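(* Let $f$ and $h$ be multiplicative functions on $\mathcal{PS}$ which are related by $h=f*\zeta$. Denote $$\kappa_n:=f(1_n,\gamma_n),\quad \kappa_{m,n}:=f(1_{m+n},\gamma_{m,n}),\quad \alpha_n:=h(1_n,\gamma_n),\quad \alpha_{m,n}:=h(1_{m+n},\gamma_{m,n}),$$ and define the generating power series $$C(x):=1+\sum_{n\ge1}\kappa_nx^n,\quad C(x,y):=\sum_{m,n\ge1}\kappa_{m,n}x^my^n,\quad M(x):=1+\sum_{n\ge1}\alpha_nx^n,\quad M(x,y):=\sum_{m,n\ge1}\alpha_{m,n}x^my^n.$$ Then, as formal power series, one has the first order relation $$C(xM(x))=M(x)$$ and for the second order $$M(x,y)=H\bigl(xM(x),yM(y)\bigr)\cdot\frac{\frac d{dx}(xM(x))}{M(x)}\cdot\frac{\frac d{dy}(yM(y))}{M(y)},$$ where $$H(x,y):=C(x,y)-xy\frac{\partial^2}{\partial x\partial y}\log\Bigl(\frac{xC(y)-yC(x)}{x-y}\Bigr),$$ or equivalently, $$M(x,y)=C\bigl(xM(x),yM(y)\bigr)\cdot\frac{\frac d{dx}(xM(x))}{M(x)}\cdot\frac{\frac d{dy}(yM(y))}{M(y)}+xy\Bigl(\frac{\frac d{dx}(xM(x))\cdot\frac d{dy}(yM(y))}{(xM(x)-yM(y))^2}-\frac1{(x-y)^2}\Bigr).$$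
   Context: Permutations are composed right to left. $\mathcal P(n)$ is the set of partitions of $[1,n]=\{1,\dots,n\}$, ordered by $\mathcal V\le\mathcal W$ iff every block of $\mathcal V$ lies in a block of $\mathcal W$; $\vee$ is the join; $1_n$ is the one-block partition. For $\pi\in S_n$, $\#\pi$ is the number of cycles, $|\pi|=n-\#\pi$, and $0_\pi\in\mathcal P(n)$ is the partition into cycles of $\pi$. For $\mathcal V\in\mathcal P(n)$, $|\mathcal V|=n-\#\mathcal V$. A partitioned permutation is a pair $(\mathcal V,\pi)$ with $\pi\in S_n$, $\mathcal V\in\mathcal P(n)$, $\mathcal V\ge0_\pi$; $\mathcal{PS}(n)$ is the set of these, $\mathcal{PS}=\bigcup_n\mathcal{PS}(n)$, and $|(\mathcal V,\pi)|=2|\mathcal V|-|\pi|$. The product is $(\mathcal V,\pi)\cdot(\mathcal W,\sigma)=(\mathcal V\vee\mathcal W,\pi\sigma)$ if $|(\mathcal V,\pi)|+|(\mathcal W,\sigma)|=|(\mathcal V\vee\mathcal W,\pi\sigma)|$, and $0$ otherwise. The convolution of $f,g:\mathcal{PS}\to\mathbb C$ is $(f*g)(\mathcal U,\gamma)=\sum f(\mathcal V,\pi)g(\mathcal W,\sigma)$ over all $(\mathcal V,\pi),(\mathcal W,\sigma)\in\mathcal{PS}(n)$ with $(\mathcal V,\pi)\cdot(\mathcal W,\sigma)=(\mathcal U,\gamma)$, for $(\mathcal U,\gamma)\in\mathcal{PS}(n)$. $f$ is multiplicative if $f(1_n,\pi)$ depends only on the conjugacy class of $\pi$ and $f(\mathcal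 V,\pi)=\prod_{V\in\mathcal V}f(1_V,\pi|_V)$ (each block $V$ being identified with $[1,|V|]$). $\zeta$ is the multiplicative function with $\zeta(\mathcal V,\pi)=1$ if $\mathcal V=0_\pi$ and $0$ otherwise. $\gamma_n=(1,2,\dots,n)\in S_n$ and $\gamma_{m,n}=(1,\dots,m)(m+1,\dots,m+n)\in S_{m+n}$. *)

(* Defs.v *)
From HB Require Import structures.
From mathcomp Require Import all_boot all_order all_algebra all_fingroup.
From mathcomp Require Import boolp reals.
From mathcomp Require Import complex.

Set Implicit Arguments.
Unset Strict Implicit.
Unset Printing Implicit Defensive.

Import GRing.Theory.
Local Open Scope ring_scope.

(* [{fps R}] is R[[x]]; two-variable series are iterated, [{fps {fps R}}], the
   outer variable being x and the inner one y: the coefficient of x^i y^j in F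
   is [fcoef (fcoef F i) j]. *)
Record fps (R : Type) := Fps { fcoef : nat -> R }.

Notation "{ 'fps' R }" := (fps R) (at level 0, format "{ 'fps'  R }").
Notation "\fps_ i E" := (Fps (fun i => E))
  (at level 36, E at level 36, i name, format "\fps_ i  E").

Lemma fpsP (R : Type) (a b : {fps R}) :
  (forall i, fcoef a i = fcoef b i) <-> a = b.
Proof.
split=> [|-> //]; case: a b => [a] [b] /= eqab.
by congr Fps; apply: funext.
Qed.

HB.instance Definition _ (R : Type) := gen_eqMixin {fps R}.
HB.instance Definition _ (R : Type) := gen_choiceMixin {fps R}.

Section FpsZmod.
Variable R : zmodType.
Implicit Types a b c : {fps R}.

Definition fps_zero : {fps R} := \fps_i 0.
Definition fps_opp a : {fps R} := \fps_i (- fcoef a i).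
Definition fps_add a b : {fps R} := \fps_i (fcoef a i + fcoef b i).

Fact fps_addA : associative fps_add.
Proof. by move=> a b c; apply/fpsP=> i /=; rewrite addrA. Qed.
Fact fps_addC : commutative fps_add.
Proof. by move=> a b; apply/fpsP=> i /=; rewrite addrC. Qed.
Fact fps_add0 : left_id fps_zero fps_add.
Proof. by move=> a; apply/fpsP=> i /=; rewrite add0r. Qed.
Fact fps_addN : left_inverse fps_zero fps_opp fps_add.
Proof. by move=> a; apply/fpsP=> i /=; rewrite addNr. Qed.

HB.instance Definition _ :=
  GRing.isZmodule.Build {fps R} fps_addA fps_addC fps_add0 fps_addN.

Lemma fcoef0 i : fcoef (0 : {fps R}) i = 0. Proof. by []. Qed.
Lemma fcoefD a b i : fcoef (a + b) i = fcoef a i + fcoef b i.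
Proof. by []. Qed.
Lemma fcoefN a i : fcoef (- a) i = - fcoef a i. Proof. by []. Qed.

End FpsZmod.

Section FpsRing.
Variable R : comNzRingType.
Implicit Types a b c : {fps R}.

Definition fps_const (r : R) : {fps R} := \fps_i (if i == 0%N then r else 0).
Definition fps_mul a b : {fps R} :=
  \fps_i (\sum_(j < i.+1) fcoef a j * fcoef b (i - j)).

Definition fps_trunc n a : {poly R} := \poly_(i < n) fcoef a i.

Fact fcoef_mul_trunc n a b i : (i < n)%N ->
  fcoef (fps_mul a b) i = (fps_trunc n a * fps_trunc n b)`_i.
Proof.
move=> lt_in; rewrite coefM; apply: eq_bigr => j _ /=.
by rewrite !coef_poly (leq_ltn_trans (leq_ord j) lt_in)
  (leq_ltn_trans (leq_subr j i) lt_in).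
Qed.

Fact coefM_eq (p q p' q' : {poly R}) i :
    (forall j, (j <= i)%N -> p`_j = p'`_j) ->
    (forall j, (j <= i)%N -> q`_j = q'`_j) ->
  (p * q)`_i = (p' * q')`_i.
Proof.
move=> eqp eqq; rewrite !coefM; apply: eq_bigr => j _.
by rewrite eqp ?leq_ord // eqq // leq_subr.
Qed.

Fact coef_trunc_mul n a b i : (i < n)%N ->
  (fps_trunc n (fps_mul a b))`_i = (fps_trunc n a * fps_trunc n b)`_i.
Proof. by move=> lt_in; rewrite coef_poly lt_in (fcoef_mul_trunc _ _ lt_in). Qed.

Fact fps_mulA : associative fps_mul.
Proof.
move=> a b c; apply/fpsP=> i; rewrite !(fcoef_mul_trunc _ _ (ltnSn i)).
rewrite (@coefM_eq _ _ (fps_trunc i.+1 a)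
           (fps_trunc i.+1 b * fps_trunc i.+1 c)) //; last first.
  by move=> j le_ji; rewrite coef_trunc_mul.
rewrite mulrA; apply: coefM_eq => // j le_ji.
by rewrite coef_trunc_mul.
Qed.

Fact fps_mulC : commutative fps_mul.
Proof.
by move=> a b; apply/fpsP=> i; rewrite !(fcoef_mul_trunc _ _ (ltnSn i)) mulrC.
Qed.

Fact fps_mul1 : left_id (fps_const 1) fps_mul.
Proof.
move=> a; apply/fpsP=> i /=; rewrite big_ord_recl /= mul1r subn0.
by rewrite big1 ?addr0 // => j _; rewrite mul0r.
Qed.

Fact fps_mulD : left_distributive fps_mul +%R.
Proof.
move=> a b c; apply/fpsP=> i /=; rewrite -big_split /=.
by apply: eq_bigr => j _; rewrite mulrDl.
Qed.

Fact fps_one_neq0 : fps_const 1 != 0.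
Proof. by apply/eqP=> /fpsP/(_ 0%N)/= /eqP; rewrite oner_eq0. Qed.

HB.instance Definition _ := GRing.Zmodule_isComNzRing.Build {fps R}
  fps_mulA fps_mulC fps_mul1 fps_mulD fps_one_neq0.

Lemma fcoef1 i : fcoef (1 : {fps R}) i = (i == 0%N)%:R.
Proof. by rewrite /=; case: eqP. Qed.
Lemma fcoefM a b i :
  fcoef (a * b) i = \sum_(j < i.+1) fcoef a j * fcoef b (i - j).
Proof. by []. Qed.

Definition fps_unit : {pred {fps R}} := fun a => `[< exists b, b * a = 1 >].

Definition fps_inv a : {fps R} :=
  if pselect (exists b, b * a = 1) is left ex_b then sval (cid ex_b) else a.

Fact fps_mulVx : {in fps_unit, left_inverse 1 fps_inv *%R}.
Proof.
move=> a /asboolP ua; rewrite /fps_inv; case: pselect => // ex_b.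
by case: cid.
Qed.

Fact fps_unitPl a b : b * a = 1 -> fps_unit a.
Proof. by move=> ba1; apply/asboolP; exists b. Qed.

Fact fps_inv_out : {in [predC fps_unit], fps_inv =1 id}.
Proof. by move=> a /asboolP nua; rewrite /fps_inv; case: pselect. Qed.

HB.instance Definition _ := GRing.ComNzRing_hasMulInverse.Build {fps R}
  fps_mulVx fps_unitPl fps_inv_out.

End FpsRing.

Section FpsIdomain.
Variable R : idomainType.
Implicit Types a b : {fps R}.

Fact fps_lowest a : a != 0 ->
  exists2 m, fcoef a m != 0 & forall i, (i < m)%N -> fcoef a i = 0.
Proof.
move=> nz_a; have ex_i : exists i, fcoef a i != 0.
  apply: contrapT => all0; case/eqP: nz_a; apply/fpsP=> i.
  by apply/eqP; apply: contrapT => /negP nz; apply: all0; exists i.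
case: (ex_minnP ex_i) => m nz_m min_m; exists m => // i lt_im.
by apply: contraTeq lt_im => /min_m; rewrite -leqNgt.
Qed.

Fact fps_mulf_eq0 a b : a * b = 0 -> (a == 0) || (b == 0).
Proof.
move=> ab0; apply/norP => -[/fps_lowest[m nz_m lo_m] /fps_lowest[n nz_n lo_n]].
have /fpsP/(_ (m + n)%N) := ab0; rewrite fcoefM fcoef0.
have lt_m : (m < (m + n).+1)%N by rewrite ltnS leq_addr.
rewrite (bigD1 (Ordinal lt_m)) //= addKn big1 ?addr0 => [/eqP|i].
  by rewrite mulf_eq0 (negPf nz_m) (negPf nz_n).
rewrite -val_eqE neq_ltn /= => /orP[lt_im | lt_mi]; first by rewrite lo_m ?mul0r.
by rewrite lo_n ?mulr0 // ltn_subLR ?leq_ord // ltn_add2r.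
Qed.

HB.instance Definition _ :=
  GRing.ComUnitRing_isIntegral.Build {fps R} fps_mulf_eq0.

End FpsIdomain.

Section FpsOperations.
Variable K : fieldType.

Definition fvar (R : comNzRingType) : {fps R} := \fps_i (i == 1%N)%:R.

Definition fderiv (R : comNzRingType) (a : {fps R}) : {fps R} :=
  \fps_i (fcoef a i.+1 *+ i.+1).

(* [in_x A] and [in_y A] are A(x) and A(y), as series in x and y. *)
Definition in_x (A : {fps K}) : {fps {fps K}} := \fps_i fps_const (fcoef A i).
Definition in_y (A : {fps K}) : {fps {fps K}} := fps_const A.

Definition deriv_x (F : {fps {fps K}}) : {fps {fps K}} := fderiv F.
Definition deriv_y (F : {fps {fps K}}) : {fps {fps K}} :=
  \fps_i fderiv (fcoef F i).

(* F(A(x)), meaningful when A has no constant term: then A^k only has terms of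
   degree at least k, so the truncated sums below are complete. The same remark
   applies to the two-variable substitution and to the logarithm. *)
Definition fcomp (F A : {fps K}) : {fps K} :=
  \fps_i (\sum_(k < i.+1) fcoef F k * fcoef (A ^+ k) i).

(* F(A, B), meaningful when A and B have no constant term. *)
Definition fcomp2 (F A B : {fps {fps K}}) : {fps {fps K}} :=
  \fps_i \fps_j (\sum_(k < (i + j).+1) \sum_(l < (i + j).+1)
    fcoef (fcoef F k) l * fcoef (fcoef (A ^+ k * B ^+ l) i) j).

(* log U = sum_{k >= 1} (-1)^(k-1) (U - 1)^k / k, meaningful when U has constant
   term 1. *)
Definition flog2 (U : {fps {fps K}}) : {fps {fps K}} :=
  \fps_i \fps_j (\sum_(1 <= k < (i + j).+1)
    (-1) ^+ k.-1 / k%:R * fcoef (fcoef ((U - 1) ^+ k) i) j).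

(* The series that an element of the fraction field of K[[x,y]] is equal to
   (0 if it is not a power series). *)
Definition frac_fps (q : {fraction {fps {fps K}}}) : {fps {fps K}} :=
  if pselect (exists p, tofrac p = q) is left ex_p then sval (cid ex_p) else 0.

Lemma frac_fpsK (p : {fps {fps K}}) : frac_fps (tofrac p) = p.
Proof.
rewrite /frac_fps; case: pselect => [ex_p|]; last by case; exists p.
by case: cid => /= p' /eqP; rewrite tofrac_eq => /eqP.
Qed.

Definition genfun (k : nat -> K) : {fps K} :=
  \fps_n (if n == 0%N then 1 else k n).

Definition genfun2 (k : nat -> nat -> K) : {fps {fps K}} :=
  \fps_m \fps_n (if (m == 0%N) || (n == 0%N) then 0 else k m n).

(* H(x,y) = C2(x,y) - x y d^2/dxdy log ((x C(y) - y C(x)) / (x - y)) *)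
Definition Hseries (C : {fps K}) (C2 : {fps {fps K}}) : {fps {fps K}} :=
  let x := in_x (fvar K) in
  let y := in_y (fvar K) in
  let U := frac_fps (tofrac (x * in_y C - y * in_x C) / tofrac (x - y)) in
  C2 - x * y * deriv_x (deriv_y (flog2 U)).

Lemma fcoef_fvarM (R : comNzRingType) (a : {fps R}) i :
  fcoef (fvar R * a) i = if i is k.+1 then fcoef a k else 0.
Proof.
rewrite fcoefM; case: i => [|i]; first by rewrite big_ord1 /= mul0r.
rewrite big_ord_recl /= mul0r add0r big_ord_recl /= mul1r subn1 /=.
by rewrite big1 ?addr0 // => j _; rewrite /= mul0r.
Qed.

Lemma fcoef_constM (R : comNzRingType) (r : R) (a : {fps R}) i :
  fcoef (fps_const r * a) i = r * fcoef a i.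
Proof.
rewrite fcoefM big_ord_recl /= subn0 big1 ?addr0 // => j _.
by rewrite mul0r.
Qed.

Lemma in_x_fvar : in_x (fvar K) = fvar {fps K}.
Proof.
apply/fpsP=> i; apply/fpsP=> j /=.
by case: (i == 1%N); rewrite /= ?fcoef1; case: eqP.
Qed.

(* The quotient whose logarithm occurs in H is a power series. *)
Lemma Hseries_quotient (C : {fps K}) :
  let x := in_x (fvar K) in
  let y := in_y (fvar K) in
  frac_fps (tofrac (x * in_y C - y * in_x C) / tofrac (x - y)) =
    \fps_i \fps_j (if (i == 0%N) && (j == 0%N) then fcoef C 0
                   else if (i == 0%N) || (j == 0%N) then 0
                   else - fcoef C (i + j)).
Proof.
move=> x y; set L := (RHS).
have -> : x * in_y C - y * in_x C = L * (x - y).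
  rewrite [L * _]mulrC mulrBl; apply/fpsP=> i; apply/fpsP=> j.
  rewrite /x /y in_x_fvar !(fcoefD, fcoefN) !fcoef_constM !fcoef_fvarM.
  case: i => [|[|i]]; case: j => [|[|j]] //=.
  all: rewrite ?addnS ?addSn ?addn0 ?add0n.
  all: rewrite ?subrr ?subr0 ?sub0r ?opprK //.
rewrite tofracM mulfK ?frac_fpsK // tofrac_eq0 subr_eq0; apply/eqP.
rewrite /x in_x_fvar => /fpsP/(_ 1%N)/fpsP/(_ 0%N)/= /eqP.
by rewrite oner_eq0.
Qed.

End FpsOperations.

Section SetPartitions.
Variable T : finType.
Implicit Types V W U : {set {set T}}.

Definition refines V W : bool := [forall A in V, [exists B in W, A \subset B]].

Definition share_block V W : rel T :=
  fun x y => [exists B in V :|: W, (x \in B) && (y \in B)].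

Definition part_join V W : {set {set T}} :=
  equivalence_partition (connect (share_block V W)) [set: T].

Fact connect_share_equiv V W :
  {in [set: T] & &, equivalence_rel (connect (share_block V W))}.
Proof.
move=> x y z _ _ _; split; first exact: connect0.
have sym : connect_sym (share_block V W).
  by apply: sym_connect_sym => u v; apply: eq_existsb => B; rewrite [(u \in B) && _]andbC.
move=> xy; apply/idP/idP => [xz|]; last exact: connect_trans.
by apply: connect_trans xz; rewrite sym.
Qed.

Lemma part_join_partition V W : partition (part_join V W) [set: T].
Proof. exact/equivalence_partitionP/connect_share_equiv. Qed.

Lemma pblock_part_join V W x y :
  (y \in pblock (part_join V W) x) = connect (share_block V W) x y.
Proof.
by rewrite pblock_equivalence_partition ?inE //; apply: connect_share_equiv.
Qed.

Lemma refines_joinl V W : partition V [set: T] -> refines V (part_join V W).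
Proof.
move=> /and3P[_ _ nV0]; apply/forallP=> A; apply/implyP=> VA.
have [A0|[x Ax]] := set_0Vmem A; first by rewrite -A0 VA in nV0.
apply/existsP; exists (pblock (part_join V W) x); apply/andP; split.
  by rewrite pblock_mem // (cover_partition (part_join_partition V W)) inE.
apply/subsetP=> y Ay; rewrite pblock_part_join; apply: connect1.
by apply/existsP; exists A; rewrite inE VA Ax Ay.
Qed.

Lemma part_joinC V W : part_join V W = part_join W V.
Proof.
rewrite /part_join; congr equivalence_partition.
by apply: funext => x; apply: funext => y; rewrite /share_block setUC.
Qed.

Lemma refines_joinr V W : partition W [set: T] -> refines W (part_join V W).
Proof. by rewrite part_joinC; apply: refines_joinl. Qed.

Lemma refines_connect V U x y : partition U [set: T] ->
  refines V U -> forall B, B \in V -> x \in B -> y \in B ->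
  pblock U x = pblock U y.
Proof.
move=> /and3P[_ tiU _] /forallP VU B VB Bx By.
have /existsP[D /andP[UD /subsetP sBD]] := implyP (VU B) VB.
by rewrite !(def_pblock tiU UD) ?sBD.
Qed.

Lemma part_join_least V W U : partition U [set: T] ->
  refines V U -> refines W U -> refines (part_join V W) U.
Proof.
move=> pU VU WU; apply/forallP=> A; apply/implyP=> JA.
have /and3P[_ tiJ nJ0] := part_join_partition V W.
have [A0|[x Ax]] := set_0Vmem A; first by rewrite -A0 JA in nJ0.
apply/existsP; exists (pblock U x); apply/andP; split.
  by rewrite pblock_mem // (cover_partition pU) inE.
apply/subsetP=> y; rewrite -(def_pblock tiJ JA Ax) pblock_part_join => xy.
suff -> : pblock U x = pblock U y.
  by rewrite mem_pblock (cover_partition pU) inE.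
have step u v : share_block V W u v -> pblock U u = pblock U v.
  case/existsP=> B /andP[]; rewrite inE => /orP[] inB /andP[Bu Bv].
    exact: (refines_connect pU VU inB).
  exact: (refines_connect pU WU inB).
case/connectP: xy => p; elim: p x {Ax} => [|z p IHp] x /=; first by move=> _ ->.
by case/andP=> /step-> pth eqy; apply: IHp.
Qed.

Lemma porbits_partition (s : {perm T}) : partition (porbits s) [set: T].
Proof.
have -> : porbits s = equivalence_partition
    (fun x y => y \in porbit s x) [set: T].
  apply/setP=> A; apply/imsetP/imsetP=> -[x _ ->]; exists x => //.
    by apply/setP=> y; rewrite !inE.
  by apply/setP=> y; rewrite !inE.
apply/equivalence_partitionP=> x y z _ _ _.
by split=> [|xy]; [apply: porbit_id | rewrite -!eq_porbit_mem; move: xy; rewrite -eq_porbit_mem => /eqP->].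
Qed.

Lemma refines_perm V (s : {perm T}) x :
  partition V [set: T] -> refines (porbits s) V -> exists2 B, B \in V & (x \in B) && (s x \in B).
Proof.
move=> pV /forallP/(_ (porbit s x)); rewrite imset_f //=.
case/existsP=> B /andP[VB /subsetP sB]; exists B => //.
rewrite !sB ?porbit_id //; first by rewrite -(expg1 s) mem_porbit.
Qed.

(* As [s * t] means "s, then t" in the library, the right-to-left composition
   of s and t is [t * s]. *)
Lemma refines_join_perm V W (s t : {perm T}) :
    partition V [set: T] -> partition W [set: T] ->
    refines (porbits s) V -> refines (porbits t) W ->
  refines (porbits (t * s)%g) (part_join V W).
Proof.
move=> pV pW sV tW; apply/forallP=> A; apply/implyP=> /imsetP[x _ ->].
apply/existsP; exists (pblock (part_join V W) x); apply/andP; split.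
  by rewrite pblock_mem // (cover_partition (part_join_partition V W)) inE.
apply/subsetP=> _ /porbitP[i ->]; rewrite pblock_part_join.
elim: i => [|i IHi]; first by rewrite expg0 perm1 connect0.
apply: connect_trans IHi _; rewrite expgSr !permM.
set y := ((t * s) ^+ i)%g x.
have [B WB /andP[By Bty]] := refines_perm y pW tW.
have [D VD /andP[Dty Dsty]] := refines_perm (t y) pV sV.
apply: (@connect_trans _ _ (t y)); apply: connect1; apply/existsP.
  by exists B; rewrite inE WB orbT By Bty.
by exists D; rewrite inE VD Dty Dsty.
Qed.

End SetPartitions.

Section PartitionedPermutations.
Variable n : nat.

Definition is_pperm (u : {set {set 'I_n}} * 'S_n) : bool :=
  partition u.1 [set: 'I_n] && refines (porbits u.2) u.1.

Definition PS := {u : {set {set 'I_n}} * 'S_n | is_pperm u}.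

Definition ppart (u : PS) : {set {set 'I_n}} := (val u).1.
Definition pperm (u : PS) : 'S_n := (val u).2.

Definition part_length (V : {set {set 'I_n}}) : int := n%:Z - #|V|%:Z.
Definition perm_length (s : 'S_n) : int := n%:Z - #|porbits s|%:Z.
Definition pp_length (u : PS) : int :=
  2 * part_length (ppart u) - perm_length (pperm u).

Fact pp_join_subproof (u v : PS) :
  is_pperm (part_join (ppart u) (ppart v), pperm v * pperm u)%g.
Proof.
have /andP[pV sV] := valP u; have /andP[pW tW] := valP v.
by rewrite /is_pperm /= part_join_partition refines_join_perm.
Qed.

(* (V \/ W, pi sigma) with pi sigma the right-to-left composition. *)
Definition pp_join (u v : PS) : PS := exist (fun w => is_pperm w) _ (pp_join_subproof u v).

(* The product, [None] standing for 0. *)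
Definition pp_mul (u v : PS) : option PS :=
  if pp_length u + pp_length v == pp_length (pp_join u v)
  then Some (pp_join u v) else None.

(* 1_n; the removal of set0 only matters for n = 0. *)
Definition part_one : {set {set 'I_n}} := [set [set: 'I_n]] :\ set0.

Fact pp_one_subproof (s : 'S_n) : is_pperm (part_one, s).
Proof.
have in1 (x : 'I_n) : [set: 'I_n] \in part_one.
  by rewrite !inE eqxx andbT; apply/set0Pn; exists x.
apply/andP; split=> /=; last first.
  apply/forallP=> A; apply/implyP=> /imsetP[x _ _].
  by apply/existsP; exists [set: 'I_n]; rewrite (in1 x) subsetT.
apply/and3P; split; last by rewrite !inE eqxx.
  apply/eqP/setP=> x; rewrite inE; apply/bigcupP.
  by exists [set: 'I_n]; rewrite ?in1 ?inE.
by apply/trivIsetP=> A B; rewrite !inE => /andP[_ /eqP->] /andP[_ /eqP->]; rewrite eqxx.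
Qed.

Definition pp_one (s : 'S_n) : PS := exist (fun w => is_pperm w) _ (pp_one_subproof s).

(* s|_B with B identified to [1,#|B|] through its increasing enumeration.
   [restr_perm B s] is s on B whenever s stabilises B. *)
Definition block_fun (s : 'S_n) (B : {set 'I_n}) (i : 'I_#|B|) : 'I_#|B| :=
  enum_rank_in (enum_valP i) (restr_perm B s (enum_val i)).

Fact block_fun_inj (s : 'S_n) (B : {set 'I_n}) : injective (@block_fun s B).
Proof.
have stabB x : x \in B -> restr_perm B s x \in B.
  by move=> Bx; have := imset_f (restr_perm B s) Bx; rewrite im_restr_perm.
have stab (i : 'I_#|B|) := stabB _ (enum_valP i).
move=> i j /(enum_rank_in_inj (stab i) (stab j)) /perm_inj.
exact: enum_val_inj.
Qed.

Definition block_perm (s : 'S_n) (B : {set 'I_n}) : 'S_#|B| :=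
  perm (@block_fun_inj s B).

End PartitionedPermutations.

Section Functions.
Variable K : fieldType.

Definition multiplicative (f : forall n, PS n -> K) : Prop :=
  (forall n (s t : 'S_n), f n (pp_one (s ^ t)%g) = f n (pp_one s)) /\
  (forall n (u : PS n),
     f n u = \prod_(B in ppart u) f #|B| (pp_one (block_perm (pperm u) B))).

Definition convolution (f g : forall n, PS n -> K) n (u : PS n) : K :=
  \sum_(p : PS n * PS n | pp_mul p.1 p.2 == Some u) f n p.1 * g n p.2.

Definition zeta n (u : PS n) : K := (ppart u == porbits (pperm u))%:R.

End Functions.

(* [ordS] is i |-> i + 1 mod n. *)
Definition gamma n : 'S_n := perm (@ordS_inj n).

Section Gamma2.
Variables m n : nat.

Definition gamma2_fun (i : 'I_(m + n)) : 'I_(m + n) :=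
  match split i with
  | inl j => lshift n (ordS j)
  | inr k => rshift m (ordS k)
  end.

Fact gamma2_fun_inj : injective gamma2_fun.
Proof.
move=> i j; rewrite /gamma2_fun.
case: splitP => i' def_i; case: splitP => j' def_j => /eqP.
- by rewrite (inj_eq (@lshift_inj _ _)) => /eqP/ordS_inj eq_ij; apply: val_inj; rewrite /= def_i def_j eq_ij.
- by rewrite eq_lrshift.
- by rewrite eq_rlshift.
- by rewrite (inj_eq (@rshift_inj _ _)) => /eqP/ordS_inj eq_ij; apply: val_inj; rewrite /= def_i def_j eq_ij.
Qed.

Definition gamma2 : 'S_(m + n) := perm gamma2_fun_inj.

End Gamma2.

(* Main.v *)
(* Removing one point x from the cycle structure gives loop equations.  Write
   gamma = pi sigma and delete x; if pi(j) = x and gamma(k) = x, then pi becomes a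
   permutation pi' of the remaining points, gamma becomes (j k) gamma' -- which cuts
   a cycle of gamma in two or joins two of them -- and the number of cycles of sigma
   changes in such a way that planarity is preserved.  The weight of the cycle of x
   is not lost if the mass of x is transferred to j.  Let A_a(x) be the generating
   series of planar pi for one cycle whose marked point has mass a + 1 (and
   A_a(0) = kappa_a).  The recursion reads A_a = kappa_a + x M(x) A_{a+1}, whence
   M = A_0 = C(xM).  With a second cycle, joining the two contributes
   Q_a = sum_{m,n} n A_a(m+n) x^m y^n, and the generating series T_a satisfies
   T_a = xM(x) T_{a+1} + x A_{a+1}(x) T_0 + x Q_{a+1}.  Both systems are solved by
   summing over a against powers of xM(x).  The remaining contributions to
   alpha_{m,n}, in which a block of V contains one cycle of pi from each side, are
   products of derivatives of the first order moments with respect to the kappa_p. *)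
Require Import Defs.
From mathcomp Require Import all_boot all_order all_algebra all_fingroup.
From mathcomp Require Import reals complex.
From mathcomp Require Import boolp zify ring.

Set Implicit Arguments.
Unset Strict Implicit.
Unset Printing Implicit Defensive.
Import GRing.Theory.

(** * Cycles and genus *)

Local Open Scope group_scope.

Section Stable.
Variable T : finType.
Implicit Types (s t : {perm T}) (A B C : {set T}).

(** Deleting a point shortens its cycle, so the moments alone satisfy no closed recursion; hence the
    whole family indexed by a mass is carried along. Planarity is the equality case of a bound on
    numbers of cycles on a connected set. This makes the cut work: the count then exceeds the bound
    for a connected set by 2, so there must be two components, and each attains its own bound. The
    same bound decides which pairs occur in the convolution. As [zeta] forces W = 0_sigma with sigma
    = pi^-1 gamma, a term is given by (V, pi) alone; for one cycle V = 0_pi is forced, for two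
    cycles V is 0_pi or merges exactly one cycle of pi from each side. Series identities come from
    comparing two families with the same relation e_a = c_a + z e_(a+1), z = xM(x): their difference
    is divisible by all powers of z, which replaces rearrangements of infinite sums. The annular
    part depends on kappa through M only, and the logarithm in H accounts for it, because x C(y) - y
    C(x) becomes (x - y) M(x) M(y) at (xM(x), yM(y)). *)

Definition stab A s := [forall p, (s p \in A) == (p \in A)].

Lemma stabP A s : reflect (forall p, (s p \in A) = (p \in A)) (stab A s).
Proof. exact: 'forall_eqP. Qed.

Lemma stabE A s p : stab A s -> (s p \in A) = (p \in A).
Proof. by move/stabP. Qed.

(** [stab] allows points outside A to move. One permutation of the whole type can therefore be
    studied on several disjoint pieces without being changed. *)
Lemma stab_perm_on A s : perm_on A s -> stab A s.
Proof. by move=> sA; apply/stabP=> p; rewrite perm_closed. Qed.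

Lemma stabM A s t : stab A s -> stab A t -> stab A (s * t).
Proof. by move=> As At; apply/stabP=> p; rewrite permM !stabE. Qed.

Lemma stabV A s : stab A s -> stab A s^-1.
Proof. by move=> As; apply/stabP=> p; rewrite -(stabE _ As) permKV. Qed.

Lemma stab_tperm A a b : (a \in A) = (b \in A) -> stab A (tperm a b).
Proof. by move=> ab; apply/stabP=> p; case: tpermP => [->|->|]. Qed.

Lemma stabMl A s t : stab A s -> stab A (s * t) -> stab A t.
Proof. by move=> As Ast; rewrite -(mulKg s t) stabM ?stabV. Qed.

Lemma stabD A B s : stab A s -> stab B s -> stab (A :\: B) s.
Proof. by move=> As Bs; apply/stabP=> p; rewrite !inE !stabE. Qed.

Lemma stabI A B s : stab A s -> stab B s -> stab (A :&: B) s.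
Proof. by move=> As Bs; apply/stabP=> p; rewrite !inE !stabE. Qed.

Lemma stabU A B s : stab A s -> stab B s -> stab (A :|: B) s.
Proof. by move=> As Bs; apply/stabP=> p; rewrite !inE !stabE. Qed.

Lemma stab1 x s : s x = x -> stab [set x] s.
Proof.
by move=> sx; apply/stabP=> p; rewrite !inE -[in LHS]sx (inj_eq perm_inj).
Qed.

Lemma stabT s : stab setT s.
Proof. by apply/stabP=> p; rewrite !inE. Qed.

Lemma stab_closed A s : {in A, forall p, s p \in A} -> stab A s.
Proof.
move=> cl; have im : s @: A = A.
  by apply/eqP; rewrite eqEcard card_imset ?leqnn ?andbT;
    [apply/subsetP=> _ /imsetP[p Ap ->]; apply: cl | apply: perm_inj].
by apply/stabP=> p; rewrite -[in LHS]im mem_imset //; apply: perm_inj.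
Qed.

Lemma porbit_sub A s p : {in A, forall q, s q \in A} -> p \in A -> porbit s p \subset A.
Proof.
move=> cl Ap; apply/subsetP=> _ /porbitP[i ->].
by elim: i => [|i IHi]; rewrite ?expg0 ?perm1 // expgSr permM cl.
Qed.

Lemma porbit_stab_sub A s p : stab A s -> p \in A -> porbit s p \subset A.
Proof. by move=> As; apply: porbit_sub => q; rewrite stabE. Qed.

Lemma mem_porbit_s s p : s p \in porbit s p.
Proof. by have := mem_porbit s 1 p; rewrite expg1. Qed.

Lemma stab_porbit s p : stab (porbit s p) s.
Proof.
apply: stab_closed => q; rewrite -!eq_porbit_mem => /eqP <-.
by rewrite eq_porbit_mem mem_porbit_s.
Qed.

Lemma porbit_fix s p : s p = p -> porbit s p = [set p].
Proof.
move=> sp; apply/eqP; rewrite eqEsubset sub1set porbit_id andbT.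
by apply: porbit_stab_sub; rewrite ?stab1 ?inE.
Qed.

Lemma porbit_agree A s t : stab A s -> {in A, s =1 t} ->
  {in A, porbit s =1 porbit t}.
Proof.
move=> As st p Ap; have st_sub q : q \in porbit s p -> q \in A.
  by apply/subsetP/porbit_stab_sub.
apply/eqP; rewrite eqEsubset; apply/andP; split.
  suff: porbit s p \subset A :&: porbit t p by rewrite subsetI => /andP[].
  apply: porbit_sub; last by rewrite inE Ap porbit_id.
  move=> q; rewrite !inE => /andP[Aq tq]; rewrite (stabE _ As) Aq st //=.
  by rewrite stabE ?stab_porbit.
apply: porbit_sub; last exact: porbit_id.
by move=> q sq; rewrite -st ?st_sub // (stabE _ (stab_porbit s p)).
Qed.

Lemma porbit_join s a b : a \notin porbit s b ->
  porbit (tperm a b * s) a = porbit s a :|: porbit s b.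
Proof.
move=> nab; set t := tperm a b * s.
have ne_ab : a != b by apply: contraNneq nab => ->; rewrite porbit_id.
have ta : t a = s b by rewrite permM tpermL.
have tb : t b = s a by rewrite permM tpermR.
(* Otherwise the transposition would lower the number of cycles both from [s] to [t] and from [t]
   back to [s]. *)
have ab : a \in porbit t b.
  apply: contraT => nt; have := porbits_mul_tperm t a b;
    rewrite /= {1}/t mulgA tperm2 mul1g.
  have := porbits_mul_tperm s a b; rewrite /= -/t nt nab ne_ab; lia.
have eq_ab : porbit t a = porbit t b by apply/eqP; rewrite eq_porbit_mem.
apply/eqP; rewrite eqEsubset; apply/andP; split.
  apply: porbit_stab_sub; last by rewrite inE porbit_id.
  apply: stabM; last by rewrite stabU ?stab_porbit.
  by apply: stab_tperm; rewrite !inE !porbit_id orbT.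
have cl : {in porbit t a, forall q, s q \in porbit t a}.
  move=> q tq; have [->|qa] := eqVneq q a; first by rewrite -tb eq_ab mem_porbit_s.
  have [->|qb] := eqVneq q b; first by rewrite -ta mem_porbit_s.
  have -> : s q = t q by rewrite permM tpermD // eq_sym.
  by rewrite stabE ?stab_porbit.
by rewrite subUset !porbit_sub // ?porbit_id // eq_ab porbit_id.
Qed.

Lemma porbit_exp_neq s p i : 0 < i < #|porbit s p| -> (s ^+ i) p != p.
Proof.
case/andP=> i0 lt_i; apply/eqP=> e; have := uniq_traject_porbit s p.
rewrite -(ltn_predK lt_i) /= => /andP[/negP []]; apply/trajectP.
by exists i.-1; [lia | rewrite -iterSr prednK // -permX e].
Qed.

(** From a = s^i b the new permutation goes to s b, and it agrees with s on the points strictly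
    between: its cycle through a is s b, ..., s^i b. *)
Lemma card_porbit_cut s b i : 0 < i < #|porbit s b| ->
  let t := tperm ((s ^+ i) b) b * s in
  #|porbit t ((s ^+ i) b)| = i /\ b \notin porbit t ((s ^+ i) b).
Proof.
move=> lt_i; set a := (s ^+ i) b; move=> t.
have ne_ab : a != b by apply: porbit_exp_neq.
have inj k l : 0 < k <= i -> 0 < l <= i -> (s ^+ k) b = (s ^+ l) b -> k = l.
  wlog lt_kl : k l / k < l => [wl ki li e|ki li].
    by case: (ltngtP k l) => // lt_kl; [|symmetry]; apply: wl.
  rewrite -[l](subnK (ltnW lt_kl)) expgD permM => /perm_inj/esym/eqP.
  by rewrite (negPf (porbit_exp_neq _)) //; lia.
have tE k : 0 < k < i -> t ((s ^+ k) b) = (s ^+ k.+1) b.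
  move=> ki; rewrite permM expgSr permM tpermD //.
    by apply/eqP=> /inj; lia.
  by rewrite eq_sym porbit_exp_neq //; lia.
have ta : t a = s b by rewrite permM tpermL.
have tX k : k < i -> (t ^+ k.+1) a = (s ^+ k.+1) b.
  elim: k => [|k IHk] lt_k; first by rewrite !expg1.
  by rewrite expgSr permM IHk ?tE //; lia.
have i0 : 0 < i by lia.
pose C := [set (s ^+ (k : 'I_i).+1) b | k in 'I_i].
have CP k : 0 < k <= i -> (s ^+ k) b \in C.
  by move=> ki; apply/imsetP; have lt_k : k.-1 < i by [lia]; exists (Ordinal lt_k);
    rewrite //= prednK //; lia.
have -> : porbit t a = C.
  apply/eqP; rewrite eqEsubset; apply/andP; split.
    apply: porbit_sub; last by apply: CP; lia.
    move=> _ /imsetP[k _ ->]; have [lt_k|ge_k] := ltnP k.+1 i.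
      by rewrite tE ?CP //; lia.
    have -> : k.+1 = i by have := ltn_ord k; lia.
    by rewrite -/a ta; have := CP 1%N; rewrite expg1; apply; lia.
  by apply/subsetP=> _ /imsetP[k _ ->]; rewrite -tX // mem_porbit.
split.
  rewrite card_imset ?card_ord // => k l /inj e; apply: val_inj.
  by apply: succn_inj; apply: e; rewrite /= ltn_ord.
apply/imsetP=> -[k _ /esym/eqP]; apply/negP/porbit_exp_neq.
by have := ltn_ord k; lia.
Qed.

(** As [s] fixes x, the product sends j to x and x to [s j]: x is inserted right after j. This is
    the form in which a deleted point is put back. *)
Lemma porbit_insert s x j p : s x = x -> j != x -> p != x ->
  porbit (tperm j x * s) p =
    if j \in porbit s p then x |: porbit s p else porbit s p.
Proof.
move=> sx jx px; case: ifP => [jp|/negbT jp]; last first.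
  apply/esym/(@porbit_agree (porbit s p)); rewrite ?stab_porbit ?porbit_id //.
  move=> q qp; rewrite permM tpermD //; first by apply: contraNneq jp => ->.
  by apply: contraNneq px => xq; rewrite -in_set1 -(porbit_fix sx) porbit_sym xq.
have nj : j \notin porbit s x by rewrite porbit_fix ?inE.
have e := porbit_join nj; move: jp; rewrite -eq_porbit_mem => /eqP ejp.
rewrite ejp (porbit_fix sx) setUC in e; rewrite -e; apply/eqP.
by rewrite eq_porbit_mem e !inE porbit_id orbT.
Qed.

Lemma porbit_conj s t p : porbit (s ^ t) (t p) = t @: porbit s p.
Proof.
apply/setP=> q; apply/porbitP/imsetP=> [[i ->]|[_ /porbitP[i ->] ->]].
  by exists ((s ^+ i) p); rewrite ?mem_porbit // -conjXg permJ.
by exists i; rewrite -conjXg permJ.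
Qed.

Definition cycs A s := [set porbit s p | p in A].
Definition ncyc A s := #|cycs A s|.

Lemma cycs_agree A s t : stab A s -> {in A, s =1 t} -> cycs A s = cycs A t.
Proof. by move=> As st; apply: eq_in_imset; apply: porbit_agree. Qed.

Lemma cycs_porbit s p : cycs (porbit s p) s = [set porbit s p].
Proof.
apply/setP=> c; rewrite inE; apply/imsetP/eqP=> [[q pq ->]|->].
  by apply/eqP; rewrite eq_porbit_mem.
by exists p; rewrite ?porbit_id.
Qed.

Lemma ncyc_porbit s p : ncyc (porbit s p) s = 1%N.
Proof. by rewrite /ncyc cycs_porbit cards1. Qed.

Lemma disjoint_cycs A B s : stab A s -> [disjoint A & B] ->
  [disjoint cycs A s & cycs B s].
Proof.
move=> As dAB; apply/pred0P=> C /=; apply/negP=> /andP[/imsetP[p Ap ->]].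
case/imsetP=> q Bq e; have: q \in porbit s p by rewrite e porbit_id.
move/(subsetP (porbit_stab_sub As Ap)) => Aq.
by move/pred0P/(_ q): dAB; rewrite /= Aq Bq.
Qed.

Lemma ncycU A B s : stab A s -> [disjoint A & B] ->
  ncyc (A :|: B) s = ncyc A s + ncyc B s.
Proof.
move=> As dAB; rewrite /ncyc /cycs imsetU cardsU; have := disjoint_cycs As dAB.
by rewrite -setI_eq0 => /eqP ->; rewrite cards0 subn0.
Qed.

Lemma ncycT s : ncyc [set: T] s = #|porbits s|.
Proof. by congr #|pred_of_set _|; apply/setP=> C; apply/imsetP/imsetP=> -[p _ ->];
  exists p; rewrite ?inE. Qed.

Lemma ncycD A B s : stab B s -> B \subset A ->
  ncyc A s = ncyc B s + ncyc (A :\: B) s.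
Proof.
move=> Bs sBA; rewrite -{1}(setID A B) (setIidPr sBA) ncycU //.
by apply/pred0P=> p; rewrite /= !inE; case: (p \in B).
Qed.

Lemma ncyc_fix A s x : s x = x -> x \in A -> ncyc A s = (ncyc (A :\ x) s).+1.
Proof.
move=> sx Ax; rewrite (@ncycD A [set x]) ?stab1 ?sub1set // /ncyc /cycs.
by rewrite imset_set1 cards1.
Qed.

Lemma ncyc_tperm A s a b : stab A s -> a \in A -> b \in A ->
  ncyc A (tperm a b * s) + (a \notin porbit s b).*2 = ncyc A s + (a != b).
Proof.
move=> As Aa Ab; have At : stab A (tperm a b * s).
  by rewrite stabM // stab_tperm // Aa Ab.
have := porbits_mul_tperm s a b; rewrite /= -!ncycT.
rewrite !(@ncycD setT A) ?subsetT // (_ : ncyc (_ :\: A) _ = ncyc (setT :\: A) s);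
  first lia.
rewrite /ncyc (@cycs_agree _ _ s) //.
  by apply/stabP=> p; rewrite !inE stabE.
move=> p; rewrite !inE andbT => nAp.
by rewrite permM tpermD //; apply: contraNneq nAp => <-.
Qed.

Lemma ncyc_insert A s x j : stab A s -> s x = x -> x \in A -> j \in A :\ x ->
  ncyc A (tperm j x * s) = ncyc (A :\ x) s.
Proof.
move=> As sx Ax; rewrite !inE => /andP[jx Aj].
have := ncyc_tperm As Aj Ax; rewrite porbit_fix // inE jx (ncyc_fix sx Ax); lia.
Qed.

Lemma ncyc_conj A s t : stab A t -> ncyc A (s ^ t) = ncyc A s.
Proof.
move=> At; rewrite /ncyc -(card_imset (mem (cycs A s)) (imset_inj (@perm_inj _ t))).
congr #|pred_of_set _|; apply/setP=> C; apply/imsetP/imsetP.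
  case=> p Ap ->; exists (porbit s (t^-1 p)); last by rewrite -porbit_conj permKV.
  by apply: imset_f; rewrite stabE ?stabV.
case=> _ /imsetP[p Ap ->] ->; exists (t p); first by rewrite stabE.
by rewrite porbit_conj.
Qed.

Lemma ncyc_agree A s t : stab A s -> {in A, s =1 t} -> ncyc A s = ncyc A t.
Proof. by move=> As st; rewrite /ncyc (cycs_agree As st). Qed.

(* A labelling invariant under s and g, and as coarse as the genus allows, is
   obtained by building s from transpositions: each one merging two labels also
   merges two cycles of s^-1 g. *)
Lemma genus_labelling s (g : {perm T}) : exists c : {ffun T -> {set T}},
  [/\ forall p, c (s p) = c p, forall p, c (g p) = c p &
      #|porbits s| + #|porbits (g * s^-1)| + #|porbits g|
        <= #|T| + 2 * #|c @: [set: T]|].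
Proof.
have [n] := ubnP #|[set p | s p != p]|; elim: n s => // n IHn s lt_n.
have [s0|[x]] := set_0Vmem [set p | s p != p].
  have -> : s = 1.
    by apply/permP=> p; rewrite perm1; apply/eqP; move/setP/(_ p): s0;
      rewrite !inE => /negbFE.
  exists [ffun p => porbit g p]; split=> [p|p|].
  - by rewrite perm1.
  - by rewrite !ffunE; have := porbit_perm g 1 p; rewrite expg1.
  rewrite invg1 mulg1 (_ : porbits 1 = [set [set x] | x in T]).
    rewrite (card_imset _ (@set1_inj T)).
    rewrite (_ : _ @: _ = porbits g).
      by rewrite mul2n -addnn addnA leqnn.
    by apply/setP=> C; apply/imsetP/imsetP=> -[p _ ->]; exists p; rewrite ?inE ?ffunE.
  by apply/setP=> C; apply/imsetP/imsetP=> -[p _ ->]; exists p;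
    rewrite // porbit_fix ?perm1.
rewrite inE => sx; set j := s^-1 x; have sj : s j = x by rewrite permKV.
have jx : j != x by apply: contraNneq sx => e; rewrite -{1}e sj.
pose s' := tperm j x * s; have s'x : s' x = x by rewrite permM tpermR.
have es : s = tperm j x * s' by rewrite mulgA tperm2 mul1g.
have [|c [cs cg le_c]] := IHn s'.
  apply: leq_trans (lt_n : _ <= n); apply: proper_card; apply/properP; split.
    apply/subsetP=> p; rewrite !inE permM; case: tpermP => [->|->|//].
      by rewrite sj [x == j]eq_sym jx.
    by rewrite sj eqxx.
  by exists x; rewrite !inE ?s'x ?eqxx.
have := porbits_mul_tperm s' j x; rewrite /= -es porbit_fix // inE jx.
have := porbits_mul_tperm (g * s'^-1)^-1 j x; rewrite /=.
have -> : tperm j x * (g * s'^-1)^-1 = (g * s^-1)^-1 by rewrite es !invMg !invgK mulgA.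
rewrite !porbitsV porbitV jx => cardg cards.
have cr p q : p \in porbit (g * s'^-1) q -> c p = c q.
  case/porbitP=> i ->; elim: i => [|i IHi]; first by rewrite expg0 perm1.
  by rewrite expgSr !permM -[c (s'^-1 _)]cs permKV cg.
(* Going from [s'] to [s] loses one cycle and the quotient gains at most one, so equal labels need
   no change. *)
have [cjx|cjx] := eqVneq (c j) (c x).
  exists c; split=> // [p|]; last first.
    apply: leq_trans le_c; rewrite leq_add2r; move: cardg cards.
    by move: #|_| #|_| #|_| #|_| (_ \notin _) => k1 k2 k3 k4 []; lia.
 
  by rewrite es permM cs; case: tpermP => [->|->|].
have /negPf nj : j \notin porbit (g * s'^-1) x by apply: contraNN cjx => /cr ->.
(* Here j and x lie on distinct cycles of the quotient, because [c] is constant on each; both counts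
   then fall by one, which pays for the lost label. *)
pose d := [ffun p => if c p == c x then c j else c p].
exists d; split=> [p|p|].
- by rewrite !ffunE es permM cs; case: tpermP => [->|->|] //; rewrite eqxx (negPf cjx).
- by rewrite !ffunE cg.
have le_d : #|c @: setT| <= #|d @: setT|.+1.
  rewrite (cardsD1 (c x)) imset_f ?inE // ltnS; apply/subset_leq_card/subsetP=> C.
  rewrite !inE => /andP[Cx /imsetP[p _ eC]]; apply/imsetP; exists p => //.
  by rewrite ffunE -eC (negPf Cx).
have arith k0 k1 k2 k3 k4 k5 n1 n2 : k1 + k3 + k5 <= k0 + 2 * n1 -> n1 <= n2.+1 ->
  k4 + 2 = k3 + 1 -> k2 + 2 = k1 + 1 -> k2 + k4 + k5 <= k0 + 2 * n2 by lia.
by rewrite nj in cardg; apply: arith le_c le_d cardg cards.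
Qed.

End Stable.

(** * Connected planar pairs on a stable set *)

Section Connected.
Variable T : finType.
Implicit Types (s t g : {perm T}) (A B C : {set T}).

(** On a stable set A this is transitivity of the group generated by [s] and [g]. Stable subsets are
    used because they behave well under restriction and under deletion of a point. *)
Definition connected_on A s g :=
  [forall B : {set T}, [&& B \subset A, stab B s & stab B g] ==>
     (B == set0) || (B == A)].

Lemma connected_onP A s g : reflect
  (forall B, B \subset A -> stab B s /\ stab B g ->
    B = set0 \/ B = A) (connected_on A s g).
Proof.
apply: (iffP forallP) => [h B sBA [Bs Bg]|h B]; last first.
  apply/implyP=> /and3P[sBA Bs Bg]; case: (h B sBA (conj Bs Bg)) => /eqP -> //.
  by rewrite orbT.
by have /implyP := h B; rewrite sBA Bs Bg => /(_ isT)/orP[]/eqP; [left|right].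
Qed.

Lemma stab_agree A B s t : B \subset A -> {in A, s =1 t} -> stab B s -> stab B t.
Proof.
move=> /subsetP sBA st Bs; apply: stab_closed => p Bp.
by rewrite -st ?sBA // stabE.
Qed.

Lemma connected_on_agree A s s' g g' : {in A, s =1 s'} -> {in A, g =1 g'} ->
  connected_on A s g = connected_on A s' g'.
Proof.
move=> ss gg; apply/connected_onP/connected_onP=> h B sBA [Bs Bg]; apply: h => //; split.
- by apply: (stab_agree sBA _ Bs) => p Ap; rewrite ss.
- by apply: (stab_agree sBA _ Bg) => p Ap; rewrite gg.
- exact: (stab_agree sBA ss Bs).
- exact: (stab_agree sBA gg Bg).
Qed.

(* The equality case of [genus_bound]. As [g * s^-1] means "g, then s^-1", it is
   the sigma of g = s sigma in right-to-left notation. *)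
Definition planar A g s :=
  ncyc A s + ncyc A (g * s^-1) + ncyc A g == #|A| + 2.

Definition connected_planar A g s := connected_on A s g && planar A g s.

Lemma quot_agree A s s' g g' : stab A s -> stab A g ->
  {in A, s =1 s'} -> {in A, g =1 g'} -> {in A, g * s^-1 =1 g' * s'^-1}.
Proof.
move=> As Ag ss gg p Ap; rewrite !permM gg //; apply: (@perm_inj _ s'); rewrite permKV.
by rewrite -ss ?permKV ?gg // stabE ?stabV // -gg // stabE.
Qed.

Lemma planar_agree A s s' g g' : stab A s -> stab A g ->
  {in A, s =1 s'} -> {in A, g =1 g'} -> planar A g s = planar A g' s'.
Proof.
move=> As Ag ss gg; rewrite /planar (ncyc_agree As ss) (ncyc_agree Ag gg).
by rewrite (ncyc_agree _ (quot_agree As Ag ss gg)) // stabM ?stabV.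
Qed.

Lemma connected_planar_agree A s s' g g' : stab A s -> stab A g ->
  {in A, s =1 s'} -> {in A, g =1 g'} -> connected_planar A g s = connected_planar A g' s'.
Proof.
by move=> As Ag ss gg;
  rewrite /connected_planar (connected_on_agree ss gg) (planar_agree As Ag ss gg).
Qed.

Lemma restr_permE_stab A s : stab A s -> {in A, restr_perm A s =1 s}.
Proof.
move=> As p Ap; apply: restr_permE => //; apply/astabsP=> q.
by rewrite /= apermE stabE.
Qed.

Lemma ncyc_perm_on A s : perm_on A s -> #|porbits s| = ncyc A s + #|~: A|.
Proof.
move=> As; rewrite -ncycT (@ncycD _ _ A) ?subsetT ?stab_perm_on // setTD.
congr (_ + _); rewrite -(card_imset (mem (~: A)) (@set1_inj T)); congr #|pred_of_set _|.
by apply: eq_in_imset => p /[!inE] Ap; rewrite porbit_fix // (out_perm As).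
Qed.

(** Made trivial outside A, the permutations have [#|~: A|] extra fixed points in each of the three
    counts. Connectedness makes the labelling of [genus_labelling] constant on A, so that it has at
    most [#|~: A| + 1] values. *)
Lemma genus_bound A s g x : stab A s -> stab A g -> x \in A -> connected_on A s g ->
  ncyc A s + ncyc A (g * s^-1) + ncyc A g <= #|A| + 2.
Proof.
wlog [As Ag] : s g / perm_on A s /\ perm_on A g => [wl As Ag Ax cA|].
  have es := restr_permE_stab As; have eg := restr_permE_stab Ag.
  have rs := stab_perm_on (restr_perm_on A s);
    have rg := stab_perm_on (restr_perm_on A g).
  have := wl (restr_perm A s) (restr_perm A g) (conj (restr_perm_on _ _) (restr_perm_on
    _ _)) rs rg Ax.
  rewrite (connected_on_agree es eg) (ncyc_agree rs es) (ncyc_agree rg eg);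
    move=> /(_ cA).
  by rewrite (ncyc_agree _ (quot_agree rs rg es eg)) // stabM ?stabV.
move=> As' Ag' Ax cA.
have [c [cs cr]] := genus_labelling s g.
rewrite !(ncyc_perm_on As, ncyc_perm_on Ag) (@ncyc_perm_on A (g * s^-1)); last first.
  by apply: perm_onM => //; apply: perm_onV.
suff: #|c @: setT| <= #|~: A| + 1.
  have := cardsC A; move: #|A| #|~: A| #|T| #|_ @: _| => a b d e <-; lia.
have cx : {in A, forall p, c p = c x}.
  pose B := [set p in A | c p == c x].
  have [||B0|eB] := (connected_onP _ _ _ cA) B.
  - by apply/subsetP=> p; rewrite inE => /andP[].
  - by split; apply/stabP=> p; rewrite !inE ?cs ?cr stabE.
  - by move/setP/(_ x): B0; rewrite !inE Ax eqxx.
  by move=> p Ap; move/setP/(_ p): eB; rewrite !inE Ap => /eqP.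
rewrite addnC.
apply: (@leq_trans #|c x |: c @: (~: A)|).
  apply/subset_leq_card/subsetP=> _ /imsetP[p _ ->]; rewrite !inE.
  by case: (boolP (p \in A)) => [/cx ->|nAp]; rewrite ?eqxx // imset_f ?orbT ?inE.
by rewrite cardsU1 leq_add ?leq_b1 ?leq_imset_card.
Qed.

Lemma perm_fixV s x : s x = x -> s^-1 x = x.
Proof. by move=> {1}<-; rewrite permK. Qed.

(** * Deleting a point x from a connected planar pair *)

Section Insert.
Variables (A : {set T}) (x : T).
Hypothesis Ax : x \in A.
Let A' := A :\ x.

(** x behaves as a copy of j: a set that treats both alike is determined by its trace on [A']. [Q]
    stands for the stability conditions, which differ between the ways of inserting x. *)
Lemma connected_on_extend (Q : {set T} -> Prop) j : j \in A' ->
    (forall B, Q B -> Q (B :\ x)) -> (forall B, Q B -> Q (x |: B)) ->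
  (forall B, B \subset A -> Q B /\ (x \in B) = (j \in B) -> B = set0 \/ B = A) <->
  (forall B, B \subset A' -> Q B -> B = set0 \/ B = A').
Proof.
move=> Aj QD QU; have [jx Aj'] : j != x /\ j \in A by apply/andP; rewrite !inE in Aj.
split=> h B sBA QB; last first.
  case: QB => QB xj; have [||B0|B1] := h (B :\ x); rewrite ?setSD //; first exact: QD.
  - left; apply/setP=> p; rewrite !inE; have [->|px] := eqVneq p x.
      by rewrite xj; move/setP/(_ j): B0; rewrite !inE jx.
    by move/setP/(_ p): B0; rewrite !inE px.
  right; apply/setP=> p; have [->|px] := eqVneq p x; last first.
    by move/setP/(_ p): B1; rewrite !inE px.
  by rewrite xj Ax; move/setP/(_ j): B1; rewrite !inE jx Aj'.
have nBx : x \notin B by apply/negP=> /(subsetP sBA); rewrite !inE eqxx.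
have sBA' : B \subset A by apply: subset_trans sBA (subsetDl _ _).
have [Bj|nBj] := boolP (j \in B).
  have [||B0|B1] := h (x |: B).
  - by rewrite subUset sub1set Ax.
  - by split; [apply: QU | rewrite !inE eqxx Bj orbT].
  - by move/setP/(_ x): B0; rewrite !inE eqxx.
  by right; rewrite /A' -B1 setU1K.
have [||B0|B1] := h B => //.
- by rewrite (negPf nBx) (negPf nBj).
- by left.
by rewrite B1 Ax in nBx.
Qed.

Variables (s g : {perm T}).
Hypotheses (As : stab A s) (Ag : stab A g) (sx : s x = x) (gx : g x = x).

Let QD B : stab B s /\ stab B g -> stab (B :\ x) s /\ stab (B :\ x) g.
Proof. by case=> Bs Bg; rewrite !stabD ?stab1. Qed.

Let QU B : stab B s /\ stab B g -> stab (x |: B) s /\ stab (x |: B) g.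
Proof. by case=> Bs Bg; rewrite !stabU ?stab1. Qed.

Lemma stab_tpermMl j t B : t x = x ->
  stab B (tperm j x * t) <-> (x \in B) = (j \in B) /\ stab B t.
Proof.
move=> tx; split=> [Bt|[xj Bt]]; last by rewrite stabM // stab_tperm.
have xj : (x \in B) = (j \in B) by rewrite -(stabE j Bt) permM tpermL tx.
by split=> //; apply: stabMl Bt; rewrite stab_tperm.
Qed.

Lemma connected_on_equiv s1 g1 s2 g2 A1 A2 :
  ((forall B, B \subset A1 -> stab B s1 /\ stab B g1 -> B = set0 \/ B = A1) <->
   (forall B, B \subset A2 -> stab B s2 /\ stab B g2 -> B = set0 \/ B = A2)) ->
  connected_on A1 s1 g1 = connected_on A2 s2 g2.
Proof. by move=> e; apply/connected_onP/connected_onP => /e. Qed.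

(** Deleting x costs one point and the cycle {x} of [s]; in [g] and in the quotient x is only
    spliced out after k. *)
Lemma connected_planar_fix k : k \in A' ->
  connected_planar A (tperm k x * g) s = connected_planar A' g s.
Proof.
move=> Ak; congr (_ && _).
  apply: connected_on_equiv; rewrite -(connected_on_extend Ak QD QU).
  split=> h B sBA; have := @stab_tpermMl k g B gx; move: (h B sBA); tauto.
rewrite /planar -mulgA !ncyc_insert // ?permM ?gx //; last 2 first.
- by rewrite stabM ?stabV.
- by rewrite perm_fixV.
by rewrite (ncyc_fix sx Ax) (cardsD1 x A) Ax add1n !addSn eqSS.
Qed.

(** Here x follows k in both permutations. Up to conjugation by [tperm k x] the quotient fixes x, so
    it is the quotient that loses a cycle. *)
Lemma connected_planar_same k : k \in A' ->
  connected_planar A (tperm k x * g) (tperm k x * s) = connected_planar A' g s.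
Proof.
move=> Ak; have /setD1P[_ Ak'] := Ak; congr (_ && _).
  apply: connected_on_equiv; rewrite -(connected_on_extend Ak QD QU).
  split=> h B sBA; have := @stab_tpermMl k g B gx; have := @stab_tpermMl k s B sx;
  move: (h B sBA); tauto.
rewrite /planar invMg tpermV !ncyc_insert //.
have -> : tperm k x * g * (s^-1 * tperm k x) = (g * s^-1) ^ tperm k x.
  by rewrite conjgE tpermV !mulgA.
rewrite ncyc_conj ?stab_tperm ?Ak' ?Ax // (@ncyc_fix _ A (g * s^-1) x) //;
  last by rewrite permM gx perm_fixV.
by rewrite (cardsD1 x A) Ax add1n addnS !addSn eqSS.
Qed.

(** Conjugation by [tperm j x] turns the product into [tperm k x] times [tperm j k * g * s^-1],
    where x is merely inserted after k. This is the origin of the transposition of j and k. *)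
Lemma ncyc_insert2 j k : j \in A' -> k \in A' -> j != k ->
  ncyc A (tperm k x * g * (tperm j x * s)^-1) = ncyc A' (tperm j k * g * s^-1).
Proof.
move=> Aj Ak jk; have /setD1P[jx Aj'] := Aj; have /setD1P[kx Ak'] := Ak.
rewrite invMg tpermV -(@ncyc_insert _ A _ x k) //; last first.
- by rewrite !permM tpermD // gx perm_fixV.
- by rewrite !stabM ?stabV // stab_tperm // Aj' Ak'.
rewrite -(@ncyc_conj _ A _ (tperm j x)) ?stab_tperm ?Aj' ?Ax // conjgE tpermV !mulgA.
rewrite -(mulgA _ (tperm j x) (tperm j x)) tperm2 mulg1. 
suff -> : tperm k x * tperm j k = tperm j x * tperm k x by [].
have -> : tperm j k = tperm j x ^ tperm x k by rewrite tpermJ tpermL tpermD // eq_sym.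
by rewrite [tperm k x]tpermC -conjgC.
Qed.

Lemma connected_on_link j k : j \in A' -> k \in A' ->
  reflect (forall B, B \subset A' ->
     (stab B s /\ stab B (tperm j k * g)) /\ (j \in B) = (k \in B) -> B = set0 \/ B = A')
  (connected_on A (tperm j x * s) (tperm k x * g)).
Proof.
move=> Aj Ak; have /setD1P[jx _] := Aj; have /setD1P[kx _] := Ak.
pose Q B := (stab B s /\ stab B g) /\ (j \in B) = (k \in B).
have Q1 B : Q B -> Q (B :\ x) by case=> /QD h jk; split=> //; rewrite !inE jx kx jk.
have Q2 B : Q B -> Q (x |: B) by case=> /QU h jk; split=> //;
  rewrite !inE jk (negPf jx) (negPf kx).
have QE B : (stab B s /\ stab B (tperm j k * g)) /\ (j \in B) = (k \in B) <-> Q B.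
  split=> [[[Bs Bg] jk]|[[Bs Bg] jk]]; split=> //; split=> //.
    by apply: stabMl Bg; apply: stab_tperm.
  by rewrite stabM ?stab_tperm.
apply: (iffP (connected_onP _ _ _)) => [h|h].
  suff h' : forall B, B \subset A' -> Q B -> B = set0 \/ B = A' by move=> B sBA /QE;
    apply: h'.
  rewrite -(connected_on_extend Aj Q1 Q2) => B sBA [[[Bs Bg] jk] xj]; apply: h => //.
  by split; apply/stab_tpermMl; rewrite // xj jk.
have h' : forall B, B \subset A' -> Q B -> B = set0 \/ B = A' by move=> B sBA /QE;
  apply: h.
rewrite -(connected_on_extend Aj Q1 Q2) in h' =>
  B sBA [/(stab_tpermMl _ _ sx)[xj Bs] /(stab_tpermMl _ _ gx)[xk Bg]].
by apply: h' => //; split=> //; split; rewrite // -xj.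
Qed.

(** The cycle that [g] loses by the joining balances the lost point x. That a stable set treats j
    and k alike is automatic once they lie on one cycle. *)
Lemma connected_planar_join j k : j \in A' -> k \in A' -> j \notin porbit g k ->
  connected_planar A (tperm k x * g) (tperm j x * s) = connected_planar A' (tperm j k *
    g) s.
Proof.
move=> Aj Ak jk; have jk' : j != k by apply: contraNneq jk => ->; rewrite porbit_id.
have gA' : stab A' g by rewrite stabD ?stab1.
congr (_ && _).
  apply/(connected_on_link Aj Ak)/connected_onP => h B sBA; last by case=> h' _; apply: h.
  move=> [Bs Bg]; apply: h => //; split=> //; rewrite -(stabE j Bg).
  have kj : k \in porbit (tperm j k * g) j by rewrite porbit_join // inE porbit_id orbT.
  apply/idP/idP => [|Bk]; rewrite (stabE _ Bg); last first.
    by apply: (subsetP (porbit_stab_sub Bg Bk)); rewrite porbit_sym.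
  by move=> Bj; apply: (subsetP (porbit_stab_sub Bg Bj)).
rewrite /planar ncyc_insert2 // !(@ncyc_insert _ A _ x) // (cardsD1 x A) Ax -/A'.
have := ncyc_tperm gA' Aj Ak; rewrite jk jk' /= => e.
by clear -e; apply/eqP/eqP; lia.
Qed.

(** The cycle {x} of [g] disappears together with x, which was attached to the rest by [s] alone. *)
Lemma connected_planar_last j : j \in A' ->
  connected_planar A g (tperm j x * s) = connected_planar A' g s.
Proof.
move=> Aj; have /setD1P[_ Aj'] := Aj; congr (_ && _).
  apply: connected_on_equiv; rewrite -(connected_on_extend Aj QD QU).
  split=> h B sBA; have := @stab_tpermMl j s B sx; move: (h B sBA); tauto.
rewrite /planar -(@ncyc_conj _ A (g * (tperm j x * s)^-1) (tperm j x)) ?stab_tperm ?Aj'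
  ?Ax //.
have -> : (g * (tperm j x * s)^-1) ^ tperm j x = tperm j x * (g * s^-1).
  by rewrite conjgE !invMg !tpermV -!mulgA tperm2 mulg1.
rewrite !(@ncyc_insert _ A _ x) ?stabM ?stabV ?permM ?gx ?perm_fixV //.
by rewrite (ncyc_fix gx Ax) (cardsD1 x A) Ax add1n addnS !addSn eqSS.
Qed.

(* When j and k lie on the same cycle of g, that cycle is cut, and the connected
   planar s are those that fall apart into two connected planar pieces. *)
Section Cut.
Variables j k : T.
Hypotheses (Aj : j \in A') (Ak : k \in A') (jk' : j != k) (jk : j \in porbit g k).
Let g2 := tperm j k * g.

Definition splitting B := [&& B \subset A', j \in B, k \notin B, stab B g2,
  stab B s, connected_planar B g2 s & connected_planar (A' :\: B) g2 s].

Let gA' : stab A' g. Proof. by rewrite stabD ?stab1. Qed.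
Let sA' : stab A' s. Proof. by rewrite stabD ?stab1. Qed.
Let gA2 : stab A' g2. Proof. by rewrite stabM // stab_tperm // Aj Ak. Qed.

Let cardA : #|A| = #|A'|.+1. Proof. by rewrite (cardsD1 x A) Ax. Qed.

(** Cutting gives [g2] one cycle more than [g]. The count is now 2 above the bound for a connected
    set, which is exactly what two planar components, each with its own 2, add up to. *)
Let planarE : planar A (tperm k x * g) (tperm j x * s) =
  (ncyc A' s + ncyc A' (g2 * s^-1) + ncyc A' g2 == #|A'| + 4).
Proof.
rewrite /planar ncyc_insert2 // !(@ncyc_insert _ A _ x) // cardA.
have := ncyc_tperm gA' Aj Ak; rewrite jk jk' -/A' -/g2 /= => e.
by clear -e; apply/eqP/eqP; lia.
Qed.

(** [B] can only be the component of j: connectedness of one solution forces it into any other. *)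
Lemma splitting_uniq B C : splitting B -> splitting C -> B = C.
Proof.
have sub B1 C1 : splitting B1 -> splitting C1 -> B1 \subset C1.
  case/and5P=> _ jB _ Bg /and3P[Bs /andP[/connected_onP cB _] _].
  case/and5P=> _ jC _ Cg /and3P[Cs _ _].
  have [||e0|/setIidPl] := cB (B1 :&: C1) => //; first exact: subsetIl.
    by rewrite !stabI.
  by move/setP/(_ j): e0; rewrite !inE jB jC.
by move=> sB sC; apply/eqP; rewrite eqEsubset !sub.
Qed.

Lemma connected_planar_splitting B : splitting B ->
  connected_planar A (tperm k x * g) (tperm j x * s).
Proof.
case/and5P=> sBA jB kB Bg /and3P[Bs /andP[/connected_onP cB pB] /andP[/connected_onP cD
  pD]].
apply/andP; split.
  apply/(connected_on_link Aj Ak) => C sCA [[Cs Cg] jkC].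
  have Ds : stab (A' :\: B) s by apply: stabD.
  have Dg : stab (A' :\: B) g2 by apply: stabD.
  have [||eB|eB] := cB (B :&: C); rewrite ?stabI ?subsetIl //.
    have [||eD|eD] := cD ((A' :\: B) :&: C); rewrite ?stabI ?subsetIl //.
      left; apply/setP=> p; move/setP/(_ p): eB; move/setP/(_ p): eD.
      rewrite !inE; have := subsetP sCA p; rewrite !inE; case: (p \in C);
        last by rewrite ?andbF.
      by move=> /(_ isT)/andP[-> ->]; case: (p \in B).
    move/setP/(_ k): eD; move/setP/(_ j): eB; move: Ak; rewrite !inE jB -jkC => -> /= ->.
    by rewrite kB andbF.
  have [||eD|eD] := cD ((A' :\: B) :&: C); rewrite ?stabI ?subsetIl //.
    move/setP/(_ k): eD; move/setP/(_ j): eB; move: Ak; rewrite !inE jB -jkC => -> /= ->.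
    by rewrite kB.
  right; apply/setP=> p; move/setP/(_ p): eB; move/setP/(_ p): eD.
  have /implyP := subsetP sBA p; have /implyP := subsetP sCA p; rewrite !inE.
  by case: (p \in B); case: (p \in C); case: (p \in A); case: (p == x).
rewrite planarE; move: pB pD; rewrite /planar => /eqP pB /eqP pD.
have Bgs := stabM Bg (stabV Bs); rewrite !(ncycD _ sBA) //.
have := cardsID B A'; rewrite (setIidPr sBA) => <-; apply/eqP; clear -pB pD; lia.
Qed.

Lemma splitting_exists : connected_planar A (tperm k x * g) (tperm j x * s) ->
  exists B, splitting B.
Proof.
case/andP=> /(connected_on_link Aj Ak) cA; rewrite planarE => /eqP pA.
have ncA : ~~ connected_on A' s g2.
  by apply/negP=> /(genus_bound sA' gA2 Aj); by rewrite pA leq_add2l.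
have [B [sBA Bs Bg jB kB]] : exists B, [/\ B \subset A', stab B s, stab B g2, j \in B &
  k \notin B].
  have [B /and3P[sBA Bs Bg] nB] : exists2 B : {set T},
    [&& B \subset A', stab B s & stab B g2] & ~~ ((B == set0) || (B == A')).
    by case/forallPn: ncA => B; rewrite negb_imply => /andP[]; exists B.
  case/norP: nB => B0 B1; have [jB|jB] := boolP (j \in B).
    exists B; split=> //; apply: contraNN B1 => kB.
    by have [|e|->] := cA B sBA => //; [rewrite jB kB | rewrite e eqxx in B0].
  have [kB|kB] := boolP (k \in B).
    exists (A' :\: B); split; rewrite ?subsetDl //; try exact: stabD.
      by rewrite in_setD jB.
    by rewrite in_setD kB.
  have [|e|e] := cA B sBA; first by rewrite (negPf jB) (negPf kB).
    by rewrite e eqxx in B0.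
  by rewrite e eqxx in B1.
(* A nonempty stable set containing neither j nor k would already have been separated before the
   deletion of x. *)
have small C : C \subset A' -> stab C s -> stab C g2 -> j \notin C -> k \notin C ->
  C = set0.
  move=> sCA Cs Cg jC kC; have [|//|e] := cA C sCA;
    first by rewrite (negPf jC) (negPf kC).
  by rewrite e Aj in jC.
(* Of j and k, the piece [D] contains at most d, so that a stable part of it without d is empty. *)
have connB (D : {set T}) d : D \subset A' -> stab D s -> stab D g2 ->
    (j \in D -> d = j) -> (k \in D -> d = k) -> connected_on D s g2.
  move=> sDA Ds Dg Dj Dk; apply/connected_onP=> C sCD [Cs Cg].
  have sm (E : {set T}) : E \subset D -> stab E s -> stab E g2 -> d \notin E -> E = set0.
    move=> sED Es Eg dE; apply: small => //; first exact: subset_trans sDA.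
      by apply: contraNN dE => jE; rewrite Dj // (subsetP sED).
    by apply: contraNN dE => kE; rewrite Dk // (subsetP sED).
  have [dC|dC] := boolP (d \in C); last by left; apply: sm.
  right; apply/eqP; rewrite eqEsubset sCD -setD_eq0; apply/eqP/sm; rewrite ?subsetDl //.
  - exact: stabD.
  - exact: stabD.
  by rewrite in_setD dC.
have cB : connected_on B s g2 by apply: (connB B j) => //; rewrite (negPf kB).
have cD : connected_on (A' :\: B) s g2.
  by apply: (connB _ k); rewrite ?subsetDl ?in_setD ?jB //; apply: stabD.
exists B; apply/and5P; split=> //; apply/and3P; split=> //;
  rewrite /connected_planar ?cB ?cD /planar.
(* The bounds for [B] and its complement add up to the total in [pA], so both are equalities. *)
all: have iB := genus_bound Bs Bg jB cB.
all: have iD : ncyc (A' :\: B) s + ncyc (A' :\: B) (g2 * s^-1) +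
  ncyc (A' :\: B) g2 <= #|A' :\: B| + 2
  by (apply: (genus_bound (stabD sA' Bs) (stabD gA2 Bg) _ cD (x := k));
    rewrite in_setD kB Ak).
all: move: pA; have Bgs := stabM Bg (stabV Bs); rewrite !(ncycD _ sBA) // => pA.
all: have := cardsID B A'; rewrite (setIidPr sBA) => cA'; apply/eqP;
  clear -iB iD pA cA'; lia.
Qed.

End Cut.
End Insert.
End Connected.

Local Close Scope group_scope.

(** * Planar sums and their recursion *)

Local Open Scope group_scope.

Section PermOnSums.
Variables (T : finType) (K : comNzRingType).
Implicit Types (s t g : {perm T}) (A B C : {set T}).

(** Each [s] is [tperm j x] times a permutation fixing x for exactly one j, namely s^-1 x; j = x is
    the case where [s] itself fixes x. *)
Lemma sum_perm_on_D1 A x (F : {perm T} -> K) : x \in A ->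
  (\sum_(s | perm_on A s) F s =
   \sum_(j in A) \sum_(s | perm_on (A :\ x) s) F (tperm j x * s)%g)%R.
Proof.
move=> Ax; rewrite (partition_big (fun s : {perm T} => s^-1 x) (mem A)); last first.
  by move=> s As; rewrite /= (stabE _ (stabV (stab_perm_on As))).
apply: eq_bigr => j; rewrite inE => Aj; rewrite (reindex_inj (mulgI (tperm j x))) /=.
apply: eq_bigl => s; rewrite invMg tpermV permM -(inj_eq (@perm_inj _ (tperm j x))).
rewrite tpermK tpermL; apply/andP/idP => [[As /eqP sx]|As].
  apply/subsetP=> p; rewrite !inE => sp; apply/andP; split.
    by apply: contraNneq sp => ->; rewrite -{1}sx permKV.
  have As' : stab A s by apply: stabMl (stab_perm_on As); rewrite stab_tperm // Aj Ax.
  apply: contraTT sp => nAp; rewrite negbK; have := out_perm As nAp.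
  by rewrite permM tpermD => [->//||]; apply: contraNneq nAp => <-.
have sx : s x = x by rewrite (out_perm As) // !inE eqxx.
rewrite perm_fixV //; split=> //; apply: perm_onM.
  apply: subset_trans (tperm_on _ _) _; apply/subsetP=> p; rewrite !inE.
  by case/orP=> /eqP ->.
by apply: subset_trans As _; rewrite subsetDl.
Qed.

Lemma sum_perm_on_prod A B (F G : {perm T} -> K) : B \subset A ->
  (forall s t, perm_on B s -> perm_on (A :\: B) t -> F (s * t) = F s) ->
  (forall s t, perm_on B s -> perm_on (A :\: B) t -> G (s * t) = G t) ->
  (\sum_(s | perm_on A s && stab B s) F s * G s =
   (\sum_(s | perm_on B s) F s) * (\sum_(s | perm_on (A :\: B) s) G s))%R.
Proof.
move=> sBA hF hG; rewrite big_distrlr pair_big /=.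
rewrite (reindex_onto (fun u : {perm T} * {perm T} => u.1 * u.2)
  (fun s => (restr_perm B s, restr_perm (A :\: B) s))) /=.
  symmetry; apply: eq_big => [[s t]|[s t] /andP[/= Bs At]] /=; last by rewrite hF ?hG.
  apply/andP/andP=> [[Bs At]|[_ /eqP[<- <-]]]; last by rewrite !restr_perm_on.
  have sE p : p \notin B -> s p = p by apply: out_perm.
  have tE p : p \notin A :\: B -> t p = p by apply: out_perm.
  have stB : {in B, s * t =1 s}.
    by move=> p Bp; rewrite permM tE // in_setD (stabE _ (stab_perm_on Bs)) Bp.
  have stA : {in A :\: B, s * t =1 t}.
    by move=> p; rewrite in_setD => /andP[Bp _]; rewrite permM sE.
  have Bst : stab B (s * t).
    apply: stabM; first exact: stab_perm_on.
    by apply: stab_closed => p Bp; rewrite tE // in_setD Bp.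
  have Ast : perm_on A (s * t).
    by apply: perm_onM; [apply: subset_trans sBA|apply: subset_trans At (subsetDl _ _)].
  split; first by rewrite Ast.
  apply/eqP; congr (_, _); apply/permP=> p.
    have [Bp|Bp] := boolP (p \in B); first by rewrite restr_permE_stab ?stB.
    by rewrite sE // (out_perm (restr_perm_on _ _)).
  have [Bp|Bp] := boolP (p \in A :\: B).
    by rewrite restr_permE_stab ?stA // stabD // stab_perm_on.
  by rewrite tE // (out_perm (restr_perm_on _ _)).
move=> s /andP[As Bs]; apply/permP=> p; rewrite permM.
have ABs : stab (A :\: B) s by rewrite stabD // stab_perm_on.
have [Bp|Bp] := boolP (p \in B).
  rewrite (restr_permE_stab Bs) // (out_perm (restr_perm_on _ _)) //.
  by rewrite in_setD stabE // Bp.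
rewrite (out_perm (restr_perm_on B _)) //.
have [Ap|Ap] := boolP (p \in A); first by rewrite restr_permE_stab // in_setD Bp.
by rewrite (out_perm (restr_perm_on _ _)) ?(out_perm As) // in_setD (negPf Ap) andbF.
Qed.

End PermOnSums.

Section Weights.
Variables (T : finType) (K : comNzRingType) (kap : nat -> K).
Implicit Types (s t g : {perm T}) (A B C : {set T}) (mu : T -> nat).

Definition weight A s mu : K := (\prod_(c in cycs A s) kap (\sum_(p in c) mu p)%N)%R.

(* The masses after x has been deleted and its mass transferred to j. *)
Definition add_mass mu j x p := (mu p + (p == j) * mu x)%N.

Lemma weight_agree A s s' mu mu' : stab A s -> {in A, s =1 s'} ->
  {in A, mu =1 mu'} -> weight A s mu = weight A s' mu'.
Proof.
move=> As ss mm; rewrite /weight (cycs_agree As ss); apply: eq_bigr => _ /imsetP[p Ap ->].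
congr kap; apply: eq_bigr => q pq; apply: mm.
by rewrite -(porbit_agree As ss Ap) in pq; apply: (subsetP (porbit_stab_sub As Ap)).
Qed.

Lemma weight_split A B s mu : B \subset A -> stab B s ->
  (weight A s mu = weight B s mu * weight (A :\: B) s mu)%R.
Proof.
move=> sBA Bs; rewrite /weight -bigU /=; last first.
  by apply: disjoint_cycs => //; apply/pred0P=> p; rewrite /= !inE; case: (p \in B).
by apply: eq_bigl => c; rewrite !inE -in_setU -imsetU -{1}(setIidPr sBA) setID.
Qed.

Lemma weight_porbit s mu p :
  (weight (porbit s p) s mu = kap (\sum_(q in porbit s p) mu q)%N)%R.
Proof. by rewrite /weight cycs_porbit big_set1. Qed.

Lemma weight_fix A s x mu : s x = x -> x \in A ->
  (weight A s mu = kap (mu x) * weight (A :\ x) s mu)%R.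
Proof.
move=> sx Ax; rewrite (@weight_split A [set x]) ?sub1set ?stab1 //.
by congr (_ * _)%R; rewrite -{1}(porbit_fix sx) weight_porbit porbit_fix // big_set1.
Qed.

Lemma weight_insert A s x j mu : stab A s -> s x = x -> x \in A -> j \in A :\ x ->
  weight A (tperm j x * s) mu = weight (A :\ x) s (add_mass mu j x).
Proof.
move=> As sx Ax Aj; have /setD1P[jx Aj'] := Aj; set t := tperm j x * s.
have tj : porbit t j = x |: porbit s j by rewrite porbit_insert // porbit_id.
have sA' : stab (A :\ x) s by rewrite stabD ?stab1.
have sjA : porbit s j \subset A :\ x by apply: porbit_stab_sub.
have xj : x \notin porbit s j by apply/negP=> /(subsetP sjA); rewrite !inE eqxx.
rewrite (@weight_split A (porbit t j)) ?stab_porbit //; last first.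
  by rewrite tj subUset sub1set Ax (subset_trans sjA) // subsetDl.
rewrite (@weight_split (A :\ x) (porbit s j)) ?stab_porbit // !weight_porbit.
rewrite tj (_ : A :\: (x |: porbit s j) = A :\ x :\: porbit s j); last first.
  by rewrite setDDl.
congr (kap _ * _)%R.
  rewrite big_setU1 //= /add_mass big_split /= addnC; congr (_ + _)%N.
  rewrite (bigD1 j) ?porbit_id //= eqxx mul1n big1 ?addn0 // => q /andP[_ /negPf ->].
  by rewrite mul0n.
symmetry; apply: weight_agree.
- by rewrite stabD ?stab_porbit.
- move=> q; rewrite !in_setD in_set1 => /and3P[qj qx _];
  rewrite permM tpermD // 1?eq_sym //.
  by apply: contraNneq qj => ->; rewrite porbit_id.
move=> q; rewrite !in_setD in_set1 /add_mass => /and3P[qj qx _].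
by have [e|_] := eqVneq q j; rewrite ?addn0 //; rewrite e porbit_id in qj.
Qed.

Definition planar_term A g mu s : K :=
  if connected_planar A g s then weight A s mu else 0%R.
Definition planar_sum A g mu : K := (\sum_(s | perm_on A s) planar_term A g mu s)%R.

Lemma planar_term_agree A g g' s s' mu mu' : stab A g -> stab A s -> {in A, g =1 g'} ->
  {in A, s =1 s'} -> {in A, mu =1 mu'} -> planar_term A g mu s = planar_term A g' mu' s'.
Proof.
move=> Ag As gg ss mm; rewrite /planar_term (connected_planar_agree As Ag ss gg).
by rewrite (weight_agree As ss mm).
Qed.

Section Recursion.
Variables (A : {set T}) (x : T) (g : {perm T}).
Hypotheses (Ax : x \in A) (Ag : stab A g) (gx : g x = x).
Let A' := A :\ x.

Let sA s : perm_on A' s -> stab A s.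
Proof. by move=> As; apply: stab_perm_on; apply: subset_trans As (subsetDl _ _). Qed.

Let sx s : perm_on A' s -> s x = x.
Proof. by move=> As; rewrite (out_perm As) // !inE eqxx. Qed.

Lemma planar_sum_last mu j0 : j0 \in A' ->
  planar_sum A g mu = (\sum_(j in A') planar_sum A' g (add_mass mu j x))%R.
Proof.
move=> Aj0; rewrite /planar_sum (sum_perm_on_D1 _ Ax) (big_setD1 x Ax) /= big1 ?add0r.
  apply: eq_bigr => j Aj; apply: eq_bigr => s As.
  have sAs := sA As; have ssx := sx As.
  by rewrite /planar_term connected_planar_last // weight_insert.
(* For j = x the set {x} would be stable under both permutations, against connectedness, since [A']
   is not empty. *)
move=> s As; rewrite tperm1 mul1g /planar_term /connected_planar.
case: connected_onP => //= cA; have [||e|e] := cA [set x].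
- by rewrite sub1set.
- by split; apply: stab1; [apply: sx|].
- by move/setP/(_ x): e; rewrite !inE eqxx.
by move: Aj0; rewrite /A' -e !inE; case: eqP.
Qed.

(** With j = s^-1 x, the three parts are j = x, j = k and the remaining j; among the last, those on
    the cycle of k in [g] produce a cut and the others a join. *)
Lemma planar_sum_rec mu k : k \in A' ->
  (planar_sum A (tperm k x * g) mu = kap (mu x) * planar_sum A' g mu +
    planar_sum A' g (add_mass mu k x)
   + \sum_(j in A' | j != k)
       if j \in porbit g k then
         \sum_(B : {set T} | [&& B \subset A', j \in B, k \notin B &
           stab B (tperm j k * g)])
           planar_sum B (tperm j k * g) (add_mass mu j x) * planar_sum (A' :\: B) (tperm
             j k * g) (add_mass mu j x)
       else planar_sum A' (tperm j k * g) (add_mass mu j x))%R.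
Proof.
move=> Ak; rewrite /planar_sum (sum_perm_on_D1 _ Ax) (big_setD1 x Ax) /= -addrA -/A';
  congr (_ + _)%R.
  rewrite big_distrr /=; apply: eq_bigr => s As; rewrite tperm1 mul1g.
  have sAs := sA As; have ssx := sx As.
  by rewrite /planar_term connected_planar_fix // (weight_fix _ ssx Ax); case: ifP;
    rewrite ?mulr0.
rewrite (bigD1 k) //=; congr (_ + _)%R.
  by apply: eq_bigr => s As; have sAs := sA As; have ssx := sx As;
    rewrite /planar_term connected_planar_same ?weight_insert.
apply: eq_bigr => j /andP[Aj jk]; case: ifPn => jgk; last first.
  by apply: eq_bigr => s As; have sAs := sA As; have ssx := sx As;
    rewrite /planar_term connected_planar_join ?weight_insert.
set g2 := tperm j k * g; set mu2 := add_mass mu j x.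
have gA2 : stab A' g2.
  by apply: stabM; [rewrite stab_tperm // Aj Ak | rewrite stabD ?stab1].
(* The splitting of a given [s] is unique, so the inner sum has at most one nonzero term; once the
   sums are exchanged, each [B] gives a product. *)
transitivity (\sum_(s | perm_on A' s) \sum_(B : {set T} |
    [&& B \subset A', j \in B, k \notin B & stab B g2])
    if stab B s then planar_term B g2 mu2 s * planar_term (A' :\: B) g2 mu2 s else 0)%R.
  apply: eq_bigr => s As; rewrite /planar_term.
  have sAs := sA As; have ssx := sx As.
  case: ifPn => [/(splitting_exists Ax sAs Ag ssx gx Aj Ak jk jgk)[B sB]|ng].
    have /and5P[sBA jB kB Bg /and3P[Bs gB gD]] := sB.
    rewrite (bigD1 B) /=; last by rewrite sBA jB kB.
    rewrite Bs gB gD big1 ?addr0.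
      by rewrite weight_insert // (weight_split _ sBA).
    move=> C /andP[/and4P[sCA jC kC Cg] CB].
    case: ifP => // Cs; case: ifP => gC; rewrite ?mul0r //.
    case: ifP => gD'; rewrite ?mulr0 //; case/eqP: CB.
    apply: (@splitting_uniq _ A x s g j k) => //.
    by apply/and5P; split=> //; apply/and3P.
  rewrite big1 // => C /and4P[sCA jC kC Cg]; case: ifP => // Cs.
  case: ifP => gC; rewrite ?mul0r //; case: ifP => gD'; rewrite ?mulr0 //.
  case/negP: ng; apply: (@connected_planar_splitting _ A x Ax s g sAs Ag ssx gx j k Aj
    Ak jk jgk C).
  by apply/and5P; split=> //; apply/and3P.
rewrite exchange_big /=; apply: eq_bigr => B /and4P[sBA jB kB Bg].
rewrite -big_mkcondr sum_perm_on_prod //.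
  move=> s t Bs At; symmetry; apply: planar_term_agree => //; first exact: stab_perm_on.
  move=> p Bp; rewrite permM [t _](out_perm At) //.
  by rewrite in_setD (stabE _ (stab_perm_on Bs)) Bp.
move=> s t Bs At; symmetry; apply: planar_term_agree => //;
  [by rewrite stabD|exact: stab_perm_on|].
by move=> p; rewrite in_setD => /andP[Bp _]; rewrite permM [s _](out_perm Bs).
Qed.

End Recursion.

Lemma planar_sum_set1 g mu x : g x = x -> planar_sum [set x] g mu = kap (mu x).
Proof.
move=> gx; rewrite /planar_sum (sum_perm_on_D1 _ (set11 x)) big_set1 setDv.
rewrite (big_pred1 1) => [|s]; last first.
  apply/idP/eqP => [s0|->]; last exact: perm_on1.
  by apply/permP=> p; rewrite perm1 (out_perm s0) ?inE.
rewrite tperm1 mul1g /planar_term (_ : connected_planar _ _ _).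
  rewrite (@weight_fix _ _ x) ?perm1 ?set11 // setDv /weight /cycs imset0.
  by rewrite big_set0 mulr1.
apply/andP; split.
  by apply/connected_onP=> B; rewrite subset1 => /orP[]/eqP; [right|left].
have n1 (s : {perm T}) : s x = x -> ncyc [set x] s = 1%N.
  by move=> _; rewrite /ncyc /cycs imset_set1 cards1.
by rewrite /planar !n1 ?permM ?perm_fixV ?perm1 ?cards1.
Qed.

End Weights.

Section CycleSurgery.
Variable T : finType.
Implicit Types (s g : {perm T}) (A B C : {set T}).

Lemma porbit_cut s k i (j := (s ^+ i) k) (t := tperm j k * s) :
    0 < i < #|porbit s k| ->
  [/\ #|porbit t j| = i, k \notin porbit t j, porbit t j \subset porbit s k,
      porbit t k = porbit s k :\: porbit t j & #|porbit t k| = #|porbit s k| - i].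
Proof.
move=> lt_i; have [cj kj] := card_porbit_cut lt_i.
have jk : j \in porbit s k by apply: mem_porbit.
have ejk : porbit s j = porbit s k by apply/eqP; rewrite eq_porbit_mem.
have st : stab (porbit s k) t by rewrite stabM ?stab_porbit ?stab_tperm // jk porbit_id.
have [sj sk] : porbit t j \subset porbit s k /\ porbit t k \subset porbit s k.
  by rewrite !porbit_stab_sub ?porbit_id.
have ck : #|porbit t k| = #|porbit s k| - i.
  (* k is reached from j by the remaining steps, so the count for j applies with j and k
     exchanged. *)
  have ek : k = (s ^+ (#|porbit s k| - i)) j.
    rewrite /j -permM -expgD subnKC; last by case/andP: lt_i => _ /ltnW.
    by rewrite permX iter_porbit.
  have := @card_porbit_cut _ s j (#|porbit s k| - i); rewrite -ek ejk [tperm k j]tpermC.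
  by case=> //; lia.
split=> //; apply/eqP; rewrite eqEcard ck cardsD (setIidPr sj) cj leqnn andbT.
rewrite subsetD sk; apply/pred0P=> q /=; apply/negP=> /andP[qk qj]; case/negP: kj.
by rewrite -!eq_porbit_mem in qk qj *; rewrite -(eqP qk).
Qed.

Lemma sum_porbit (K : nmodType) s k (F : T -> K) :
  (\sum_(j in porbit s k | j != k) F j =
   \sum_(1 <= i < #|porbit s k|) F ((s ^+ i)%g k))%R.
Proof.
have c0 : 0 < #|porbit s k| by apply/card_gt0P; exists k; apply: porbit_id.
transitivity (\sum_(j <- traject s k #|porbit s k| | j != k) F j)%R.
  rewrite -big_filter -[RHS]big_filter; apply: perm_big; apply: uniq_perm.
  - by rewrite filter_uniq // index_enum_uniq.
  - by rewrite filter_uniq // uniq_traject_porbit.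
  by move=> j; rewrite !mem_filter mem_index_enum andbT porbit_traject andbC.
rewrite (big_nth k) size_traject big_ltn_cond //= nth_traject //= eqxx /=.
rewrite [LHS]big_nat_cond [RHS]big_nat_cond;
  apply: eq_big => [i|i /andP[/andP[_ lt_i] _]].
  have [lt_i|] := boolP (0 < i < _) => //=; rewrite nth_traject; last by case/andP: lt_i.
  by rewrite -permX porbit_exp_neq.
by rewrite nth_traject // -permX.
Qed.

End CycleSurgery.

(** * Planar sums for one and for two cycles *)

Section Recursions.
Variables (T : finType) (K : comNzRingType) (kap : nat -> K).
Implicit Types (s g : {perm T}) (A B C : {set T}) (mu : T -> nat).

Lemma planar_sum_one_cycle_rec s x mu (k := s^-1 x) (g := tperm k x * s) : s x != x ->
  [/\ porbit s x :\ x = porbit g k, #|porbit s x| = #|porbit g k|.+1 & 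
  (planar_sum kap (porbit s x) s mu =
    kap (mu x) * planar_sum kap (porbit g k) g mu +
      planar_sum kap (porbit g k) g (add_mass mu k x)
    + \sum_(1 <= i < #|porbit g k|)
        (let j := (g ^+ i)%g k in let t := (tperm j k * g)%g in
        planar_sum kap (porbit t j) t (add_mass mu j x) * planar_sum kap (porbit t k) t
          (add_mass mu j x)))%R].
Proof.
move=> sx; have sk : s k = x by rewrite permKV.
have kx : k != x by apply: contraNneq sx => e; rewrite -{1}e sk.
have gx : g x = x by rewrite permM tpermR.
have es : s = tperm k x * g by rewrite mulgA tperm2 mul1g.
have pk : porbit s k = x |: porbit g k by rewrite {1}es porbit_insert // porbit_id.
have pxk : porbit s x = porbit s k by apply/eqP; rewrite eq_porbit_mem pk !inE eqxx.
have nx : x \notin porbit g k by rewrite porbit_sym porbit_fix // inE.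
have eA' : porbit s x :\ x = porbit g k by rewrite pxk pk setU1K.
split=> //; first by rewrite (cardsD1 x) eA' porbit_id.
have gA : stab (porbit s x) g.
  by rewrite stabM ?stab_porbit // stab_tperm // porbit_id pxk porbit_id.
rewrite {2}es (planar_sum_rec kap (porbit_id s x) gA gx) eA' ?porbit_id //;
  congr (_ + _)%R.
rewrite sum_porbit; rewrite [LHS]big_nat_cond [RHS]big_nat_cond.
apply: eq_bigr => i /andP[lt_i _]; rewrite mem_porbit.
set j := (g ^+ i) k; set t := tperm j k * g.
have [cj kj sj tk ck] := porbit_cut lt_i; rewrite -/j -/t in cj kj sj tk ck.
(* The cut leaves just two cycles, so only one stable [B] contains j and not k. *)
rewrite (big_pred1 (porbit t j)) -?tk //= => B.
apply/and4P/eqP=> [[sB jB kB Bt]|->]; last by rewrite sj porbit_id kj stab_porbit.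
apply/eqP; rewrite eqEsubset porbit_stab_sub // andbT.
apply/subsetP=> q qB; have qk := subsetP sB q qB; apply: contraNT kB => qj.
have : q \in porbit t k by rewrite tk inE qj.
rewrite porbit_sym; exact/subsetP/porbit_stab_sub.
Qed.

Lemma planar_sum_two_cycles_rec s x y mu (k := s^-1 x) (g := tperm k x * s)
    (D := porbit s y) : x \notin D -> s x != x ->
  [/\ stab (porbit g k :|: D) g, porbit g y = D,
      (forall j, j \in D -> porbit (tperm j k * g) j = porbit g k :|: D),
      (forall i (j := (g ^+ i) k), porbit (tperm j k * g) y = D) &
  (planar_sum kap (porbit s x :|: D) s mu =
    kap (mu x) * planar_sum kap (porbit g k :|: D) g mu
    + planar_sum kap (porbit g k :|: D) g (add_mass mu k x)
    + (\sum_(1 <= i < #|porbit g k|)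
        (let j := (g ^+ i)%g k in let t := (tperm j k * g)%g in
        let mu' := add_mass mu j x in
        planar_sum kap (porbit t j :|: D) t mu' * planar_sum kap (porbit t k) t mu'
        + planar_sum kap (porbit t j) t mu' * planar_sum kap (porbit t k :|: D) t mu')
    + \sum_(j in D) planar_sum kap (porbit g k :|: D) (tperm j k * g)%g (add_mass mu j
      x)))%R].
Proof.
move=> xD sx; have [eA' _ _] := planar_sum_one_cycle_rec mu sx; rewrite -/k -/g in eA'.
have sk : s k = x by rewrite permKV.
have kx : k != x by apply: contraNneq sx => e; rewrite -{1}e sk.
have gx : g x = x by rewrite permM tpermR.
have es : s = tperm k x * g by rewrite mulgA tperm2 mul1g.
have Ds : stab D s by apply: stab_porbit.
have kD : k \notin D by rewrite -(stabE _ Ds) sk.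
have kA : k \in porbit s x by rewrite porbit_sym -{1}sk mem_porbit_s.
have gD : {in D, g =1 s}.
  by move=> p pD; rewrite permM tpermD //;
    [apply: contraNneq kD | apply: contraNneq xD] => ->.
have gyD : porbit g y = D by rewrite -(porbit_agree Ds (fun p pD =>
  esym (gD p pD))) ?porbit_id.
have Dg : stab D g by rewrite -gyD stab_porbit.
have dCD : [disjoint porbit g k & D].
  apply/pred0P=> p /=; apply/negP=> /andP[]; rewrite -eA' !inE => /andP[_ px] pD.
  by case/negP: xD; apply: (subsetP (porbit_stab_sub Ds pD)); rewrite porbit_sym.
have Cg : stab (porbit g k :|: D) g by rewrite stabU ?stab_porbit.
have tD j : j \in porbit g k -> {in D, tperm j k * g =1 g}.
  move=> jk p pD; rewrite permM tpermD //; last by apply: contraNneq kD => ->.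
  by apply: contraTneq jk => ->; move/pred0P/(_ p): dCD; rewrite /= pD andbT => ->.
have tyD j : j \in porbit g k -> porbit (tperm j k * g) y = D.
  by move=> jk; rewrite -(porbit_agree Dg (fun p pD => esym (tD j jk p pD))) ?porbit_id.
have join j : j \in D -> porbit (tperm j k * g) j = porbit g k :|: D.
  move=> jD; have ejD : porbit g j = D by apply/eqP; rewrite -gyD eq_porbit_mem gyD.
  rewrite porbit_join ?ejD 1?setUC // porbit_sym ejD.
  exact: kD.
split=> // [i j|]; first exact/tyD/mem_porbit.
have xA : x \in porbit s x :|: D by rewrite inE porbit_id.
have gA : stab (porbit s x :|: D) g.
  apply: stabU => //; apply: stabM (stab_porbit _ _).
  by apply: stab_tperm; rewrite kA porbit_id.
have eA : (porbit s x :|: D) :\ x = porbit g k :|: D.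
  by rewrite setDUl eA' (setDidPl _ : D :\ x = D) // disjoint_sym disjoints1.
rewrite {2}es (planar_sum_rec kap xA gA gx) eA ?inE ?porbit_id // -!addrA;
  congr (_ + (_ + _))%R.
rewrite (bigID [in D]) /= addrC; congr (_ + _)%R; last first.
  apply: eq_big => [j|j]; last first.
    case/andP=> _ jD; rewrite ifN //; apply/negP=> jk.
    by move/pred0P/(_ j): dCD; rewrite /= jk jD.
  rewrite inE; have [jD|] := boolP (j \in D); rewrite ?andbF // orbT andbT.
  by apply: contraNneq kD => <-.
transitivity (\sum_(j in porbit g k | j != k)
  (let t := (tperm j k * g)%g in let mu' := add_mass mu j x in
        planar_sum kap (porbit t j :|: D) t mu' * planar_sum kap (porbit t k) t mu'
        + planar_sum kap (porbit t j) t mu' * planar_sum kap (porbit t k :|: D) t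
          mu'))%R; last by rewrite sum_porbit.
apply: eq_big => [j|j /andP[/andP[jCD jk] jD]].
  rewrite inE; have [jD|jD] := boolP (j \in D); rewrite ?orbF ?andbT // andbF.
  by symmetry; apply/negP=> /andP[jk _]; move/pred0P/(_ j): dCD; rewrite /= jk jD.
have jC : j \in porbit g k by move: jCD; rewrite inE (negPf jD) orbF.
have [i lt_i ej] : exists2 i, 0 < i < #|porbit g k| & j = (g ^+ i) k.
  have : j \in traject g k #|porbit g k| by rewrite -porbit_traject.
  case/trajectP=> [[|i] lt_i ej]; first by rewrite ej eqxx in jk.
  by exists i.+1; rewrite ?permX.
rewrite jC; have [cj kj sj tk ck] := porbit_cut lt_i; rewrite -ej in cj kj sj tk ck.
set t := tperm j k * g; have tD' := tyD j jC; rewrite -/t in cj kj sj tk ck tD' *.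
have Dt : stab D t by rewrite -tD' stab_porbit.
have dD (q : T) : q \in porbit g k -> q \notin D.
  by move=> qk; apply/negP=> qD; move/pred0P/(_ q): dCD; rewrite /= qk qD.
have eD1 : (porbit g k :|: D) :\: porbit t j = porbit t k :|: D.
  apply/setP=> q; rewrite tk !inE; have := dD q; have := subsetP sj q.
  by case: (q \in porbit t j); case: (q \in porbit g k); case: (q \in D) => //= h1 h2;
    [have := h2 (h1 isT) | have := h1 isT].
have eD2 : (porbit g k :|: D) :\: (porbit t j :|: D) = porbit t k.
  apply/setP=> q; rewrite tk !inE; have := dD q; have := subsetP sj q.
  by case: (q \in porbit t j); case: (q \in porbit g k); case: (q \in D) => //= h1 h2;
    have := h2 isT.
(* The cut leaves three cycles; the untouched one, [D], goes either with j or with k. *)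
rewrite (eq_bigl [in [set porbit t j; porbit t j :|: D]]) => [|B]; last first.
  rewrite !inE; apply/and4P/orP=> [[sB jB kB Bt]|[]/eqP->]; last 2 first.
  - by rewrite porbit_id kj stab_porbit (subset_trans sj) ?subsetUl.
  - rewrite !inE porbit_id (negPf kj) kD stabU ?stab_porbit //.
    by rewrite subUset subsetUr (subset_trans sj) ?subsetUl.
  have sjB : porbit t j \subset B by apply: porbit_stab_sub.
  have sBj : B \subset porbit t j :|: D.
    apply/subsetP=> q qB; have := subsetP sB q qB; rewrite !inE => /orP[qk|->];
      last by rewrite orbT.
    case: (boolP (q \in porbit t j)) => //= qj; case/negP: kB.
    have : q \in porbit t k by rewrite tk inE qj.
    by rewrite porbit_sym; exact/subsetP/porbit_stab_sub.
  have [yB|yB] := boolP (y \in B).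
    right; rewrite eqEsubset sBj subUset sjB -tD' /=; exact: porbit_stab_sub.
  left; rewrite eqEsubset sjB andbT; apply/subsetP=> q qB.
  move/subsetP/(_ q qB): sBj; rewrite inE => /orP[//|qD]; case/negP: yB.
  move: qD; rewrite -tD' porbit_sym; exact/subsetP/porbit_stab_sub.
rewrite big_setU1 /= ?big_set1 ?eD1 ?eD2 1?addrC // inE.
apply: contraNneq (dD j jC) => e;
  have : y \in porbit t j by rewrite e inE -tD' porbit_id orbT.
by move/(subsetP sj)/dD; rewrite porbit_id.
Qed.

Section Values.
Hypothesis kap0 : kap 0 = 1%R.
Variable F : nat -> nat -> K.
Hypothesis F0 : forall a, F a 0 = kap a.
Hypothesis FS : forall a n,
  F a n.+1 = (\sum_(i < n.+1) F a.+1 i * F 0 (n - i)%N)%R.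

Definition marked A x a mu := mu x = a.+1 /\ forall p, p \in A -> p != x -> mu p = 1%N.

Lemma sum_split_ends (u : nat -> K) c : 0 < c ->
  (\sum_(i < c.+1) u i = u 0 + u c + \sum_(1 <= i < c) u i)%R.
Proof.
move=> c0; rewrite -(big_mkord xpredT) big_nat_recr //= big_ltn //.
by rewrite -!addrA [(_ + u c)%R]addrC.
Qed.

Lemma planar_sum_one_cycle n : forall s x mu a, #|porbit s x| = n ->
  marked (porbit s x) x a mu -> planar_sum kap (porbit s x) s mu = F a n.
Proof.
elim/ltn_ind: n => n IHn s x mu a cn [mux mu1]; have [sx|sx] := eqVneq (s x) x.
  move: cn; rewrite porbit_fix // cards1 => <-; rewrite planar_sum_set1 // mux FS.
  by rewrite big_ord1 !F0 kap0 mulr1.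
have [eA cA ->] := planar_sum_one_cycle_rec mu sx; move: cn eA IHn; rewrite cA.
set k := s^-1 x; set g := tperm k x * s => <- eA IHn; have c0 : 0 < #|porbit g k|.
  by apply/card_gt0P; exists k; apply: porbit_id.
have mk p : p \in porbit g k -> mu p = 1%N.
  by rewrite -eA !inE => /andP[px pA]; apply: mu1.
have mj j p : p \in porbit g k -> add_mass mu j x p = (1 + (p == j) * a.+1)%N.
  by move=> pk; rewrite /add_mass mk // mux.
(* The end terms of the sum are the cases j = x (first) and j = k (last); [kap 0 = 1] is what makes
   the last one fit. *)
rewrite mux FS (sum_split_ends (fun i => F a.+1 i * F 0 (_ - i)%N)%R c0);
  congr (_ + _ + _)%R.
- rewrite F0 subn0; congr (_ * _)%R; apply: IHn => //.
  by split=> [|p pk _]; apply: mk; rewrite ?porbit_id.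
- rewrite subnn F0 kap0 mulr1; apply: IHn => //; split=> [|p pk pk'].
    by rewrite mj ?porbit_id // eqxx mul1n.
  by rewrite mj // (negPf pk').
rewrite [LHS]big_nat_cond [RHS]big_nat_cond; apply: eq_bigr => i /andP[lt_i _] /=.
have [cj kj sj tk ck] := porbit_cut lt_i.
set j := (g ^+ i) k in cj kj sj tk ck *; set t := tperm j k * g in cj kj sj tk ck *.
have sk : porbit t k \subset porbit g k by rewrite tk subsetDl.
congr (_ * _)%R; apply: IHn => //; try by lia.
- split=> [|p pj pj']; rewrite mj ?(subsetP sj) ?porbit_id ?eqxx ?mul1n //.
  by rewrite (negPf pj').
split=> [|p pk _]; rewrite mj ?(subsetP sk) ?porbit_id //.
  by case: eqP kj => // e; rewrite -e porbit_id.
by case: eqP => // e; move: pk; rewrite tk e !inE porbit_id.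
Qed.

Variable G : nat -> nat -> nat -> K.
Hypothesis G0 : forall a n, G a 0 n = 0%R.
Hypothesis GS : forall a m n, G a m.+1 n =
  (\sum_(i < m.+1) (G a.+1 i n * F 0 (m - i)%N + F a.+1 i * G 0 (m - i)%N n)
   + F a.+1 (m + n)%N *+ n)%R.

Lemma planar_sum_two_cycles m : forall s x y mu a, #|porbit s x| = m ->
  x \notin porbit s y -> marked (porbit s x :|: porbit s y) x a mu ->
  planar_sum kap (porbit s x :|: porbit s y) s mu = G a m #|porbit s y|.
Proof.
elim/ltn_ind: m => m IHm s x y mu a cm xD [mux mu1].
set D := porbit s y in xD mu1 *; have [sx|sx] := eqVneq (s x) x.
  have eA : (porbit s x :|: D) :\ x = D.
    by rewrite porbit_fix // setU1K.
  have Ds : stab (porbit s x :|: D) s by rewrite stabU ?stab_porbit.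
  have xA : x \in porbit s x :|: D by rewrite inE porbit_id.
  rewrite (planar_sum_last kap xA Ds sx mu (j0 := y)) ?eA ?porbit_id //.
  (* For a cycle of length 1 both products in [GS] vanish, and n equal terms remain, one for each
     point of [D] that x can follow in the permutation summed over. *)
  move: cm; rewrite porbit_fix // cards1 => <-;
    rewrite GS big_ord1 !G0 mul0r mulr0 !add0r.
  rewrite -sumr_const; apply: eq_bigr => j jD.
  have ejD : D = porbit s j by apply/eqP; rewrite eq_sym eq_porbit_mem.
  rewrite {1}ejD; apply: planar_sum_one_cycle; rewrite -?ejD //.
  have dx p : p \in D -> p != x by apply: contraTneq => ->.
  have mp p : p \in D -> mu p = 1%N by move=> pD; apply: mu1; rewrite ?dx // inE pD orbT.
  split=> [|p pD pj]; rewrite /add_mass mp // mux ?eqxx ?mul1n //.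
  by rewrite (negPf pj).
have [Cg gyD join tyD ->] := planar_sum_two_cycles_rec mu xD sx.
have [eA cA _] := planar_sum_one_cycle_rec mu sx; move: cm eA IHm; rewrite cA -/D.
move: Cg gyD join tyD; rewrite -/D.
set k := s^-1 x; set g := tperm k x * s => Cg gyD join tyD <- eA IHm.
have c0 : 0 < #|porbit g k| by apply/card_gt0P; exists k; apply: porbit_id.
have mk p : p \in porbit g k :|: D -> mu p = 1%N.
  rewrite -eA !inE => /orP[/andP[px pA]|pD]; apply: mu1; rewrite // ?inE ?pA ?pD ?orbT //.
  by apply: contraTneq pD => ->.
have mj j p : p \in porbit g k :|: D -> add_mass mu j x p = (1 + (p == j) * a.+1)%N.
  by move=> pk; rewrite /add_mass mk // mux.
have kCD : k \in porbit g k :|: D by rewrite inE porbit_id.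
have dCD q : q \in porbit g k -> q \notin D.
  rewrite -eA !inE => /andP[_ qx]; apply: contraNN xD => qD.
  by move: (qD); rewrite /D -!eq_porbit_mem in qx * => /eqP <-; rewrite eq_sym.
rewrite mux GS addrA; congr (_ + _)%R; last first.
  (* Whichever j of [D] is used, the joined cycle has the same size and j as its marked point; hence
     the multiplicity [#|D|]. *)
  rewrite -sumr_const; apply: eq_bigr => j jD; rewrite -(join j jD).
  have jCD : j \in porbit g k :|: D by rewrite inE jD orbT.
  have cU : #|porbit (tperm j k * g) j| = #|porbit g k| + #|D|.
    rewrite join // cardsU; suff -> : porbit g k :&: D = set0 by rewrite cards0 subn0.
    by apply/setP=> q; rewrite !inE; apply/negP=> /andP[/dCD/negP].
  rewrite -cU; apply: planar_sum_one_cycle => //; rewrite join //; split=> [|p pCD pj];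
    rewrite mj ?eqxx ?mul1n //.
  by rewrite (negPf pj).
rewrite (sum_split_ends (fun i =>
  G a.+1 i _ * F 0 (_ - i)%N +
  F a.+1 i * G 0 (_ - i)%N _)%R c0) !subnn !subn0 !G0 !mul0r !mulr0 !add0r !addr0 !F0
  kap0 mulr1.
congr (_ * _ + _ + _)%R.
- rewrite -gyD; apply: IHm => //; rewrite gyD ?dCD ?porbit_id //.
  by split=> [|p pk _]; apply: mk.
- rewrite -gyD; apply: IHm => //; rewrite gyD ?dCD ?porbit_id //; split=> [|p pk pk'].
    by rewrite mj // eqxx mul1n.
  by rewrite mj // (negPf pk').
rewrite [LHS]big_nat_cond [RHS]big_nat_cond; apply: eq_bigr => i /andP[lt_i _] /=.
have [cj kj sj tk ck] := porbit_cut lt_i; have tyDi := tyD i.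
set j := (g ^+ i) k in cj kj sj tk ck tyDi *;
  set t := tperm j k * g in cj kj sj tk ck tyDi *.
have sk : porbit t k \subset porbit g k by rewrite tk subsetDl.
have jCk : j \in porbit g k by apply: mem_porbit.
have jk : k != j by apply: contraNneq kj => ->; rewrite porbit_id.
have jt : j \notin porbit t k by rewrite tk inE porbit_id.
have jD := dCD j jCk; have kD := dCD k (porbit_id g k).
have mjk p : p \in porbit t k -> add_mass mu j x p = 1%N.
  move=> pt; rewrite mj ?inE ?(subsetP sk) //.
  by have [e|] := eqVneq p j; [rewrite -e pt in jt | ].
have mjD p : p \in D -> add_mass mu j x p = 1%N.
  move=> pD; rewrite mj ?inE ?pD ?orbT //.
  by have [e|] := eqVneq p j; [rewrite -e pD in jD | ].
have mjj p : p \in porbit t j -> p != j -> add_mass mu j x p = 1%N.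
  by move=> pt /negPf pj; rewrite mj ?inE ?(subsetP sj) // pj.
have mjjj : add_mass mu j x j = a.+2 by rewrite mj ?inE ?jCk // eqxx mul1n.
congr (_ * _ + _ * _)%R.
- rewrite -tyDi; apply: IHm; rewrite ?tyDi //; first by clear -lt_i ck; lia.
  by split=> // p; rewrite inE => /orP[|/mjD //]; apply: mjj.
- apply: planar_sum_one_cycle => //; split=> [|p pk _]; apply: mjk; rewrite ?porbit_id //.
- by apply: planar_sum_one_cycle => //; split=> // p; apply: mjj.
rewrite -tyDi; apply: IHm; rewrite ?tyDi //; first by clear -lt_i ck; lia.
split=> [|p]; first by apply: mjk; rewrite porbit_id.
by rewrite inE => /orP[/mjk //|/mjD //].
Qed.

End Values.

End Recursions.

Local Close Scope group_scope.

(** * Formal power series *)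

Local Open Scope ring_scope.

Section Evaluation.
Variable R : comNzRingType.
Implicit Types (a b z : {fps R}) (F G : {fps {fps R}}).

Definition fshift (S : Type) (c : {fps S}) : {fps S} := \fps_i (fcoef c i.+1).

(* F(z), for a series F in an auxiliary variable whose coefficients are
   themselves series; meaningful when z has no constant term. *)
Definition feval F z : {fps R} :=
  \fps_i (\sum_(k < i.+1) fcoef (fcoef F k * z ^+ k) i).

Lemma fcoef_sum (I : Type) (r : seq I) (P : pred I) (E : I -> {fps R}) i :
  fcoef (\sum_(k <- r | P k) E k) i = \sum_(k <- r | P k) fcoef (E k) i.
Proof. by elim/big_rec2: _ => // k c d _ <-. Qed.

Lemma fcoefM_lt z a b i : fcoef z 0 = 0 ->
  (forall j, (j < i)%N -> fcoef a j = fcoef b j) -> fcoef (z * a) i = fcoef (z * b) i.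
Proof.
move=> z0 eab; rewrite !fcoefM; apply: eq_bigr => -[[|j] lt_j] _ /=.
  by rewrite z0 !mul0r.
by rewrite eab //; lia.
Qed.

Lemma fcoef_expr_lt z k i a : fcoef z 0 = 0 -> (i < k)%N -> fcoef (a * z ^+ k) i = 0.
Proof.
move=> z0; elim: k i => // k IHk i lt_i.
rewrite exprS mulrCA (@fcoefM_lt z _ 0) ?mulr0 // => j lt_j.
by rewrite IHk //; lia.
Qed.

Lemma fcoef_feval F z i N : fcoef z 0 = 0 -> (i < N)%N ->
  fcoef (feval F z) i = fcoef (\sum_(k < N) fcoef F k * z ^+ k) i.
Proof.
move=> z0 lt_i; rewrite fcoef_sum /= (big_ord_widen N (fun k =>
  fcoef (fcoef F k * z ^+ k) i)) //.
rewrite [RHS](bigID (fun k : 'I_N => (k < i.+1)%N)) /= [X in _ + X]big1 ?addr0 // => k.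
by rewrite -leqNgt => lt_k; apply: fcoef_expr_lt.
Qed.

(** Horner's rule. Combined with [fshift_uniq] it yields identities for [feval] without rearranging
    sums. *)
Lemma feval_shift F z : fcoef z 0 = 0 ->
  feval F z = fcoef F 0 + z * feval (fshift F) z.
Proof.
move=> z0; apply/fpsP=> i; rewrite (@fcoef_feval _ _ _ i.+2) // big_ord_recl.
rewrite expr0 mulr1 !fcoefD; congr (_ + _).
rewrite (@fcoefM_lt z _ (\sum_(k < i.+1) fcoef (fshift F) k * z ^+ k)) //; last first.
  by move=> j lt_j; rewrite -(fcoef_feval _ z0) //; lia.
rewrite mulr_sumr; congr fcoef; apply: eq_bigr => k _.
by rewrite /= exprS mulrCA.
Qed.

(* Since z has no constant term, a family that is divisible by z along its own
   reindexing is divisible by every power of z. *)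
Lemma fshift_uniq z (I : Type) (E : I -> {fps R}) (next : I -> I) :
  fcoef z 0 = 0 -> (forall c, E c = z * E (next c)) -> forall c, E c = 0.
Proof.
move=> z0 Ez c; apply/fpsP=> i; elim/ltn_ind: i c => i IHi c.
by rewrite Ez (@fcoefM_lt z _ 0) ?mulr0 // => j lt_j; rewrite IHi.
Qed.

Section Hom.
Variable z : {fps R}.
Hypothesis z0 : fcoef z 0 = 0.

Lemma fevalD F G : feval (F + G) z = feval F z + feval G z.
Proof.
apply/eqP; rewrite -subr_eq0; apply/eqP.
pose E (u : {fps {fps R}} * {fps {fps R}}) :=
  feval (u.1 + u.2) z - (feval u.1 z + feval u.2 z).
apply: (@fshift_uniq z _ E (fun u => (fshift u.1, fshift u.2)) z0 _ (F, G)) => -[a b].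
rewrite /E /= (feval_shift (a + b)) // (feval_shift a) // (feval_shift b) // fcoefD.
rewrite (_ : fshift (a + b) = fshift a + fshift b) //; ring.
Qed.

(** Stated for a general d so that it covers both multiplication by a series and differentiation in
    a variable on which z does not depend. *)
Lemma feval_linear (d : {fps R} -> {fps R}) F :
  (forall a b, d (a + b) = d a + d b) -> (forall a, d (z * a) = z * d a) ->
  d (feval F z) = feval (\fps_k d (fcoef F k)) z.
Proof.
move=> dD dz; apply/eqP; rewrite -subr_eq0; apply/eqP.
pose E (a : {fps {fps R}}) := d (feval a z) - feval (\fps_k d (fcoef a k)) z.
apply: (@fshift_uniq z _ E (@fshift _) z0 _ F) => a.
rewrite /E (feval_shift a) // dD dz (feval_shift (\fps_k _)) //=.
rewrite (_ : fshift (\fps_k _) = \fps_k d (fcoef (fshift a) k)) //; ring.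
Qed.

Lemma fevalZ c F : c * feval F z = feval (\fps_k (c * fcoef F k)) z.
Proof. by apply: feval_linear => [a b|a]; rewrite (mulrDr, mulrCA). Qed.

Lemma feval_const c : feval (fps_const c) z = c.
Proof.
rewrite feval_shift // (_ : feval _ z = 0) ?mulr0 ?addr0 //.
pose E (u : unit) := feval (fshift (fps_const c)) z.
apply: (@fshift_uniq z _ E id z0 _ tt) => -[]; rewrite {1}/E feval_shift //.
by rewrite add0r; congr (_ * feval _ _).
Qed.

Lemma feval_fvarM F : feval (fvar {fps R} * F) z = z * feval F z.
Proof.
rewrite feval_shift // fcoef_fvarM add0r; congr (_ * feval _ _).
by apply/fpsP=> i; rewrite -[LHS]/(fcoef (fvar {fps R} * F) i.+1) fcoef_fvarM.
Qed.

Lemma fps_split (S : comNzRingType) (c : {fps S}) :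
  c = fps_const (fcoef c 0) + fvar S * fshift c.
Proof.
apply/fpsP=> i; rewrite fcoefD fcoef_fvarM.
by case: i => [|i] /=; rewrite (addr0, add0r).
Qed.

Lemma fevalM F G : feval (F * G) z = feval F z * feval G z.
Proof.
apply/eqP; rewrite -subr_eq0; apply/eqP.
pose E (a : {fps {fps R}}) := feval (a * G) z - feval a z * feval G z.
apply: (@fshift_uniq z _ E (@fshift _) z0 _ F) => a.
have -> : E a = feval (fps_const (fcoef a 0) * G + fvar _ * (fshift a * G)) z
                - feval a z * feval G z.
  by rewrite /E {1}[a]fps_split mulrDl mulrA.
rewrite fevalD feval_fvarM (feval_shift a) // /E (_ : _ * G = \fps_k (fcoef a 0 * fcoef
  G k)).
  by rewrite -fevalZ; ring.
by apply/fpsP=> k; rewrite fcoef_constM.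
Qed.

Lemma fevalN F : feval (- F) z = - feval F z.
Proof.
rewrite -[RHS]mulN1r fevalZ; congr feval; apply/fpsP=> i.
by rewrite /= mulN1r.
Qed.

Lemma feval1 : feval 1 z = 1.
Proof. exact: feval_const. Qed.

End Hom.

Lemma fderivD a b : fderiv (a + b) = fderiv a + fderiv b.
Proof. by apply/fpsP=> i; rewrite /= mulrnDl. Qed.

Lemma fderivN a : fderiv (- a) = - fderiv a.
Proof. by apply/fpsP=> i; rewrite /= mulNrn. Qed.

Lemma fderiv_const c : fderiv (fps_const c) = 0 :> {fps R}.
Proof. by apply/fpsP=> i; rewrite /= mul0rn. Qed.

Lemma fderiv_fvar : fderiv (fvar R) = 1.
Proof. by apply/fpsP=> -[|i]; rewrite /= ?mulr1n ?mul0rn. Qed.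

Lemma fderivM a b : fderiv (a * b) = fderiv a * b + a * fderiv b.
Proof.
apply/fpsP=> i; rewrite fcoefD.
have e1 : fcoef (fderiv a * b) i = \sum_(j < i.+2) fcoef a j * fcoef b (i.+1 - j) *+ j.
  rewrite big_ord_recl mulr0n add0r fcoefM; apply: eq_bigr => j _ /=.
  by rewrite mulrnAl subSS.
have e2 : fcoef (a * fderiv b) i = \sum_(j < i.+2) fcoef a j * fcoef b (i.+1 - j) *+
  (i.+1 - j).
  rewrite big_ord_recr /= subnn mulr0n addr0; apply: eq_bigr => j _ /=.
  by rewrite mulrnAr subSn // -ltnS.
rewrite e1 e2 -big_split -[LHS]/(fcoef (a * b) i.+1 *+ i.+1) fcoefM -sumrMnl;
  apply: eq_bigr => j _.
by rewrite /= -mulrnDr subnKC // -ltnS.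
Qed.

End Evaluation.

(** The step at n receives the earlier values as a function; by hypothesis it ignores the values
    from n on, so the default [v0] is harmless. *)
Lemma strong_recursion (V : Type) (v0 : V) (step : nat -> (nat -> V) -> V) :
    (forall n f g, (forall i, (i < n)%N -> f i = g i) -> step n f = step n g) ->
  exists F, forall n, F n = step n F.
Proof.
move=> ext; pose l := fix l n :=
  if n is n'.+1 then rcons (l n') (step n' (nth v0 (l n'))) else [::].
have sl n : size (l n) = n by elim: n => //= n IHn; rewrite size_rcons IHn.
have nl n i : (i < n)%N -> nth v0 (l n) i = step i (nth v0 (l i)).
  elim: n => // n IHn; rewrite ltnS leq_eqVlt /= nth_rcons sl.
  by case: eqVneq => [->|_] /=; [rewrite ltnn | move=> lt_i; rewrite lt_i IHn].
exists (fun n => step n (nth v0 (l n))) => n; apply: ext => i lt_i.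
by rewrite nl.
Qed.

(** * First order: the disc series *)

Section DiscSeries.
Variables (K : comNzRingType) (kap : nat -> K).

(* F a n is the planar sum of an n-cycle one point of which has mass a + 1, all
   others having mass 1; the value kap a at n = 0 makes the recursion uniform. *)
Definition disc_rec (F : nat -> nat -> K) :=
  (forall a, F a 0%N = kap a) /\
  (forall a n, F a n.+1 = \sum_(i < n.+1) F a.+1 i * F 0%N (n - i)%N).

Lemma disc_rec_exists : exists F, disc_rec F.
Proof.
pose step n (f : nat -> nat -> K) a :=
  if n is n'.+1 then \sum_(i < n'.+1) f i a.+1 * f (n' - i)%N 0%N else kap a.
have [|F FE] := @strong_recursion _ (fun=> 0) step.
  move=> [|n] f g e; apply: funext => a //=; apply: eq_bigr => i _.
  by rewrite !e // ltnS leq_subr.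
by exists (fun a n => F n a); split=> [a|a n]; rewrite FE.
Qed.

Lemma disc_rec_uniq F G : disc_rec F -> disc_rec G -> forall n a, F a n = G a n.
Proof.
move=> [F0 FS] [G0 GS]; elim/ltn_ind=> -[|n] IHn a; first by rewrite F0 G0.
by rewrite FS GS; apply: eq_bigr => i _; rewrite !IHn // ltnS leq_subr.
Qed.

Variable F : nat -> nat -> K.
Hypothesis rF : disc_rec F.

Definition disc a : {fps K} := \fps_n F a n.
Let M := disc 0.
Let z := fvar K * M.

Lemma zM0 (A : {fps K}) : fcoef (fvar K * A) 0 = 0.
Proof. by rewrite fcoef_fvarM. Qed.
Let z0 : fcoef z 0 = 0 := zM0 M.

Lemma disc_shift a : disc a = fps_const (kap a) + z * disc a.+1.
Proof.
have [F0 FS] := rF; apply/fpsP=> -[|n]; rewrite fcoefD /z -mulrA fcoef_fvarM.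
  by rewrite addr0 /= F0.
by rewrite add0r [M * _]mulrC fcoefM /= FS.
Qed.

(** More generally [disc a] is the sum of kappa_(a+k) z^k: both families satisfy e_a = kappa_a + z
    e_(a+1), and its solution is unique. *)
Lemma disc_comp : M = feval (\fps_k fps_const (kap k)) z.
Proof.
apply/eqP; rewrite -subr_eq0; apply/eqP.
pose E a := disc a - feval (\fps_k fps_const (kap (a + k)%N)) z.
apply: (@fshift_uniq _ z _ E succn z0 _ 0) => a;
  rewrite /E {1}disc_shift feval_shift //= addn0.
rewrite (_ : fshift _ = \fps_k fps_const (kap (a.+1 + k)%N)); first ring.
by apply/fpsP=> k; rewrite /= addSnnS.
Qed.

(** This is C'(z): as [disc k.+1] is the sum over l of kappa_(k+1+l) z^l, the power z^m receives
    kappa_(m+1) exactly m + 1 times. *)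
Definition disc_sum := feval (\fps_k disc k.+1) z.

(** The chain rule for M = C(z), obtained for all masses a at once. *)
Lemma fderiv_disc : fderiv M = fderiv z * disc_sum.
Proof.
apply/eqP; rewrite -subr_eq0; apply/eqP.
pose E a := fderiv (disc a) - fderiv z * feval (\fps_k disc (a + k).+1) z.
apply: (@fshift_uniq _ z _ E succn z0 _ 0) => a; rewrite /E {1}disc_shift.
rewrite fderivD fderiv_const add0r fderivM feval_shift //= addn0.
rewrite (_ : fshift _ = \fps_k disc (a.+1 + k).+1); first ring.
by apply/fpsP=> k; rewrite /= addSnnS.
Qed.

(** 1 - x C'(z) is the factor by which the linear systems below have to be divided; this is the
    origin of z'/M in the second order relation. *)
Lemma fderiv_xM : fderiv z * (1 - fvar K * disc_sum) = M.
Proof.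
have : fderiv z = M + fvar K * fderiv M by rewrite /z fderivM fderiv_fvar mul1r.
rewrite fderiv_disc => e; transitivity (fderiv z - fvar K * (fderiv z * disc_sum));
  first ring.
by rewrite {1}e addrK.
Qed.

End DiscSeries.

(* F_t is the disc recursion for kap + t [a = p]; its derivative at t = 0 counts
   partitions with a distinguished block of size p. *)
Section Perturbation.
Variables (K : comNzRingType) (kap : nat -> K) (p : nat).
Let kapt a : {poly K} := (kap a)%:P + (a == p)%:R * 'X.
Variable Ft : nat -> nat -> {poly K}.
Hypothesis rFt : disc_rec kapt Ft.
Let F a n := (Ft a n)`_0.
Let E a n := (Ft a n)`_1.

Let coef1M (r q : {poly K}) : (r * q)`_1 = r`_0 * q`_1 + r`_1 * q`_0.
Proof. by rewrite coefM big_ord_recl big_ord1. Qed.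

Let kapt0 a : (kapt a)`_0 = kap a.
Proof. by rewrite /kapt coefD coefC coefMX addr0. Qed.

Let kapt1 a : (kapt a)`_1 = (a == p)%:R.
Proof. by rewrite /kapt coefD coefC coefMX add0r /= -polyC_natr coefC. Qed.

Lemma disc_rec_coef0 : disc_rec kap F.
Proof.
have [F0 FS] := rFt; split=> [a|a n]; first by rewrite /F F0 kapt0.
by rewrite /F FS coef_sum; apply: eq_bigr => i _; rewrite coef0M.
Qed.

Let M := disc F 0.
Let z := fvar K * M.
Let z0 : fcoef z 0 = 0 := zM0 M.

Let Es a : {fps K} := \fps_n E a n.

Let Es_shift a : Es a = fps_const (a == p)%:R + fvar K * disc F a.+1 * Es 0 + z * Es a.+1.
Proof.
have [F0 FS] := rFt; rewrite -addrA -!mulrA -mulrDr [M * _]mulrC.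
apply/fpsP=> -[|n]; rewrite fcoefD fcoef_fvarM; first by rewrite addr0 /= /E F0 kapt1.
rewrite add0r fcoefD !fcoefM -big_split /= /E FS coef_sum; apply: eq_bigr => i _.
by rewrite coef1M.
Qed.

(** Differentiating M = C(z) with respect to kappa_p gives dM = z^p + x C'(z) dM, and [fderiv_xM]
    turns the division by 1 - x C'(z) into the factor z'/M. *)
Lemma perturbation : \fps_n E 0 n * M = fderiv z * z ^+ p.
Proof.
have e : Es 0 = z ^+ p + fvar K * Es 0 * disc_sum F.
  apply/eqP; rewrite -subr_eq0; apply/eqP.
  (* The power of z solves the system with source [a = p]: the source reaches the index a after p -
     a steps, each costing a factor z. *)
  pose D a := Es a - ((if (a <= p)%N then z ^+ (p - a) else 0)
                      + fvar K * Es 0 * feval (\fps_k disc F (a + k).+1) z).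
  have := @fshift_uniq _ z _ D succn z0 _ 0; rewrite /D subn0; apply=> a.
  rewrite {1}Es_shift feval_shift //= addn0.
  rewrite (_ : fshift _ = \fps_k disc F (a.+1 + k).+1); last first.
    by apply/fpsP=> k; rewrite /= addSnnS.
  case: (ltngtP a p) => [lt_a|_|->].
  - rewrite subnS -[X in z ^+ X](@prednK (p - a)) ?subn_gt0 // exprS.
    rewrite (_ : fps_const _ = 0); first ring.
    by apply/fpsP=> -[].
  - rewrite (_ : fps_const _ = 0); first ring.
    by apply/fpsP=> -[].
  rewrite subnn expr0 (_ : fps_const _ = 1); first ring.
  by apply/fpsP=> -[].
rewrite -/(Es 0); have eM : _ = M := fderiv_xM disc_rec_coef0;
  rewrite -[X in _ * X = _]eM -/z.
transitivity (fderiv z * (Es 0 - fvar K * Es 0 * disc_sum F)); first ring.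
by rewrite {1}e addrK.
Qed.

End Perturbation.

(** * Two variables and the annular series *)

Section TwoVariables.
Variable K : fieldType.
Implicit Types (f g : {fps {fps K}}).

Lemma fps_constD (R : comNzRingType) (r s : R) :
  fps_const (r + s) = fps_const r + fps_const s.
Proof. by apply/fpsP=> -[|i]; rewrite fcoefD //= addr0. Qed.

Lemma fps_constM (R : comNzRingType) (r s : R) :
  fps_const (r * s) = fps_const r * fps_const s.
Proof. by apply/fpsP=> -[|i]; rewrite fcoef_constM //= mulr0. Qed.

Lemma fps_constN (R : comNzRingType) (r : R) : fps_const (- r) = - fps_const r.
Proof. by apply/fpsP=> -[|i]; rewrite fcoefN //= oppr0. Qed.

Lemma in_xD (a b : {fps K}) : in_x (a + b) = in_x a + in_x b.
Proof. by apply/fpsP=> i; rewrite fcoefD /= fps_constD. Qed.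

Lemma in_xN (a : {fps K}) : in_x (- a) = - in_x a.
Proof. by apply/fpsP=> i; rewrite fcoefN /= fps_constN. Qed.

Lemma in_xM (a b : {fps K}) : in_x (a * b) = in_x a * in_x b.
Proof.
apply/fpsP=> i; rewrite fcoefM -[LHS]/(fps_const (fcoef (a * b) i)) fcoefM.
rewrite (big_morph (@fps_const K) (@fps_constD K) (id1 := 0) (op1 := +%R)).
  by apply: eq_bigr => j _; rewrite fps_constM.
by apply/fpsP=> -[].
Qed.

Lemma in_x1 : in_x (1 : {fps K}) = 1.
Proof. by apply/fpsP=> -[|i]; apply/fpsP=> -[]. Qed.

Lemma in_x_const (r : K) : in_x (fps_const r) = in_y (fps_const r).
Proof. by apply/fpsP=> -[|i] //; apply/fpsP=> -[]. Qed.

Lemma in_yD (a b : {fps K}) : in_y (a + b) = in_y a +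
  in_y b. Proof. exact: fps_constD. Qed.
Lemma in_yM (a b : {fps K}) : in_y (a * b) = in_y a * in_y b. Proof. exact: fps_constM.
  Qed.

Lemma deriv_yD f g : deriv_y (f + g) = deriv_y f + deriv_y g.
Proof. by apply/fpsP=> i; rewrite /= fderivD. Qed.

Lemma deriv_yN f : deriv_y (- f) = - deriv_y f.
Proof. by apply/fpsP=> i; rewrite /= fderivN. Qed.

Lemma deriv_yM f g : deriv_y (f * g) = deriv_y f * g + f * deriv_y g.
Proof.
apply/fpsP=> i; rewrite fcoefD !fcoefM -big_split -[LHS]/(fderiv (fcoef (f * g) i))
  fcoefM.
rewrite (big_morph (@fderiv K) (@fderivD K) (id1 := 0) (op1 := +%R)).
  by apply: eq_bigr => j _; rewrite fderivM.
by apply/fpsP=> j; rewrite /= mul0rn.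
Qed.

Lemma deriv_y_in_x (a : {fps K}) : deriv_y (in_x a) = 0.
Proof. by apply/fpsP=> i; rewrite /= fderiv_const. Qed.

Lemma deriv_y_in_y (a : {fps K}) : deriv_y (in_y a) = in_y (fderiv a).
Proof. by apply/fpsP=> -[|i] //; apply/fpsP=> j; rewrite /= mul0rn. Qed.

Lemma fcoef_in_x0 (a : {fps K}) : fcoef a 0 = 0 -> fcoef (in_x a) 0 = 0.
Proof. by move=> a0; rewrite /= a0; apply/fpsP=> -[]. Qed.

Lemma in_x_feval F (a : {fps K}) : fcoef a 0 = 0 ->
  in_x (feval F a) = feval (\fps_k in_x (fcoef F k)) (in_x a).
Proof.
move=> a0; apply/eqP; rewrite -subr_eq0; apply/eqP.
pose E (H : {fps {fps K}}) := in_x (feval H a) - feval (\fps_k in_x (fcoef H k)) (in_x a).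
apply: (@fshift_uniq _ (in_x a) _ E (@fshift _) (fcoef_in_x0 a0) _ F) => H.
rewrite /E (feval_shift H a0) in_xD in_xM.
rewrite (feval_shift (\fps_k in_x (fcoef H k)) (fcoef_in_x0 a0)).
by rewrite opprD addrACA subrr add0r mulrBr.
Qed.

Lemma fcoef_in_xM (a : {fps K}) f m n : fcoef (fcoef (in_x a * f) m) n =
  \sum_(i < m.+1) fcoef a i * fcoef (fcoef f (m - i)) n.
Proof. by rewrite fcoefM fcoef_sum; apply: eq_bigr => i _; rewrite fcoef_constM. Qed.

Lemma fcoef_Min_x (a : {fps K}) f m n : fcoef (fcoef (f * in_x a) m) n =
  \sum_(i < m.+1) fcoef (fcoef f i) n * fcoef a (m - i).
Proof.
rewrite fcoefM fcoef_sum; apply: eq_bigr => i _.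
by rewrite mulrC fcoef_constM mulrC.
Qed.

Section Annular.
Variables (kap : nat -> K) (F : nat -> nat -> K).
Hypothesis rF : disc_rec kap F.

(* The same for two cycles, of sizes m (with the marked point) and n. *)
Definition annular_rec (G : nat -> nat -> nat -> K) :=
  (forall a n, G a 0%N n = 0) /\
  (forall a m n, G a m.+1 n =
    \sum_(i < m.+1) (G a.+1 i n * F 0%N (m - i)%N + F a.+1 i * G 0%N (m - i)%N n)
    + F a.+1 (m + n)%N *+ n).

Lemma annular_rec_exists : exists G, annular_rec G.
Proof.
pose step m (f : nat -> nat -> nat -> K) a n :=
  if m is m'.+1 then
    \sum_(i < m'.+1) (f i a.+1 n * F 0%N (m' - i)%N + F a.+1 i * f (m' - i)%N 0%N n)
    + F a.+1 (m' + n)%N *+ n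
  else 0.
have [|G GE] := @strong_recursion _ (fun _ _ => 0) step.
  move=> [|m] f g e; apply: funext => a; apply: funext => n //=; congr (_ + _).
  by apply: eq_bigr => i _; rewrite !e // ltnS leq_subr.
by exists (fun a m n => G m a n); split=> [a n|a m n]; rewrite GE.
Qed.

Variable G : nat -> nat -> nat -> K.
Hypothesis rG : annular_rec G.

Lemma annular_rec_n0 m a : G a m 0 = 0.
Proof.
have [G0 GS] := rG; elim/ltn_ind: m a => -[|m] IHm a; first exact: G0.
rewrite GS mulr0n addr0 big1 // => i _.
by rewrite !IHm ?mul0r ?mulr0 ?addr0 // ltnS leq_subr.
Qed.

Definition annular a : {fps {fps K}} := \fps_m \fps_n G a m n.

Let M := disc F 0.
Let z := fvar K * M.
Let z0 : fcoef z 0 = 0 := zM0 M.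
Let X := in_x (fvar K).
Let Y := in_y (fvar K).
Let u := in_x z.
Let v := in_y z.
Let u0 : fcoef u 0 = 0 := fcoef_in_x0 z0.

(** The divided difference (x A(x) - y A(y)) / (x - y) of A = [disc F a], as [eN] shows; applying y
    d/dy to it supplies the factor n of the joining term. *)
Let N a : {fps {fps K}} := \fps_m \fps_n F a (m + n)%N.
Let Q a := Y * deriv_y (N a).
Let S := feval (\fps_k N k.+1) u.

Let annular_shift a :
  annular a = X * (in_x (disc F a.+1) * annular 0 + Q a.+1) + u * annular a.+1.
Proof.
have [G0 GS] := rG.
have -> : u * annular a.+1 = X * (annular a.+1 * in_x M) by rewrite /u /z in_xM -/X; ring.
rewrite -mulrDr /X in_x_fvar; apply/fpsP=> -[|m]; rewrite fcoef_fvarM; apply/fpsP=> n.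
  by rewrite /= G0.
have eQ : fcoef (fcoef (Q a.+1) m) n = F a.+1 (m + n)%N *+ n.
  by rewrite fcoef_constM fcoef_fvarM; case: n => //= n; rewrite addnS.
rewrite !fcoefD eQ fcoef_in_xM fcoef_Min_x -[LHS]/(G a m.+1 n) GS big_split.
by rewrite -addrA addrC.
Qed.

Let W := disc_sum F.

(** u does not involve y, so y d/dy can be taken out of the sum over the masses, and only the single
    series [S] remains to be found. *)
Let annular_eq : annular 0 = X * annular 0 * in_x W + X * (Y * deriv_y S).
Proof.
have eW : in_x W = feval (\fps_k in_x (disc F k.+1)) u by exact: (in_x_feval _ z0).
have eS : Y * deriv_y S = feval (\fps_k Q k.+1) u.
  apply: (@feval_linear _ u u0 (fun f => Y * deriv_y f)) => [f g|f].
    by rewrite deriv_yD mulrDr.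
  by rewrite deriv_yM deriv_y_in_x; ring.
rewrite eW eS; apply/eqP; rewrite -subr_eq0; apply/eqP.
pose E a := annular a - (X * annular 0 * feval (\fps_k in_x (disc F (a + k).+1)) u
                     + X * feval (\fps_k Q (a + k).+1) u).
apply: (@fshift_uniq _ u _ E succn u0 _ 0) => a; rewrite /E {1}annular_shift.
rewrite (feval_shift (\fps_k in_x _) u0) (feval_shift (\fps_k Q _) u0) /= addn0.
rewrite (_ : fshift (\fps_k in_x _) = \fps_k in_x (disc F (a.+1 + k).+1)); last first.
  by apply/fpsP=> k; rewrite /= addSnnS.
rewrite (_ : fshift (\fps_k Q _) = \fps_k Q (a.+1 + k).+1); last first.
  by apply/fpsP=> k; rewrite /= addSnnS.
ring.
Qed.

Let eN a : (X - Y) * N a = X * in_x (disc F a) - Y * in_y (disc F a).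
Proof.
rewrite mulrBl /X in_x_fvar; apply/fpsP=> i; apply/fpsP=> j.
rewrite !(fcoefD, fcoefN) !fcoef_constM !fcoef_fvarM.
case: i => [|i]; case: j => [|j]; rewrite ?fcoef_fvarM ?mulr0 //=.
  by rewrite addn0.
by rewrite addSnnS !subrr.
Qed.

Let W2 := feval (\fps_k in_y (disc F k.+1)) u.

Let eS : (X - Y) * S = X * in_x W - Y * W2.
Proof.
rewrite /S (fevalZ u0) (in_x_feval _ z0) (fevalZ u0 X) (fevalZ u0 Y) -(fevalN u0)
  -(fevalD u0).
by congr feval; apply/fpsP=> k; rewrite fcoefD fcoefN -[LHS]/((X - Y) * N k.+1) eN.
Qed.

(** [W2] is the divided difference of C at u and v. The sum of A_k(y) u^k is evaluated in two ways:
    by splitting off k = 0, and by A_k(y) = kappa_k + v A_(k+1)(y). *)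
Let eW2 : (u - v) * W2 = in_x M - in_y M.
Proof.
have e1 : feval (\fps_k in_y (disc F k)) u = in_y M + u * W2 by apply: (feval_shift _ u0).
have e2 : feval (\fps_k in_y (disc F k)) u = in_x M + v * W2.
  rewrite [X in in_x X](disc_comp rF) (in_x_feval _ z0) /W2 (fevalZ u0 v) -(fevalD u0).
  congr feval; apply/fpsP=> k; rewrite fcoefD /= {1}(disc_shift rF) in_yD in_yM.
  by rewrite in_x_const.
have /eqP := e2; rewrite e1 -subr_eq0 => /eqP e3.
apply/eqP; rewrite -subr_eq0; apply/eqP; rewrite -[RHS]e3; ring.
Qed.

Let zx := in_x (fderiv z).
Let zy := in_y (fderiv z).
Let Mx := in_x M.

Let e_zx : zx * (1 - X * in_x W) = Mx.
Proof. by rewrite /zx /X -in_x1 -in_xM -in_xN -in_xD -in_xM (fderiv_xM rF). Qed.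

(** As fractions this reads S zx = M(x) (zx / (u - v) - 1 / (x - y)), where zx, u and M(x) are free
    of y. *)
Let eSz : (u - v) * (X - Y) * S * zx = Mx * (zx * (X - Y) - (u - v)).
Proof.
have eu : u = X * Mx by rewrite /u /z in_xM.
have ev : v = Y * in_y M by rewrite /v /z in_yM.
transitivity ((u - v) * X * (zx * in_x W) - Y * ((u - v) * W2) * zx).
  transitivity ((u - v) * ((X - Y) * S) * zx); first ring.
  by rewrite eS; ring.
have -> : (u - v) * X * (zx * in_x W) = (u - v) * (zx - Mx) by rewrite -e_zx; ring.
by rewrite eW2 -/Mx eu ev; ring.
Qed.

(** The y-derivative of [eSz] is zx dS/dy = M(x) (zx zy / (u - v)^2 - 1 / (x - y)^2), while
    [annular_eq] and [e_zx] give T M(x) = x y zx dS/dy for T = [annular 0]. *)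
Lemma annular_universal : kap 0 = 1 ->
  annular 0 * ((u - v) ^+ 2 * (X - Y) ^+ 2) =
  X * Y * (zx * zy * (X - Y) ^+ 2 - (u - v) ^+ 2).
Proof.
move=> kap0; have deriv_u : deriv_y u = 0 by apply: deriv_y_in_x.
have deriv_X : deriv_y X = 0 by apply: deriv_y_in_x.
have deriv_v : deriv_y v = zy by apply: deriv_y_in_y.
have deriv_Y : deriv_y Y = 1 by rewrite /Y deriv_y_in_y fderiv_fvar.
have := congr1 (@deriv_y K) eSz.
rewrite !(deriv_yM, deriv_yD, deriv_yN) deriv_u deriv_X deriv_v deriv_Y.
rewrite (deriv_y_in_x (fderiv z)) (deriv_y_in_x M) => eS'.
have eA : annular 0 * Mx = zx * X * Y * deriv_y S.
  rewrite -e_zx; transitivity (zx * (annular 0 - X * annular 0 * in_x W)); first ring.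
  by rewrite {1}annular_eq; ring.
have Mx0 : Mx != 0.
  apply/eqP=> Mx0; have /fpsP/(_ 0%N)/fpsP/(_ 0%N) := Mx0.
  by rewrite /= rF.1 kap0 => /eqP; rewrite oner_eq0.
apply: (mulfI Mx0).
have -> : Mx * (annular 0 * ((u - v) ^+ 2 * (X - Y) ^+ 2)) =
  annular 0 * Mx * ((u - v) ^+ 2 * (X - Y) ^+ 2) by ring.
rewrite eA.
have e1 : zx * ((u - v) ^+ 2 * (X - Y) ^+ 2) * deriv_y S =
  (u - v) * (X - Y) * Mx * (zy - zx)
  + (zy * (X - Y) + (u - v)) * ((u - v) * (X - Y) * S * zx).
  transitivity ((u - v) * (X - Y) * (zx * ((u - v) * (X - Y) * deriv_y S))); first ring.
  have -> : zx * ((u - v) * (X - Y) * deriv_y S) = Mx * (zy - zx)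
     + zx * (zy * (X - Y) * S + (u - v) * S).
    apply/eqP; rewrite -subr_eq0; apply/eqP.
    move/eqP: eS'; rewrite -subr_eq0 => /eqP e; rewrite -[RHS]e; ring.
  ring.
transitivity (X * Y * (zx * ((u - v) ^+ 2 * (X - Y) ^+ 2) * deriv_y S)); first ring.
by rewrite e1 eSz; ring.
Qed.

End Annular.
End TwoVariables.

(** * The logarithmic derivative *)

Section Log.
Variable K : fieldType.
Implicit Types (f g U V : {fps {fps K}}).

Lemma fcoef2M f g i j : fcoef (fcoef (f * g) i) j =
  \sum_(k < i.+1) \sum_(l < j.+1)
    fcoef (fcoef f k) l * fcoef (fcoef g (i - k)) (j - l).
Proof. by rewrite fcoefM fcoef_sum; apply: eq_bigr => k _; rewrite fcoefM. Qed.

Definition low n f := forall i j, (i + j < n)%N -> fcoef (fcoef f i) j = 0.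

Lemma lowM n m f g : low n f -> low m g -> low (n + m) (f * g).
Proof.
move=> lf lg i j lt_ij; rewrite fcoef2M big1 // => k _; rewrite big1 // => l _.
have [lt_kl|le_kl] := ltnP (k + l) n; first by rewrite lf ?mul0r.
rewrite lg ?mulr0 //; have := ltn_ord k; have := ltn_ord l; lia.
Qed.

Lemma lowX n f : low 1 f -> low n (f ^+ n).
Proof. by move=> lf; elim: n => // n IHn; rewrite exprS -add1n; apply: lowM. Qed.

Lemma deriv_yX V n : deriv_y (V ^+ n) = n%:R * (V ^+ n.-1 * deriv_y V).
Proof.
elim: n => [|n IHn].
  by rewrite expr0 mul0r; apply/fpsP=> -[|i]; apply/fpsP=> j; rewrite /= ?mul0rn //;
    case: j => [|j] /=; rewrite mul0rn.
rewrite exprS deriv_yM IHn -natr1 /=; case: n {IHn} => [|n] /=; first by rewrite mul0r;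
  ring.
by rewrite exprS; ring.
Qed.

(** Partial sums of the logarithm telescope: with U = 1 + V, the derivative of the N-th one times U
    is dV (1 - (-V)^N), and the error has degree at least N. *)
Lemma deriv_y_log U : (forall k, k.+1%:R != 0 :> K) -> fcoef (fcoef U 0) 0 = 1 ->
  deriv_y (flog2 U) * U = deriv_y U.
Proof.
move=> char0 U1; pose V := U - 1; have eU : U = 1 + V by rewrite /V addrC subrK.
have lV : low 1 V by move=> [|i] [|j] // _; rewrite !fcoefD U1 /= subrr.
have eUV : deriv_y U = deriv_y V.
  rewrite eU deriv_yD (_ : deriv_y 1 = 0) ?add0r //.
  by rewrite -(in_x1 K) deriv_y_in_x.
pose c k : {fps {fps K}} := in_y (fps_const ((-1) ^+ k.-1 / k%:R)).
pose L N := \sum_(1 <= k < N.+1) c k * V ^+ k.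
have Lij N i j : (i + j <= N)%N -> fcoef (fcoef (flog2 U) i) j = fcoef (fcoef (L N) i) j.
  move=> le_N; rewrite -[LHS]/(\sum_(1 <= k < (i +
    j).+1) (-1) ^+ k.-1 / k%:R * fcoef (fcoef (V ^+ k) i) j).
  rewrite /L !fcoef_sum; pose E k := fcoef (fcoef (c k * V ^+ k) i) j.
  have -> : \sum_(1 <= k < N.+1) E k =
      \sum_(1 <= k < (i + j).+1) E k + \sum_((i + j).+1 <= k < N.+1) E k.
    by apply: big_cat_nat.
  rewrite /E [X in _ + X]big_nat_cond [X in _ + X]big1 ?addr0.
    by apply: eq_bigr => k _; rewrite !fcoef_constM.
  by move=> k /andP[/andP[lt_k _] _]; rewrite !fcoef_constM lowX ?mulr0.
have dL N : deriv_y (L N) * U = deriv_y V * (1 - (- V) ^+ N).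
  elim: N => [|N IHN].
    rewrite /L big_geq // expr0 subrr mulr0 (_ : deriv_y 0 = 0) ?mul0r //.
    by apply/fpsP=> i; apply/fpsP=> j; rewrite /= mul0rn.
  rewrite /L big_nat_recr // deriv_yD mulrDl IHN deriv_yM deriv_yX /=.
  rewrite deriv_y_in_y fderiv_const (_ : in_y 0 = 0) ?mul0r ?add0r;
    last by apply/fpsP=> -[].
  have -> : c N.+1 * (N.+1%:R * (V ^+ N * deriv_y V)) = (- V) ^+ N * deriv_y V.
    rewrite mulrA (_ : c N.+1 * _ = (-1) ^+ N); first by rewrite [in RHS]exprNn; ring.
    have -> : N.+1%:R = in_y (fps_const (N.+1%:R)) :> {fps {fps K}}.
      have nat_const (R : comNzRingType) n : n%:R = fps_const n%:R :> {fps R}.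
        elim: n => [|n IHn]; first by apply/fpsP=> -[].
        by rewrite -!natr1 IHn fps_constD.
      by rewrite !nat_const.
    rewrite -in_yM -fps_constM /= divfK //.
    have sign_const (R : comNzRingType) n : fps_const ((-1) ^+ n) = (-1) ^+ n :> {fps R}.
      elim: n => // n IHn; rewrite !exprS fps_constM IHn; congr (_ * _).
      by rewrite fps_constN.
    by rewrite /in_y !sign_const.
  by rewrite eU exprS; ring.
apply/fpsP=> i; apply/fpsP=> j; rewrite eUV.
(* The truncation is at i + j + 1 because [deriv_y] reads a coefficient one degree higher. *)
transitivity (fcoef (fcoef (deriv_y (L (i + j).+1) * U) i) j).
  rewrite !fcoef2M; apply: eq_bigr => k _; apply: eq_bigr => l _; congr (_ * _).
  rewrite -[LHS]/(fcoef (fcoef (flog2 U) k) l.+1 *+ l.+1) (Lij (i + j).+1) //.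
  have := ltn_ord k; have := ltn_ord l; lia.
rewrite dL mulrBr mulr1 !(fcoefD, fcoefN).
rewrite (_ : fcoef (fcoef (_ * _ ^+ _) i) j = 0) ?subr0 //.
apply: (@lowM 0 (i + j).+1) => //; apply: lowX => k l kl.
by rewrite !fcoefN lV ?oppr0.
Qed.

End Log.

Lemma fps_const0 (R : comNzRingType) : fps_const (0 : R) = 0.
Proof. by apply/fpsP=> -[]. Qed.

(** * Substitution of one series for both variables *)

Section Substitution.
Variable K : fieldType.
Implicit Types (f g : {fps {fps K}}).

Lemma fcomp_feval (a z : {fps K}) : fcomp a z = feval (in_x a) z.
Proof. by apply/fpsP=> i; apply: eq_bigr => k _; apply/esym/fcoef_constM. Qed.

Variable z : {fps K}.
Hypothesis z0 : fcoef z 0 = 0.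
Let u := in_x z.
Let u0 : fcoef u 0 = 0 := fcoef_in_x0 z0.

Lemma fcompD a b : fcomp (a + b) z = fcomp a z + fcomp b z.
Proof. by rewrite !fcomp_feval in_xD fevalD. Qed.

Lemma fcompM a b : fcomp (a * b) z = fcomp a z * fcomp b z.
Proof. by rewrite !fcomp_feval in_xM fevalM. Qed.

Lemma fcomp_const (r : K) : fcomp (fps_const r) z = fps_const r.
Proof. by rewrite fcomp_feval in_x_const feval_const. Qed.

Lemma fcomp0 : fcomp 0 z = 0.
Proof. by rewrite -(fps_const0 K) fcomp_const. Qed.

Lemma fcomp_fvar : fcomp (fvar K) z = z.
Proof.
by rewrite fcomp_feval in_x_fvar -[fvar _]mulr1 feval_fvarM // feval1 // mulr1.
Qed.

Lemma fcomp_deriv a : fderiv (fcomp a z) = fderiv z * fcomp (fderiv a) z.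
Proof.
apply/eqP; rewrite -subr_eq0; apply/eqP.
pose E b := fderiv (fcomp b z) - fderiv z * fcomp (fderiv b) z.
apply: (@fshift_uniq _ z _ E (@fshift _) z0 _ a) => b; rewrite /E {1 2}(fps_split b).
rewrite fcompD fcompM fcomp_const fcomp_fvar !fderivD !fderivM !fderiv_const fderiv_fvar.
by rewrite mul1r !fcompD fcompM fcomp_fvar fcomp0; ring.
Qed.

(** Two one-variable substitutions, y inside and x outside, so that multiplicativity follows from
    the one-variable case; [fcomp2_subst2] links it to [fcomp2]. *)
Definition subst2 f : {fps {fps K}} := feval (\fps_k in_y (fcomp (fcoef f k) z)) u.

Lemma subst2D f g : subst2 (f + g) = subst2 f + subst2 g.
Proof.
by rewrite /subst2 -(fevalD u0); congr feval; apply/fpsP=> k;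
  rewrite fcoefD /= fcompD in_yD.
Qed.

Lemma fcomp_sum (I : Type) (r : seq I) (P : pred I) (a : I -> {fps K}) :
  fcomp (\sum_(k <- r | P k) a k) z = \sum_(k <- r | P k) fcomp (a k) z.
Proof.
apply: (big_morph (fun b => fcomp b z) fcompD).
exact: fcomp0.
Qed.

Lemma subst2M f g : subst2 (f * g) = subst2 f * subst2 g.
Proof.
rewrite /subst2 -(fevalM u0); congr feval; apply/fpsP=> k.
rewrite -[LHS]/(in_y (fcomp (fcoef (f * g) k) z)) !fcoefM fcomp_sum.
rewrite (big_morph (@in_y K) (@in_yD K) (id1 := 0) (op1 := +%R)).
  by apply: eq_bigr => l _; rewrite fcompM in_yM.
by apply/fpsP=> -[].
Qed.

Lemma subst2_in_y a : subst2 (in_y a) = in_y (fcomp a z).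
Proof.
rewrite /subst2 -[RHS](@feval_const _ u u0); congr feval.
by apply/fpsP=> -[|k] //=; rewrite fcomp0; apply: fps_const0.
Qed.

Lemma subst2_in_x a : subst2 (in_x a) = in_x (fcomp a z).
Proof.
rewrite fcomp_feval (in_x_feval _ z0); congr feval; apply/fpsP=> k /=.
by rewrite fcomp_const in_x_const.
Qed.

Lemma in_xX (a : {fps K}) n : in_x (a ^+ n) = in_x a ^+ n.
Proof. by elim: n => [|n IHn]; rewrite ?in_x1 // !exprS in_xM IHn. Qed.

Lemma in_yX (a : {fps K}) n : in_y (a ^+ n) = in_y a ^+ n.
Proof. by elim: n => // n IHn; rewrite !exprS in_yM IHn. Qed.

Lemma fcoef2_in_xy (a b : {fps K}) i j :
  fcoef (fcoef (in_x a * in_y b) i) j = fcoef a i * fcoef b j.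
Proof. by rewrite mulrC fcoef_constM mulrC fcoef_constM. Qed.

Lemma fcoef_subst2 f i j N : (i <= N)%N -> (j <= N)%N ->
  fcoef (fcoef (subst2 f) i) j =
  \sum_(k < N.+1) \sum_(l < N.+1) fcoef (fcoef f k) l * (fcoef (z ^+ k) i * fcoef (z ^+
    l) j).
Proof.
move=> le_i le_j; rewrite (@fcoef_feval _ _ _ _ N.+1) // !fcoef_sum;
  apply: eq_bigr => k _.
rewrite -in_xX.
rewrite -[LHS]/(fcoef (fcoef (in_y (fcomp (fcoef f k) z) * in_x (z ^+ k)) i) j).
rewrite mulrC fcoef2_in_xy fcomp_feval.
rewrite (@fcoef_feval _ _ _ _ N.+1) // fcoef_sum mulr_sumr; apply: eq_bigr => l _.
by rewrite fcoef_constM; ring.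
Qed.

Lemma fcomp2_subst2 f : fcomp2 f u (in_y z) = subst2 f.
Proof.
apply/fpsP=> i; apply/fpsP=> j;
  rewrite (@fcoef_subst2 _ _ _ (i + j)) ?leq_addr ?leq_addl //.
apply: eq_bigr => k _; apply: eq_bigr => l _.
by rewrite -in_xX -in_yX fcoef2_in_xy.
Qed.

End Substitution.

(** [tU], [tx], [ty], [txy] are U and its derivatives taken at (u, v), [tL'] is the mixed derivative
    of log U there, and [Px], [Py] are C'(u), C'(v). The identity reflects U = M(x) M(y) (x - y) /
    (u - v) at (u, v): only log (x - y) - log (u - v) survives a mixed derivative in x and y. *)
Lemma dlog_algebra (R : idomainType) (X Y Mx My u v zx zy Px Py tU tx ty txy tL tL' : R) :
  X - Y != 0 -> Mx != 0 -> My != 0 -> u = X * Mx -> v = Y * My ->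
  zx = Mx + X * (zx * Px) -> zy = My + Y * (zy * Py) ->
  tU * (u - v) = u * My - v * Mx -> tx * (u - v) + tU = My - v * Px ->
  ty * (u - v) - tU = u * Py - Mx -> txy * (u - v) + ty - tx = Py - Px ->
  tL * tU = ty -> tL' * tU + tL * tx = txy ->
  tL' * (zx * zy * (u - v) ^+ 2 * (X - Y) ^+ 2) = (u - v) ^+ 2 - zx * zy * (X - Y) ^+ 2.
Proof.
move=> XY0 Mx0 My0 eu ev ePx ePy e1 e2 e3 e4 e5 e6.
(* With this factor (X - Y)^2 on the left is absorbed into c^2 = (tU d)^2, after which only
   numerators of the derivatives of U occur. *)
apply: (@mulfI _ ((Mx * My) ^+ 2)); first by rewrite sqrf_eq0 mulf_neq0.
set d := u - v in e1 e2 e3 e4 *; pose c := Mx * My * (X - Y).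
have ec : tU * d = c by rewrite e1 eu ev /c; ring.
have ea : tx * d ^+ 2 = (My - v * Px) * d - c.
  by rewrite -e2 -ec; ring.
have eb : ty * d ^+ 2 = (u * Py - Mx) * d + c.
  by rewrite -e3 -ec; ring.
have exy : txy * d ^+ 3 = (Py - Px) * d ^+ 2 - ty * d ^+ 2 + tx * d ^+ 2.
  by rewrite -e4; ring.
have eL : tL' * tU ^+ 2 = txy * tU - ty * tx by rewrite -e6 -e5; ring.
transitivity (zx * zy * (txy * d ^+ 3 * (tU * d) - ty * d ^+ 2 * (tx * d ^+ 2))).
  transitivity (zx * zy * (tL' * tU ^+ 2) * d ^+ 4); last by rewrite eL; ring.
  transitivity (zx * zy * tL' * d ^+ 2 * (tU * d) ^+ 2); last by ring.
  by rewrite ec /c; ring.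
rewrite exy ea eb ec.
set m := zx * Px in ePx; set n := zy * Py in ePy.
transitivity (c * (d ^+ 2 * (zx * n - zy * m) - zx * ((u * n - Mx * zy) * d + c * zy)
    + zy * ((My * zx - v * m) * d - c * zx))
  - ((u * n - Mx * zy) * d + c * zy) * ((My * zx - v * m) * d - c * zx)).
  by rewrite /m /n; ring.
by rewrite ePx ePy /c /d eu ev; ring.
Qed.

Lemma second_order_algebra (Q : fieldType) (m2 c t ex ey zx zy mx my x y u v : Q) :
  mx != 0 -> my != 0 -> u - v != 0 -> x - y != 0 ->
  m2 = c * (ex * ey) + t -> ex * mx = zx -> ey * my = zy ->
  t * ((u - v) ^+ 2 * (x - y) ^+ 2) = x * y * (zx * zy * (x - y) ^+ 2 - (u - v) ^+ 2) ->
  m2 = c * (zx / mx) * (zy / my)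
       + x * y * (zx * zy / (u - v) ^+ 2 - 1 / (x - y) ^+ 2).
Proof.
move=> mx0 my0 uv0 xy0 -> <- <- et; rewrite !mulfK // mulrA; congr (_ + _).
apply: (@mulIf _ ((u - v) ^+ 2 * (x - y) ^+ 2)).
  by rewrite mulf_neq0 // expf_neq0.
by rewrite et; field; rewrite uv0 xy0.
Qed.

(** * The two relations from the recursions *)

Section Assembly.
Variable K : fieldType.
Hypothesis char0 : forall k, k.+1%:R != 0 :> K.

Let X : {fps {fps K}} := in_x (fvar K).
Let Y : {fps {fps K}} := in_y (fvar K).

Lemma deriv_x_in_x (a : {fps K}) : deriv_x (in_x a) = in_x (fderiv a).
Proof.
apply/fpsP=> i; rewrite /= -[in LHS]/(fps_const _).
elim: (i.+1) (fcoef a i.+1) => [|n IHn] r; first by rewrite !mulr0n fps_const0.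
by rewrite !mulrS IHn fps_constD.
Qed.

Lemma deriv_x_in_y (a : {fps K}) : deriv_x (in_y a) = 0.
Proof. exact: fderiv_const. Qed.

Lemma deriv_xD (f g : {fps {fps K}}) : deriv_x (f + g) = deriv_x f + deriv_x g.
Proof. exact: fderivD. Qed.

Lemma deriv_xN (f : {fps {fps K}}) : deriv_x (- f) = - deriv_x f.
Proof. exact: fderivN. Qed.

Lemma deriv_xM (f g : {fps {fps K}}) : deriv_x (f * g) = deriv_x f * g + f * deriv_x g.
Proof. exact: fderivM. Qed.

Lemma subr_XY_neq0 : X - Y != 0.
Proof.
rewrite subr_eq0; apply/eqP; rewrite /X in_x_fvar => /fpsP/(_ 1%N)/fpsP/(_ 0%N)/= /eqP.
by rewrite oner_eq0.
Qed.

Lemma subr_uv_neq0 (M : {fps K}) : fcoef M 0 = 1 ->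
  in_x (fvar K * M) - in_y (fvar K * M) != 0.
Proof.
move=> M0; rewrite subr_eq0; apply/eqP => /fpsP/(_ 1%N)/fpsP/(_ 0%N).
rewrite -[LHS]/(fcoef (fvar K * M) 1) fcoef_fvarM M0 /= => /eqP.
by rewrite oner_eq0.
Qed.

(* Expresses d^2/dxdy log U through the numerator x C(y) - y C(x) only, so that
   the substitution x := xM(x), y := yM(y) needs no chain rule in two variables. *)
Lemma dlog_subst (C z : {fps K}) (M := fcomp C z) :
    fcoef C 0 = 1 -> z = fvar K * M ->
  let u := in_x z in let v := in_y z in
  let zx := in_x (fderiv z) in let zy := in_y (fderiv z) in
  let U := frac_fps (tofrac (X * in_y C - Y * in_x C) / tofrac (X - Y)) in
  subst2 z (deriv_x (deriv_y (flog2 U))) * (zx * zy * (u - v) ^+ 2 * (X - Y) ^+ 2)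
  = (u - v) ^+ 2 - zx * zy * (X - Y) ^+ 2.
Proof.
move=> C0 ez u v zx zy U; have z0 : fcoef z 0 = 0 by rewrite ez fcoef_fvarM.
pose Cx := in_x C; pose Cy := in_y C.
pose Dx := in_x (fderiv C); pose Dy := in_y (fderiv C).
have U1 : fcoef (fcoef U 0) 0 = 1 by rewrite /U Hseries_quotient.
have eU : U * (X - Y) = X * Cy - Y * Cx.
  rewrite /U Hseries_quotient [LHS]mulrC mulrBl /X in_x_fvar; apply/fpsP=> i;
    apply/fpsP=> j.
  rewrite !(fcoefD, fcoefN) !fcoef_constM !fcoef_fvarM.
  by case: i => [|[|i]]; case: j => [|[|j]];
    rewrite /= ?addnS ?addSn ?addn0 ?add0n ?subrr ?subr0 ?sub0r ?opprK.
pose Ux := deriv_x U; pose Uy := deriv_y U; pose Uxy := deriv_x Uy.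
pose L := deriv_y (flog2 U).
have eL : L * U = Uy by apply: deriv_y_log.
have eL' : deriv_x L * U + L * Ux = Uxy.
  by rewrite -[Uxy]/(deriv_x Uy) -eL deriv_xM.
have eUx : Ux * (X - Y) + U = Cy - Y * Dx.
  have := congr1 (@deriv_x K) eU; 
  rewrite !(deriv_xM, deriv_xD,
    deriv_xN) !deriv_x_in_x !deriv_x_in_y fderiv_fvar in_x1 => e.
  by transitivity (Ux * (X - Y) + U * (1 - 0)); [rewrite -/Ux;
    ring | rewrite e -/Dx -/Cy; ring].
have eUy : Uy * (X - Y) - U = X * Dy - Cx.
  have := congr1 (@deriv_y K) eU.
  rewrite !(deriv_yM, deriv_yD,
    deriv_yN) !deriv_y_in_x !deriv_y_in_y fderiv_fvar (_ : in_y 1 = 1) // => e.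
  by transitivity (Uy * (X - Y) + U * (0 - 1)); [ring | rewrite e -/Dy; ring].
have eUxy : Uxy * (X - Y) + Uy - Ux = Dy - Dx.
  have := congr1 (@deriv_x K) eUy; 
  rewrite !(deriv_xM, deriv_xD,
    deriv_xN) !deriv_x_in_x !deriv_x_in_y fderiv_fvar in_x1 -/Ux -/Uxy -/Dx -/Dy => e.
  by transitivity (Uxy * (X - Y) + Uy * (1 - 0) - Ux); [ring | rewrite e; ring].
pose phi := subst2 z.
have phiD f g : phi (f + g) = phi f + phi g by apply: subst2D.
have phiM f g : phi (f * g) = phi f * phi g by apply: subst2M.
have phiN f : phi (- f) = - phi f.
  by apply/eqP; rewrite -addr_eq0 -phiD addNr -(fps_const0 {fps K}) -[fps_const 0]/(in_y
    0) /phi subst2_in_y // fcomp0 // /in_y fps_const0.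
have phiX : phi X = u by rewrite /phi subst2_in_x // fcomp_fvar.
have phiY : phi Y = v by rewrite /phi subst2_in_y // fcomp_fvar.
pose Mx := in_x M; pose My := in_y M.
have eu : u = X * Mx by rewrite /u {1}ez in_xM.
have ev : v = Y * My by rewrite /v {1}ez in_yM.
have ez' : fderiv z = M + fvar K * (fderiv z * fcomp (fderiv C) z).
  by rewrite -fcomp_deriv // -/M {1}ez fderivM fderiv_fvar mul1r.
pose Px := phi Dx; pose Py := phi Dy.
have ePx : zx = Mx + X * (zx * Px).
  by rewrite /Px /phi subst2_in_x // {1}/zx {1}ez' in_xD !in_xM.
have ePy : zy = My + Y * (zy * Py).
  by rewrite /Py /phi subst2_in_y // {1}/zy {1}ez' in_yD !in_yM.
have phiCx : phi Cx = Mx by apply: subst2_in_x.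
have phiCy : phi Cy = My by apply: subst2_in_y.
move: (congr1 phi eU) (congr1 phi eUx) (congr1 phi eUy) (congr1 phi eUxy) (congr1 phi
  eL) (congr1 phi eL').
rewrite !(phiD, phiM, phiN) phiX phiY phiCx phiCy -/Px -/Py.
move: (phi U) (phi Ux) (phi Uy) (phi Uxy) (phi L) => tU tx ty txy tL.
rewrite -[X in _ = X]/(_) -[subst2 z _]/(phi (deriv_x L)).
move: (phi (deriv_x L)) => tL' e1 e2 e3 e4 e5 e6.
have M0 : fcoef M 0 = 1.
  by rewrite /M fcomp_feval feval_shift // fcoefD fcoefM big_ord1 z0 mul0r addr0 /= C0.
apply: dlog_algebra ePx ePy e1 e2 e3 e4 e5 e6 => //; first exact: subr_XY_neq0.
- by apply/eqP=> /fpsP/(_ 0%N)/fpsP/(_ 0%N) e; have := oner_neq0 K;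
  rewrite -M0 (e : fcoef M 0 = 0) eqxx.
- by apply/eqP=> /fpsP/(_ 0%N)/fpsP/(_ 0%N) e; have := oner_neq0 K;
  rewrite -M0 (e : fcoef M 0 = 0) eqxx.
Qed.

Lemma fps_unit1 (S : comNzRingType) (a : {fps S}) : fcoef a 0 = 1 -> a \is a GRing.unit.
Proof.
move=> a0; pose step n (b : nat -> S) :=
  (n == 0%N)%:R - \sum_(j < n) fcoef a j.+1 * b (n - j.+1)%N.
have [|b bE] := @strong_recursion _ 0 step.
  move=> n b c e; congr (_ - _); apply: eq_bigr => j _; rewrite e //.
  by have := ltn_ord j; lia.
apply/unitrPr; exists (Fps b); apply/fpsP=> n.
by rewrite fcoefM fcoef1 big_ord_recl a0 mul1r subn0 /= {1}bE subrK.
Qed.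

Lemma fcoef_subst2M (z a b : {fps K}) (f : {fps {fps K}}) i j N : fcoef z 0 = 0 ->
  (i <= N)%N -> (j <= N)%N ->
  fcoef (fcoef (subst2 z f * (in_x a * in_y b)) i) j =
  \sum_(k < N.+1) \sum_(l < N.+1)
     fcoef (fcoef f k) l * (fcoef (z ^+ k * a) i * fcoef (z ^+ l * b) j).
Proof.
move=> z0 le_i le_j; rewrite fcoef2M.
transitivity (\sum_(s < i.+1) \sum_(t < j.+1) \sum_(k < N.+1) \sum_(l < N.+1)
   fcoef (fcoef f k) l * ((fcoef (z ^+ k) s * fcoef a (i - s)) * (fcoef (z ^+ l) t *
     fcoef b (j - t)))).
  apply: eq_bigr => s _; apply: eq_bigr => t _; rewrite fcoef2_in_xy.
  rewrite (@fcoef_subst2 _ _ z0 _ _ _ N); last 2 first.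
  - by have := ltn_ord s; lia.
  - by have := ltn_ord t; lia.
  rewrite mulr_suml; apply: eq_bigr => k _; rewrite mulr_suml; apply: eq_bigr => l _.
  ring.
under eq_bigr do rewrite exchange_big; rewrite exchange_big; apply: eq_bigr => k _.
under eq_bigr do rewrite exchange_big; rewrite exchange_big; apply: eq_bigr => l _.
rewrite !fcoefM big_distrlr mulr_sumr; apply: eq_bigr => s _; rewrite mulr_sumr.
by apply: eq_bigr.
Qed.

Section Final.
Variables (kappa alpha : nat -> K) (kappa2 alpha2 : nat -> nat -> K).
Let C := genfun kappa.
Let C2 := genfun2 kappa2.
Let M := genfun alpha.
Let M2 := genfun2 alpha2.
Let z := fvar K * M.
Variables (F : nat -> nat -> K) (G : nat -> nat -> nat -> K) (E : nat -> nat -> K).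
Hypothesis rF : disc_rec (fcoef C) F.
Hypothesis rG : annular_rec F G.
Hypothesis alphaE : forall n, alpha n.+1 = F 0%N n.+1.
Hypothesis eE : forall p, \fps_n E p.+1 n * M = fderiv z * z ^+ p.+1.
Hypothesis alpha2E : forall m n, alpha2 m.+1 n.+1 = G 0%N m.+1 n.+1 +
  \sum_(p < m.+1) \sum_(q < n.+1) kappa2 p.+1 q.+1 * (E p.+1 m.+1 * E q.+1 n.+1).

Let z0 : fcoef z 0 = 0 := zM0 M.

Let MF : M = disc F 0.
Proof. by apply/fpsP=> -[|n] /=; [rewrite rF.1 | rewrite alphaE]. Qed.

Lemma first_order : fcomp C z = M.
Proof. by rewrite fcomp_feval [RHS]MF (disc_comp rF) -MF. Qed.

Let M0 : fcoef M 0 = 1. Proof. by []. Qed.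
Let Mu : M \is a GRing.unit := fps_unit1 M0.

(** By [eE], [E p.+1] is the coefficient sequence of z^(p+1) z'/M; summing these against kappa2 in
    both variables is substitution into C2. *)
Lemma disc_part : M2 - annular G 0 = subst2 z C2 * (in_x (fderiv z / M) * in_y (fderiv z
  / M)).
Proof.
have Ep p n : E p.+1 n = fcoef (z ^+ p.+1 * (fderiv z / M)) n.
  rewrite mulrA [_ * fderiv z]mulrC -eE mulrK //.
have lowE p n : (n < p)%N -> fcoef (z ^+ p * (fderiv z / M)) n = 0.
  by move=> lt_n; rewrite mulrC fcoef_expr_lt.
apply/fpsP=> m; apply/fpsP=> n.
rewrite (@fcoef_subst2M _ _ _ _ _ _ (m + n)) ?leq_addr ?leq_addl //.
have C2m0 k : fcoef (fcoef C2 k) 0 = 0 by rewrite /= orbT.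
rewrite !(fcoefD, fcoefN) [RHS]big_ord_recl [X in _ = X + _]big1 ?add0r; last first.
  by move=> l _; rewrite -[fcoef (fcoef C2 _) _]/(0 : K) mul0r.
under eq_bigr => k _ do rewrite big_ord_recl C2m0 mul0r add0r.
case: m => [|m]; last case: n => [|n].
- rewrite -[fcoef (fcoef M2 _) _]/(0 : K) -[fcoef (fcoef (annular G 0) _) _]/(G 0%N 0%N
  n) rG.1 subrr big1 // => k _; rewrite big1 // => l _.
  by rewrite lowE ?mul0r ?mulr0.
- rewrite -[fcoef (fcoef (annular G 0) _) _]/(G 0%N m.+1 0%N) (annular_rec_n0 rG) subr0
  big1 // => k _.
  by rewrite big1 // => l _; rewrite (@lowE _ 0%N) ?mulr0.
rewrite -[fcoef (fcoef M2 _) _]/(alpha2 m.+1 n.+1) -[fcoef (fcoef (annular G 0) _) _]/(G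
  0%N m.+1 n.+1).
rewrite alpha2E addrC addKr.
(* The added indices contribute nothing, since z^p has no term of degree below p. *)
rewrite (big_ord_widen (m.+1 + n.+1) (fun p =>
  \sum_(q < n.+1) kappa2 p.+1 q.+1 * (E p.+1 m.+1 * E q.+1 n.+1))) ?leq_addr //.
rewrite big_mkcond; apply: eq_bigr => p _; case: ifPn => [lt_p|]; last first.
  by rewrite -leqNgt => le_p; rewrite big1 // => q _; rewrite lowE ?mul0r ?mulr0.
rewrite (big_ord_widen (m.+1 + n.+1) (fun q =>
  kappa2 p.+1 q.+1 * (E p.+1 m.+1 * E q.+1 n.+1))) ?leq_addl //.
rewrite big_mkcond; apply: eq_bigr => q _; rewrite !Ep; case: ifPn => [lt_q //|].
by rewrite -leqNgt => le_q; rewrite (@lowE (lift ord0 q) n.+1) ?mulr0.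
Qed.

Let T := annular G 0.
Let u := in_x z.
Let v := in_y z.
Let zx := in_x (fderiv z).
Let zy := in_y (fderiv z).

Let in_xV : in_x (fderiv z / M) * in_x M = zx.
Proof. by rewrite -in_xM divrK. Qed.

Let in_yV : in_y (fderiv z / M) * in_y M = zy.
Proof. by rewrite -in_yM divrK. Qed.

Let universal : T * ((u - v) ^+ 2 * (X - Y) ^+ 2) = X * Y * (zx * zy * (X - Y) ^+ 2 - (u
  - v) ^+ 2).
Proof.
have := annular_universal rF rG (erefl _).
by rewrite -MF.
Qed.

Let uv0 : u - v != 0 := subr_uv_neq0 M0.
Let XY0 := subr_XY_neq0.

Let Mx0 : in_x M != 0.
Proof.
apply/eqP=> /fpsP/(_ 0%N)/fpsP/(_ 0%N) e; have := oner_neq0 K.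
by rewrite -(e : 1 = 0) eqxx.
Qed.

Let My0 : in_y M != 0.
Proof.
apply/eqP=> /fpsP/(_ 0%N)/fpsP/(_ 0%N) e; have := oner_neq0 K.
by rewrite -(e : 1 = 0) eqxx.
Qed.

(** The logarithmic term of H enters with the factor u v = x y M(x) M(y), which cancels both
    denominators M; by [dlog_subst] and [universal] the result is the annular series. *)
Lemma second_order_H :
  M2 = fcomp2 (Hseries C C2) u v * in_x (fderiv z / M) * in_y (fderiv z / M).
Proof.
rewrite fcomp2_subst2 // -mulrA; set e := _ * in_y _.
pose L := deriv_x (deriv_y (flog2 (frac_fps (tofrac (X * in_y C - Y * in_x C) / tofrac
  (X - Y))))).
have ez : z = fvar K * fcomp C z by rewrite first_order.
have C0 : fcoef C 0 = 1 by [].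
have := dlog_subst C0 ez; rewrite /= -/L -/u -/v -/zx -/zy => eL.
have -> : Hseries C C2 = C2 + (- (X * Y)) * L by rewrite mulNr.
rewrite subst2D // subst2M // mulrDl -disc_part -{1}[M2](subrK T); congr (_ + _).
have -> : subst2 z (- (X * Y)) = - (u * v).
  have -> : - (X * Y) = in_y (fps_const (-1)) * X * Y.
    by rewrite /in_y !fps_constN mulN1r mulNr.
  rewrite !subst2M // subst2_in_x // !subst2_in_y // fcomp_const // fcomp_fvar //.
  by rewrite /in_y !fps_constN mulN1r mulNr.
pose dd := (u - v) ^+ 2 * (X - Y) ^+ 2.
have dd0 : dd != 0 by rewrite mulf_neq0 ?sqrf_eq0.
apply: (mulIf Mx0); apply: (mulIf My0); apply: (mulIf dd0).
transitivity (T * dd * (in_x M * in_y M)); first ring.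
transitivity (- (u * v) * (subst2 z L * (zx * zy * (u - v) ^+ 2 * (X - Y) ^+ 2)));
  last first.
  by rewrite /e -in_xV -in_yV /dd; ring.
rewrite eL universal; have -> : u * v = X * Y * (in_x M * in_y M).
  by rewrite /u /v in_xM in_yM /X /Y; ring.
ring.
Qed.

Local Notation Fr := (@tofrac _).

(** Both squared denominators vanish at the origin, so their inverses live only in the fraction
    field. *)
Lemma second_order_frac :
  Fr M2 = Fr (fcomp2 C2 u v) * (Fr zx / Fr (in_x M)) * (Fr zy / Fr (in_y M))
    + Fr (X * Y) * (Fr zx * Fr zy / (Fr u - Fr v) ^+ 2 - 1 / (Fr X - Fr Y) ^+ 2).
Proof.
have e1 : M2 = fcomp2 C2 u v * (in_x (fderiv z / M) * in_y (fderiv z / M)) + T.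
  by rewrite fcomp2_subst2 // -disc_part subrK.
rewrite [Fr (X * Y)]tofracM; apply: second_order_algebra.
- by rewrite tofrac_eq0; exact: Mx0.
- by rewrite tofrac_eq0; exact: My0.
- by rewrite -tofracB tofrac_eq0; exact: uv0.
- by rewrite -tofracB tofrac_eq0; exact: XY0.
- by rewrite e1 tofracD !tofracM.
- by rewrite -tofracM; congr Fr; exact: in_xV.
- by rewrite -tofracM; congr Fr; exact: in_yV.
by rewrite -!(tofracM, tofracB, tofracXn); congr Fr; exact: universal.
Qed.

End Final.
End Assembly.

Local Close Scope ring_scope.

(** * From the convolution to planar sums *)

Local Open Scope group_scope.

Section Orbits.

Lemma perm_morphX (S T : finType) (s : {perm S}) (t : {perm T}) (phi : S -> T) i k :
  (forall j, t (phi j) = phi (s j)) -> (t ^+ k) (phi i) = phi ((s ^+ k) i).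
Proof.
by move=> h; elim: k => [|k IHk]; rewrite ?expg0 ?perm1 // !expgSr !permM IHk.
Qed.

Lemma porbit_morph (S T : finType) (s : {perm S}) (t : {perm T}) (phi : S -> T) i :
  (forall j, t (phi j) = phi (s j)) -> porbit t (phi i) = phi @: porbit s i.
Proof.
move=> h; apply/setP=> q; apply/porbitP/imsetP=> [[k ->]|[_ /porbitP[k ->] ->]].
  by exists ((s ^+ k) i); rewrite ?mem_porbit // (perm_morphX _ _ h).
by exists k; rewrite (perm_morphX _ _ h).
Qed.

Lemma gammaX n (i : 'I_n.+1) : (gamma n.+1 ^+ i) ord0 = i.
Proof.
suff h k : k < n.+1 -> val ((gamma n.+1 ^+ k) ord0) = k by apply/val_inj/h.
elim: k => [|k IHk] lt_k; first by rewrite expg0 perm1.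
by rewrite expgSr permM permE /= IHk ?modn_small // ltnW.
Qed.

Lemma porbit_gamma n (i : 'I_n) : porbit (gamma n) i = [set: 'I_n].
Proof.
case: n i => [[] //|n] i; have h j : porbit (gamma n.+1) j = porbit (gamma n.+1) ord0.
  by apply/eqP; rewrite eq_porbit_mem -[j]gammaX mem_porbit.
apply/eqP; rewrite eqEsubset subsetT; apply/subsetP=> j _.
by rewrite h -[j]gammaX mem_porbit.
Qed.

Definition left_part m n : {set 'I_(m + n)} := lshift n @: [set: 'I_m].
Definition right_part m n : {set 'I_(m + n)} := @rshift m n @: [set: 'I_n].

Lemma gamma2_lshift m n (i : 'I_m) : gamma2 m n (lshift n i) = lshift n (gamma m i).
Proof. by rewrite !permE /gamma2_fun -[lshift n i]/(unsplit (inl i)) unsplitK. Qed.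

Lemma gamma2_rshift m n (i : 'I_n) : gamma2 m n (rshift m i) = rshift m (gamma n i).
Proof. by rewrite !permE /gamma2_fun -[rshift m i]/(unsplit (inr i)) unsplitK. Qed.

Lemma porbit_gamma2_l m n (i : 'I_m) : porbit (gamma2 m n) (lshift n i) = left_part m n.
Proof. by rewrite (porbit_morph _ (@gamma2_lshift m n)) porbit_gamma. Qed.

Lemma porbit_gamma2_r m n (i : 'I_n) : porbit (gamma2 m n) (rshift m i) = right_part m n.
Proof. by rewrite (porbit_morph _ (@gamma2_rshift m n)) porbit_gamma. Qed.

Lemma card_left_part m n : #|left_part m n| = m.
Proof. by rewrite card_imset ?cardsT ?card_ord //; apply: lshift_inj. Qed.

Lemma card_right_part m n : #|right_part m n| = n.
Proof. by rewrite card_imset ?cardsT ?card_ord //; apply: rshift_inj. Qed.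

Lemma left_right_setC m n : ~: left_part m n = right_part m n.
Proof.
apply/setP=> p; rewrite inE; case: (split_ordP p) => i ->.
  rewrite (mem_imset _ _ (@lshift_inj m n)) inE /=.
  by symmetry; apply/imsetP=> -[j _ /eqP]; rewrite eq_lrshift.
rewrite (mem_imset _ _ (@rshift_inj m n)) inE.
by apply/imsetP=> -[j _ /eqP]; rewrite eq_rlshift.
Qed.

Lemma porbitX_inj (T : finType) (s : {perm T}) p i j :
  i < #|porbit s p| -> j < #|porbit s p| -> (s ^+ i) p = (s ^+ j) p -> i = j.
Proof.
wlog lt_ij : i j / i < j => [wl hi hj e|hi hj].
  by case: (ltngtP i j) => // h; [apply: wl | symmetry; apply: wl].
rewrite -[j](subnK (ltnW lt_ij)) expgD permM => /perm_inj/esym/eqP.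
by rewrite (negPf (porbit_exp_neq _)) //; lia.
Qed.

End Orbits.

(** * Multiplicative functions on cycles and blocks *)

Section Conjugacy.
Variables (K : fieldType) (f : forall n, PS n -> K).
Hypothesis f_conj : forall n (s t : 'S_n), f (pp_one (s ^ t)) = f (pp_one s).

Lemma conj_from (n : nat) (s g : 'S_n) (phi : 'I_n -> 'I_n) : injective phi ->
  (forall i, s (phi i) = phi (g i)) -> f (pp_one s) = f (pp_one g).
Proof.
move=> phi_inj h; rewrite -(f_conj g (perm phi_inj)); congr (f (pp_one _)).
apply/permP=> k; rewrite -[k](permKV (perm phi_inj)) permJ.
by rewrite [X in s X]permE [RHS]permE h.
Qed.

Lemma gamma_expS (T : finType) n (s : {perm T}) p (i : 'I_n) : #|porbit s p| = n ->
  s ((s ^+ i) p) = (s ^+ (gamma n i)) p.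
Proof.
move=> c; rewrite permE /= -permM -expgSr; have := ltn_ord i.
rewrite leq_eqVlt => /orP[/eqP e|lt_i]; last by rewrite modn_small.
by rewrite e modnn expg0 perm1 permX -c iter_porbit.
Qed.

Lemma conj_gamma n (s : 'S_n) p : #|porbit s p| = n ->
  f (pp_one s) = f (pp_one (gamma n)).
Proof.
move=> c; apply: (@conj_from _ _ _ (fun i : 'I_n => (s ^+ i) p)) => [i j e|i].
  by apply: val_inj; apply: porbitX_inj e; rewrite c.
exact: gamma_expS.
Qed.

Lemma conj_gamma2 n (s : 'S_n) p q m1 m2 : #|porbit s p| = m1 -> #|porbit s q| = m2 ->
  q \notin porbit s p -> n = m1 + m2 ->
  f (pp_one s) = f (pp_one (gamma2 m1 m2)).
Proof.
move=> c1 c2 qp en; subst n.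
pose phi (i : 'I_(m1 + m2)) := match split i with inl j => (s ^+ j) p | inr j =>
  (s ^+ j) q end.
have phil j : phi (lshift m2 j) = (s ^+ j) p.
  by rewrite /phi -[lshift m2 j]/(unsplit (inl j)) unsplitK.
have phir j : phi (rshift m1 j) = (s ^+ j) q.
  by rewrite /phi -[rshift m1 j]/(unsplit (inr j)) unsplitK.
have disj i j : (s ^+ i) p != (s ^+ j) q.
  apply: contraNneq qp => e; rewrite -eq_porbit_mem.
  by rewrite -(porbit_perm s j q) -e porbit_perm.
apply: (@conj_from _ _ _ phi) => [i j|i].
  case: (split_ordP i) => i' ->; case: (split_ordP j) => j' ->; rewrite ?phil ?phir => e.
  - by congr lshift; apply: val_inj; apply: porbitX_inj e; rewrite c1.
  - by case/eqP: (disj i' j').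
  - by case/eqP: (disj j' i').
  - by congr rshift; apply: val_inj; apply: porbitX_inj e; rewrite c2.
case: (split_ordP i) => i' ->.
  by rewrite gamma2_lshift !phil gamma_expS.
by rewrite gamma2_rshift !phir gamma_expS.
Qed.

Definition block_val n (s : 'S_n) (B : {set 'I_n}) := f (pp_one (block_perm s B)).

Lemma block_permE n (s : 'S_n) (B : {set 'I_n}) (i : 'I_#|B|) : stab B s ->
  s (enum_val i) = enum_val (block_perm s B i).
Proof.
move=> Bs; rewrite permE /block_fun enum_rankK_in; last first.
  by rewrite restr_permE_stab ?stabE ?enum_valP.
by rewrite restr_permE_stab ?enum_valP.
Qed.

Lemma card_porbit_block n (s : 'S_n) (B : {set 'I_n}) (i : 'I_#|B|) : stab B s ->
  porbit s (enum_val i) = enum_val @: porbit (block_perm s B) i.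
Proof. by move=> Bs; apply: porbit_morph => j; apply: block_permE. Qed.

Lemma block_val_porbit n (s : 'S_n) p :
  block_val s (porbit s p) = f (pp_one (gamma #|porbit s p|)).
Proof.
set B := porbit s p; have Bp : p \in B := porbit_id s p.
apply: (@conj_gamma _ _ (enum_rank_in Bp p)).
rewrite -(card_imset _ (@enum_val_inj _ (mem B))) -card_porbit_block ?stab_porbit //.
by rewrite enum_rankK_in.
Qed.

Lemma block_val_porbit2 n (s : 'S_n) p q : q \notin porbit s p ->
  block_val s (porbit s p :|: porbit s q) = f (pp_one (gamma2 #|porbit s p| #|porbit s
    q|)).
Proof.
move=> qp; set B := _ :|: _; have Bp : p \in B by rewrite inE porbit_id.
have Bq : q \in B by rewrite inE porbit_id orbT.
have Bs : stab B s by rewrite stabU ?stab_porbit.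
have pE x (Bx : x \in B) : porbit s x = enum_val @: porbit (block_perm s B)
  (enum_rank_in Bx x).
  by rewrite -card_porbit_block // enum_rankK_in.
apply: (@conj_gamma2 _ _ (enum_rank_in Bp p) (enum_rank_in Bq q)).
- by rewrite (pE p Bp) card_imset //; apply: enum_val_inj.
- by rewrite (pE q Bq) card_imset //; apply: enum_val_inj.
- apply: contraNN qp; rewrite (pE p Bp) => h; apply/imsetP.
  by exists (enum_rank_in Bq q); rewrite // enum_rankK_in.
rewrite cardsU (_ : porbit s p :&: porbit s q = set0) ?cards0 ?subn0 //.
apply/setP=> x; rewrite !inE; apply/negP=> /andP[]; rewrite -!eq_porbit_mem => /eqP ->.
by rewrite eq_sym eq_porbit_mem (negPf qp).
Qed.

End Conjugacy.

(** * Comparing a partition with a coarser one *)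

Section Refinement.
Variable T : finType.
Implicit Types (P V W : {set {set T}}) (s g : {perm T}).

Let blockmap V (A : {set T}) := if [pick x in A] is Some x then pblock V x else set0.

Lemma partition_pblock V : partition V [set: T] -> V = [set pblock V x | x in T].
Proof.
move=> pV; have /and3P[_ tV nV] := pV; apply/setP=> B; apply/idP/imsetP=> [VB|[x _ ->]].
  have [x Bx] : exists x, x \in B by apply/set0Pn; apply: contraNneq nV => <-.
  by exists x => //; rewrite (def_pblock tV VB).
by rewrite pblock_mem // (cover_partition pV) inE.
Qed.

Lemma blockmap_pblock P V x : partition P [set: T] -> partition V [set: T] ->
  refines P V -> blockmap V (pblock P x) = pblock V x.
Proof.
move=> pP pV PV; rewrite /blockmap; have Px : x \in pblock P x.
  by rewrite mem_pblock (cover_partition pP) inE.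
case: pickP => [y Py|/(_ x)]; last by rewrite Px.
apply: (refines_connect pV PV _ Py Px).
by rewrite pblock_mem // (cover_partition pP) inE.
Qed.

Lemma refines_imset P V : partition P [set: T] -> partition V [set: T] ->
  refines P V -> V = blockmap V @: P.
Proof.
move=> pP pV PV; rewrite {1}(partition_pblock pV) [in RHS](partition_pblock pP).
rewrite -imset_comp; apply: eq_imset => x /=.
by rewrite blockmap_pblock.
Qed.

Lemma refines_card P V : partition P [set: T] -> partition V [set: T] ->
  refines P V -> #|V| <= #|P|.
Proof. by move=> pP pV PV; rewrite (refines_imset pP pV PV) leq_imset_card. Qed.

Lemma pblock_refl V x : partition V [set: T] -> x \in pblock V x.
Proof. by move=> pV; rewrite mem_pblock (cover_partition pV) inE. Qed.

Lemma pblock_in V x : partition V [set: T] -> pblock V x \in V.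
Proof. by move=> pV; rewrite pblock_mem // (cover_partition pV) inE. Qed.

Lemma refines_sub P V x : partition P [set: T] -> partition V [set: T] ->
  refines P V -> pblock P x \subset pblock V x.
Proof.
move=> pP pV PV; apply/subsetP=> y Py.
rewrite (refines_connect pV PV (pblock_in x pP) (pblock_refl x pP) Py).
exact: pblock_refl.
Qed.

Lemma refines_card_eq P V : partition P [set: T] -> partition V [set: T] ->
  refines P V -> #|V| = #|P| -> V = P.
Proof.
move=> pP pV PV cVP; have inj : {in P &, injective (blockmap V)}.
  by apply/imset_injP; rewrite -refines_imset // cVP.
have /and3P[_ tV _] := pV; have /and3P[_ tP _] := pP.
rewrite (partition_pblock pV) [RHS](partition_pblock pP); apply: eq_imset => x.
apply/eqP; rewrite eqEsubset (refines_sub x pP pV PV) andbT; apply/subsetP=> y Vy.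
have eV := same_pblock tV Vy; have : pblock P x = pblock P y.
  by apply: inj; rewrite ?pblock_in // !blockmap_pblock.
by move=> ->; apply: pblock_refl.
Qed.

(** If no two blocks of P lay in one block of V, the map from P onto V would be injective and the
    cardinalities equal. *)
Lemma refines_card_succ P V : partition P [set: T] -> partition V [set: T] ->
  refines P V -> #|V| < #|P| ->
  exists c1 c2, [/\ c1 \in P, c2 \in P, c1 != c2 & exists2 B, B \in V &
    c1 :|: c2 \subset B].
Proof.
move=> pP pV PV lt_VP.
have /dinjectivePn[c1 Pc1 [c2 /andP[/= c21 Pc2] e12]] : ~~ dinjectiveb (blockmap V) P.
  apply/negP=> /dinjectiveP/imset_injP; rewrite -refines_imset // => /eqP e.
  by rewrite e ltnn in lt_VP.
exists c1, c2; split=> //; first by rewrite eq_sym.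
move: Pc1 Pc2; rewrite {1 2}(partition_pblock pP) => /imsetP[x1 _ e1] /imsetP[x2 _ e2].
exists (pblock V x1); first exact: pblock_in.
rewrite subUset {1}e1 refines_sub //= e2.
move: e12; rewrite e1 e2 !blockmap_pblock // => ->.
exact: refines_sub.
Qed.

End Refinement.

(** * The convolution as a sum over pairs (V, pi) *)

Section Convolution.
Variables (K : fieldType) (f : forall n, PS n -> K).
Hypothesis f_mult : Defs.multiplicative f.
Variable n : nat.
Implicit Types (s g : 'S_n.+1) (V : {set {set 'I_n.+1}}).

Fact pp_perm_subproof s : is_pperm (porbits s, s).
Proof.
rewrite /is_pperm /= porbits_partition; apply/forallP=> A; apply/implyP=> PA.
by apply/existsP; exists A; rewrite PA subxx.
Qed.

(** These are the elements on which [zeta] is 1; it vanishes on all others. *)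
Definition pp_perm s : PS n.+1 := exist (fun w => is_pperm w) _ (pp_perm_subproof s).

(* The last condition is the additivity of lengths, with
   |(1, g)| = 2n - |g| since the size here is n + 1. *)
Definition contributes g s V :=
  [&& partition V [set: 'I_n.+1], refines (porbits s) V,
      part_join V (porbits (g * s^-1)) == part_one n.+1 &
      n.+1 + 2 + #|porbits s| == 2 * #|V| + #|porbits (g * s^-1)| + #|porbits g|].

Lemma card_part_one : #|part_one n.+1| = 1%N.
Proof.
rewrite (_ : part_one _ = [set [set: 'I_n.+1]]) ?cards1 //.
apply/setP=> A; rewrite !inE andbC; case: eqP => //= ->.
by apply/set0Pn; exists ord0.
Qed.

Lemma pp_mul_perm (u : PS n.+1) g : 
  (pp_mul u (pp_perm (g * (pperm u)^-1)) == Some (pp_one g)) =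
  contributes g (pperm u) (ppart u).
Proof.
have /andP[pV sV] := valP u; rewrite /contributes pV sV /=.
have eJ : (pp_join u (pp_perm (g * (pperm u)^-1)) == pp_one g) =
    (part_join (ppart u) (porbits (g * (pperm u)^-1)) == part_one n.+1).
  by rewrite -val_eqE /= /pperm /= mulgKV xpair_eqE eqxx andbT.
have lenE : part_join (ppart u) (porbits (g * (pperm u)^-1)) = part_one n.+1 ->
  (pp_length u + pp_length (pp_perm (g * (pperm u)^-1)) ==
     pp_length (pp_join u (pp_perm (g * (pperm u)^-1))))%R =
  (n.+1 + 2 + #|porbits (pperm u)| ==
     2 * #|ppart u| + #|porbits (g * (pperm u)^-1)| + #|porbits g|).
  move=> ej; rewrite /pp_length /ppart /pperm /= mulgKV -/(ppart u) -/(pperm u) ej.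
  rewrite /part_length /perm_length card_part_one.
  move: #|ppart u| #|porbits (pperm u)| #|porbits (g * _)| #|porbits g| => k1 k2 k3 k4.
  by apply/eqP/eqP; lia.
rewrite /pp_mul; case: (eqVneq (part_join _ _) (part_one _)) eJ lenE =>
  [ej eJ lenE|nej eJ _] /=.
  rewrite lenE //; case: ifP => // _; rewrite (inj_eq Some_inj); exact/eJ.
by case: ifP => // _; rewrite (inj_eq Some_inj); exact/eJ.
Qed.

(** [zeta] leaves only second factors of the form (0_sigma, sigma), and sigma is determined by [s]
    and [g]. *)
Lemma convolution_zeta g : convolution f (@zeta K) (pp_one g) =
  (\sum_s \sum_(V | contributes g s V) \prod_(B in V) block_val f s B)%R.
Proof.
rewrite /convolution big_mkcond -(pair_bigA _ (fun u v =>
  if pp_mul u v == Some (pp_one g) then f u * zeta K v else 0)%R) /=.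
transitivity (\sum_(u : PS n.+1 | contributes g (pperm u) (ppart u)) f u)%R.
  rewrite [RHS]big_mkcond; apply: eq_bigr => u _;
    rewrite (bigD1 (pp_perm (g * (pperm u)^-1))) //=.
  rewrite pp_mul_perm /zeta eqxx mulr1 big1 ?addr0 // => v neq_v.
  case: eqP => // e; case: eqP => [ev|_]; last by rewrite mulr0.
  case/eqP: neq_v; apply: val_inj; move: e; rewrite /pp_mul; case: ifP => // _.
  move/(congr1 (omap (@pperm n.+1))) => /= -[e].
  have e' : pperm v * pperm u = g := e.
  by rewrite [LHS]surjective_pairing -/(ppart v) -/(pperm v) ev /= -e' mulgK.
rewrite (eq_bigr (fun u => \prod_(B in ppart u) block_val f (pperm u) B)%R); last first.
  by move=> u _; rewrite f_mult.2.
transitivity (\sum_(w in [pred w | @is_pperm n.+1 w] | contributes g w.2 w.1)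
   \prod_(B in w.1) block_val f w.2 B)%R.
  symmetry; exact: (@big_sub_cond _ _ _ _ [pred w | @is_pperm n.+1 w] (fun w =>
    contributes g w.2 w.1) (fun w => \prod_(B in w.1) block_val f w.2 B)%R).
rewrite pair_big_dep /= (reindex (fun p : 'S_n.+1 * {set {set 'I_n.+1}} =>
  (p.2, p.1))) /=.
  apply: eq_bigl => -[s V] /=; rewrite inE /is_pperm /= /contributes.
  by case: (partition V _); case: (refines _ V).
by exists (fun w => (w.2, w.1)) => -[].
Qed.

End Convolution.

Section Merge.
Variable T : finType.
Implicit Types (P V : {set {set T}}) (c A B : {set T}).

Definition merge_blocks P c1 c2 := (c1 :|: c2) |: (P :\ c1 :\ c2).

Variables (P : {set {set T}}) (c1 c2 : {set T}).
Hypotheses (pP : partition P [set: T]) (P1 : c1 \in P) (P2 : c2 \in P) (c12 : c1 != c2).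

Lemma block_eq A B x : A \in P -> B \in P -> x \in A -> x \in B -> A = B.
Proof.
have /and3P[_ tP _] := pP => PA PB xA xB.
by rewrite -(def_pblock tP PA xA) (def_pblock tP PB xB).
Qed.

Lemma block_neq0 A : A \in P -> exists x, x \in A.
Proof.
have /and3P[_ _ nP] := pP => PA; apply/set0Pn.
by apply: contraNneq nP => <-.
Qed.

Lemma mem_mergeP B : reflect (B = c1 :|: c2 \/ [/\ B \in P, B != c1 & B != c2])
  (B \in merge_blocks P c1 c2).
Proof.
rewrite !inE; apply: (iffP orP) => [[/eqP|/and3P[]]|[->|[]]]; [by left|by right|by left;
  rewrite eqxx|].
by move=> PB B1 B2; right; rewrite B2 B1.
Qed.

Lemma setU_notin : c1 :|: c2 \notin P.
Proof.
apply/negP=> PU; case/eqP: c12.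
have [x x1] := block_neq0 P1; have [y y2] := block_neq0 P2.
rewrite (@block_eq c1 _ x P1 PU x1) ?inE ?x1 //.
by rewrite -(@block_eq c2 _ y P2 PU y2) ?inE ?y2 ?orbT.
Qed.

Lemma partition_merge : partition (merge_blocks P c1 c2) [set: T].
Proof.
have /and3P[/eqP cP tP nP] := pP; apply/and3P; split.
- rewrite eqEsubset subsetT; apply/subsetP=> x; rewrite -{1}cP => /bigcupP[A PA xA].
  apply/bigcupP; have [e1|A1] := eqVneq A c1.
    by exists (c1 :|: c2); [apply/mem_mergeP; left | rewrite inE -e1 xA].
  have [e2|A2] := eqVneq A c2.
    by exists (c1 :|: c2); [apply/mem_mergeP; left | rewrite inE -e2 xA orbT].
  by exists A => //; apply/mem_mergeP; right.
- have dU A : A \in P -> A != c1 -> A != c2 -> [disjoint c1 :|: c2 & A].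
    move=> PA A1 A2; apply/pred0P=> x /=; apply/negP=> /andP[];
      rewrite inE => /orP[] xc xA.
      by case/eqP: A1; apply: block_eq xA xc.
    by case/eqP: A2; apply: block_eq xA xc.
  apply/trivIsetP=> A B /mem_mergeP[->|[PA A1 A2]] /mem_mergeP[->|[PB B1 B2]].
  + by rewrite eqxx.
  + by move=> _; apply: dU.
  + by move=> _; rewrite disjoint_sym; apply: dU.
  by apply: (trivIsetP tP).
apply/mem_mergeP=> -[e|[PA _ _]]; last by rewrite PA in nP.
by have [x x1] := block_neq0 P1; move/setP/(_ x): e; rewrite !inE x1.
Qed.

Lemma refines_merge : refines P (merge_blocks P c1 c2).
Proof.
apply/forallP=> A; apply/implyP=> PA; apply/existsP.
have [e1|A1] := eqVneq A c1.
  by exists (c1 :|: c2); rewrite e1 subsetUl andbT; apply/mem_mergeP; left.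
have [e2|A2] := eqVneq A c2.
  by exists (c1 :|: c2); rewrite e2 subsetUr andbT; apply/mem_mergeP; left.
by exists A; rewrite subxx andbT; apply/mem_mergeP; right.
Qed.

Lemma card_merge : #|merge_blocks P c1 c2|.+1 = #|P|.
Proof.
rewrite cardsU1 !inE (negPf setU_notin) !andbF add1n.
by rewrite (cardsD1 c1 P) P1 (cardsD1 c2 (P :\ c1)) !inE eq_sym c12 P2.
Qed.

Lemma refines_mergeV V : partition V [set: T] -> refines P V ->
  (exists2 B, B \in V & c1 :|: c2 \subset B) -> refines (merge_blocks P c1 c2) V.
Proof.
move=> pV /forallP PV [B VB sB]; apply/forallP=> A;
  apply/implyP=> /mem_mergeP[->|[PA _ _]].
  by apply/existsP; exists B; rewrite VB.
exact: (implyP (PV A)).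
Qed.

End Merge.

(** * Which pairs contribute *)

Section Contributions.
Variable n : nat.
Implicit Types (s g : 'S_n.+1) (V : {set {set 'I_n.+1}}).

(** A connected component of the join is the same as a minimal union of blocks stable under [s];
    this form can be compared with [connected_on]. *)
Lemma join_oneP V s : partition V [set: 'I_n.+1] -> reflect
  (forall B : {set 'I_n.+1}, (forall c, c \in V -> forall x y, x \in c -> y \in c ->
    x \in B -> y \in B) ->
     stab B s -> B = set0 \/ B = setT)
  (part_join V (porbits s) == part_one n.+1).
Proof.
move=> pV; have pJ := part_join_partition V (porbits s).
have J1 : part_one n.+1 = [set setT].
  apply/setP=> A; rewrite !inE andbC; case: eqP => //= ->.
  by apply/set0Pn; exists ord0.
apply: (iffP eqP) => [eJ B BV Bs|h].
  have [->|[x Bx]] := set_0Vmem B; first by left.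
  right; apply/setP=> y; rewrite inE.
  have : y \in pblock (part_join V (porbits s)) x.
    have := pblock_in x pJ; rewrite {2}eJ J1 => /set1P ->.
    by rewrite inE.
  rewrite pblock_part_join => /connectP[p + ->];
    elim: p x Bx => //= z p IHp x Bx /andP[xz].
  apply: IHp; case/existsP: xz => c /andP[]; rewrite inE => /orP[Vc|sc] /andP[cx cz].
    exact: (BV c Vc x z).
  move: sc cx cz => /imsetP[w _ ->] cx cz; apply: (subsetP (porbit_stab_sub Bs Bx)).
  by move: cx cz; rewrite -!eq_porbit_mem => /eqP -> /eqP ->.
set J := part_join _ _ in pJ *.
have [| |B0|B1] := h (pblock J ord0).
- move=> c Vc x y cx cy; rewrite !pblock_part_join => h1; apply: connect_trans h1 _.
  by apply: connect1; apply/existsP; exists c; rewrite inE Vc cx cy.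
- apply: stab_closed => x; rewrite !pblock_part_join => h1; apply: connect_trans h1 _.
  apply: connect1; apply/existsP; exists (porbit s x).
  by rewrite inE porbit_id mem_porbit_s andbT imset_f ?orbT.
- by have := pblock_refl ord0 pJ; rewrite B0 inE.
rewrite J1 (partition_pblock pJ); apply/setP=> A; rewrite inE;
  apply/imsetP/eqP => [[x _ ->]|->].
  have /and3P[_ tJ _] := pJ; have : x \in pblock J ord0 by rewrite B1 inE.
  by move/(same_pblock tJ) ->; rewrite B1.
by exists ord0.
Qed.

(** With V = 0_s the length condition is equality in the genus bound. The join condition is
    connectedness, because stability under [s] and [g * s^-1] is stability under [s] and [g]. *)
Lemma contributes_porbits g s : contributes g s (porbits s) = connected_planar setT g s.
Proof.
have pP := porbits_partition s; have /andP[_ rP] := pp_perm_subproof s.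
rewrite /contributes pP rP /= /connected_planar; congr (_ && _); last first.
  rewrite /planar !ncycT cardsT card_ord.
  by move: #|porbits s| #|porbits (g * _)| #|porbits g| => k1 k2 k3; apply/eqP/eqP; lia.
apply/(join_oneP _ pP)/connected_onP => h B.
  move=> _ [Bs Bg]; apply: h => [c|]; last by rewrite stabM ?stabV.
  case/imsetP=> z _ -> x y; rewrite -!eq_porbit_mem => /eqP <- /eqP e Bx.
  by apply: (subsetP (porbit_stab_sub Bs Bx)); rewrite -eq_porbit_mem e.
move=> BV Bq; have Bs : stab B s.
  apply: stab_closed => x; apply: (BV (porbit s x)); rewrite ?porbit_id ?mem_porbit_s //.
  exact: imset_f.
apply: h; rewrite ?subsetT //; split=> //; rewrite -(mulgKV s g).
exact: stabM.
Qed.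

(** A single cycle makes the pair connected; the genus bound then gives V at least as many blocks as
    [s] has cycles, and refinement gives at most as many. *)
Lemma contributes_cycle g s V x : porbit g x = setT -> contributes g s V -> V = porbits s.
Proof.
move=> gx /and4P[pV sV _ /eqP e].
have pP := porbits_partition s; have le := refines_card pP pV sV.
have : connected_on setT s g.
  apply/connected_onP=> B _ [_ Bg]; have [->|[y By]] := set_0Vmem B; first by left.
  right; apply/eqP; rewrite -subTset -gx.
  have <- : porbit g y = porbit g x by apply/eqP; rewrite eq_porbit_mem gx inE.
  exact: porbit_stab_sub.
move/(genus_bound (stabT s) (stabT g) (in_setT x)); rewrite !ncycT cardsT card_ord => gen.
have g1 : #|porbits g| = 1%N by rewrite -ncycT -gx ncyc_porbit.
apply: refines_card_eq => //; move: e gen le; rewrite g1.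
by move: #|porbits s| #|porbits (g * _)| #|V| => k1 k2 k3; lia.
Qed.

Section TwoCycles.
Variables (g : 'S_n.+1) (x1 x2 : 'I_n.+1).
Let A1 := porbit g x1.
Let A2 := porbit g x2.
Hypothesis A12 : ~: A1 = A2.

Let A1g : stab A1 g := stab_porbit g x1.
Let A2g : stab A2 g := stab_porbit g x2.
Let A2D : setT :\: A1 = A2. Proof. by rewrite setTD. Qed.

Let g2 : #|porbits g| = 2.
Proof. by rewrite -ncycT (ncycD A1g (subsetT _)) A2D !ncyc_porbit. Qed.

Let stable_cycle B p : stab B g -> p \in B -> porbit g p \subset B.
Proof. exact: porbit_stab_sub. Qed.

Let connected_on_cycle s p : connected_on (porbit g p) s g.
Proof.
apply/connected_onP=> B sB [_ Bg]; have [->|[q Bq]] := set_0Vmem B; first by left.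
right; apply/eqP; rewrite eqEsubset sB.
have := subsetP sB q Bq; rewrite -eq_porbit_mem => /eqP <-; exact: stable_cycle.
Qed.

Definition joining s := [&& stab A1 s, connected_planar A1 g s & connected_planar A2 g s].

(** If V has fewer blocks than [s] has cycles, the length condition violates the genus bound for a
    connected pair, so [s] preserves both cycles of [g]. The bounds on the two cycles are then
    tight, and V has exactly one block less than [s] has cycles. *)
Lemma contributes_two_cycles s V : contributes g s V -> V != porbits s ->
  joining s /\ exists c1 c2,
    [/\ c1 \in cycs A1 s, c2 \in cycs A2 s & V = merge_blocks (porbits s) c1 c2].
Proof.
case/and4P=> pV sV /(join_oneP _ pV) jV /eqP e neV.
have pP := porbits_partition s; have le := refines_card pP pV sV.
have ltV : #|V| < #|porbits s|.
  by rewrite ltn_neqAle le andbT; apply: contraNneq neV => /(refines_card_eq pP pV sV) ->.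
have ncT : ~~ connected_on setT s g.
  apply/negP=> /(genus_bound (stabT s) (stabT g) (in_setT x1));
    rewrite !ncycT cardsT card_ord.
  move: e ltV; rewrite g2.
  by move: #|porbits s| #|porbits (g * _)| #|V| => k1 k2 k3; lia.
have A1s : stab A1 s.
  case/forallPn: ncT => B;
    rewrite negb_imply subsetT negb_or /= => /andP[/andP[Bs Bg] /andP[B0 BT]].
  have BA i : i \in B -> porbit g i \subset B by apply: stable_cycle.
  have cov p : p \in A1 \/ p \in A2.
    by have [h|h] := boolP (p \in A1); [left | right; rewrite -A12 inE].
  have [x1B|x1B] := boolP (x1 \in B).
    suff -> : A1 = B by [].
    apply/eqP; rewrite eqEsubset BA //; apply/subsetP=> p Bp; case: (cov p) => // A2p.
    case/eqP: BT; apply/setP=> q; rewrite inE; case: (cov q) => [A1q|A2q].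
      exact: (subsetP (BA _ x1B)).
    apply: (subsetP (BA _ Bp)); move: A2p A2q; rewrite -!eq_porbit_mem => /eqP -> /eqP ->.
    by rewrite eqxx.
  suff -> : A1 = ~: B by rewrite -setTD stabD ?stabT.
  apply/setP=> q; rewrite inE; apply/idP/idP=> [A1q|].
    apply: contraNN x1B => Bq; apply: (subsetP (BA _ Bq)).
    by rewrite porbit_sym.
  case: (cov q) => // A2q qB; case/set0Pn: B0 => p Bp; case: (cov p) => [A1p|A2p].
    by case/negP: x1B; apply: (subsetP (BA _ Bp)); rewrite porbit_sym.
  case/negP: qB; apply: (subsetP (BA _ Bp)); move: A2p A2q.
  by rewrite -!eq_porbit_mem => /eqP -> /eqP ->; rewrite eqxx.
have A2s : stab A2 s by rewrite -A2D stabD ?stabT.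
have i1 := genus_bound A1s A1g (porbit_id g x1) (connected_on_cycle s x1).
have i2 := genus_bound A2s A2g (porbit_id g x2) (connected_on_cycle s x2).
have card12 : n.+1 = #|A1| + #|A2| by rewrite -A12 cardsC card_ord.
have eS : #|porbits s| = ncyc A1 s + ncyc A2 s
  by rewrite -ncycT (ncycD A1s (subsetT _)) A2D.
have eQ : #|porbits (g * s^-1)| = ncyc A1 (g * s^-1) + ncyc A2 (g * s^-1).
  by rewrite -ncycT (ncycD (stabM A1g (stabV A1s)) (subsetT _)) A2D.
have g1' := ncyc_porbit g x1; have g2' := ncyc_porbit g x2;
  rewrite -/A1 -/A2 in g1' g2' i1 i2.
have [p1 p2 cV] : [/\ planar A1 g s, planar A2 g s & #|V|.+1 = #|porbits s|].
  move: card12 e i1 i2 ltV; rewrite /planar eS eQ g2 g1' g2'.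
  move: (ncyc A1 s) (ncyc A2 s) (ncyc A1 _) (ncyc A2 _) #|A1| #|A2| #|V|.
  by move=> k1 k2 k3 k4 k5 k6 k7 card12 e i1 i2 ltV; clear -card12 e i1 i2 ltV; split;
    [apply/eqP| apply/eqP|]; lia.
split; first by rewrite /joining /connected_planar A1s !connected_on_cycle p1 p2.
have [c1 [c2 [P1 P2 c12 [B VB sB]]]] := refines_card_succ pP pV sV ltV.
have eV : V = merge_blocks (porbits s) c1 c2.
  apply: refines_card_eq => //; first exact: partition_merge.
    by apply: refines_mergeV => //; exists B.
  by apply: succn_inj; rewrite cV card_merge.
have inA c : c \in porbits s -> (c \in cycs A1 s) || (c \in cycs A2 s).
  case/imsetP=> p _ ->; have [A1p|A1p] := boolP (p \in A1); first by rewrite imset_f.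
  by rewrite [X in _ || X]imset_f ?orbT // -A12 inE.
(* If both merged cycles lay on the same side, that side would be separated
   from the other one by the join. *)
have same Ai Aj : stab Ai s -> stab Ai g -> ~: Ai = Aj -> (exists p, p \in Ai) ->
  (exists p, p \in Aj) ->
    c1 \in cycs Ai s -> c2 \in cycs Ai s -> False.
  move=> Ais Aig eAj [p Aip] [q Ajq] /imsetP[y1 Ay1 e1] /imsetP[y2 Ay2 e2].
  have [||A0|AT] := jV Ai.
  - move=> c; rewrite eV => /mem_mergeP h y z; case: h => [->|[/imsetP[w _ ->] _ _]].
      rewrite e1 e2 => _ + _; apply/subsetP.
      by rewrite subUset !porbit_stab_sub.
    rewrite -!eq_porbit_mem => /eqP <- /eqP ez Aiy.
    by apply: (subsetP (porbit_stab_sub Ais Aiy)); rewrite -eq_porbit_mem ez.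
  - by rewrite stabM ?stabV.
  - by rewrite A0 inE in Aip.
  by move: Ajq; rewrite -eAj AT !inE.
have ex1 : exists p, p \in A1 by exists x1; apply: porbit_id.
have ex2 : exists p, p \in A2 by exists x2; apply: porbit_id.
have A21 : ~: A2 = A1 by rewrite -A12 setCK.
case/orP: (inA _ P1) => h1; case/orP: (inA _ P2) => h2.
- by case: (same A1 A2).
- by exists c1, c2.
- exists c2, c1; split=> //; rewrite eV /merge_blocks [c2 :|: c1]setUC; congr (_ |: _).
  by apply/setP=> c; rewrite !inE andbCA.
- by case: (same A2 A1).
Qed.

Lemma contributes_merge s c1 c2 : joining s -> c1 \in cycs A1 s -> c2 \in cycs A2 s ->
  [/\ c1 \in porbits s, c2 \in porbits s, c1 != c2 &
    contributes g s (merge_blocks (porbits s) c1 c2)].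
Proof.
case/and3P=> A1s /andP[cn1 pl1] /andP[cn2 pl2] C1 C2.
have A2s : stab A2 s by rewrite -A2D stabD ?stabT.
have pP := porbits_partition s.
have cP A : cycs A s \subset porbits s.
  by apply/subsetP=> _ /imsetP[p _ ->]; apply: imset_f.
have P1 := subsetP (cP _) _ C1; have P2 := subsetP (cP _) _ C2.
have c12 : c1 != c2.
  have dA : [disjoint A1 & A2] by rewrite -A12 disjoints_subset setCK.
  apply/eqP=> e; move/pred0P/(_ c1): (disjoint_cycs A1s dA).
  by rewrite /= C1 e C2.
split=> //; apply/and4P; split.
- exact: partition_merge.
- exact: refines_merge.
- apply/(join_oneP _ (partition_merge pP P1 P2)) => B BV Bq.
  have Bs : stab B s.
    apply: stab_closed => x Bx.
    have [c mc [xc sxc]] : exists2 c, c \in merge_blocks (porbits s) c1 c2 &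
      x \in c /\ s x \in c.
      have /existsP[c /andP[mc sc]] :=
        implyP (forallP (refines_merge (porbits s) c1 c2) (porbit s x)) (imset_f _ isT).
      by exists c => //; rewrite !(subsetP sc) ?porbit_id ?mem_porbit_s.
    exact: (BV c mc x).
  have Bg : stab B g by rewrite -(mulgKV s g) stabM.
  have BA p : p \in B -> porbit g p \subset B by apply: stable_cycle.
  have Bc x y : x \in c1 :|: c2 -> y \in c1 :|: c2 -> x \in B -> y \in B.
    by apply: BV; apply/mem_mergeP => //; left.
  have [y1 A1y e1] := imsetP C1; have [y2 A2y e2] := imsetP C2.
  have yc1 : y1 \in c1 :|: c2 by rewrite inE e1 porbit_id.
  have yc2 : y2 \in c1 :|: c2 by rewrite inE e2 porbit_id orbT.
  have pA1 p : p \in A1 -> porbit g p = A1 by rewrite -eq_porbit_mem => /eqP.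
  have pA2 p : p \in A2 -> porbit g p = A2 by rewrite -eq_porbit_mem => /eqP.
  (* The merged block carries a stable set from one cycle of [g] to the other. *)
  have full : y1 \in B -> B = setT.
    move=> By1; have By2 := Bc _ _ yc1 yc2 By1.
    apply/eqP; rewrite -subTset -(setUCr A1) A12 subUset.
    by rewrite -{1}(pA1 _ A1y) -{1}(pA2 _ A2y) !BA.
  have [->|[p Bp]] := set_0Vmem B; [by left | right; apply: full].
  have [A1p|A1p] := boolP (p \in A1).
    by apply: (subsetP (BA _ Bp)); rewrite pA1.
  apply: (Bc _ _ yc2 yc1); apply: (subsetP (BA _ Bp)); rewrite pA2 //.
  by rewrite -A12 inE.
have card12 : n.+1 = #|A1| + #|A2| by rewrite -A12 cardsC card_ord.
have eS : #|porbits s| = ncyc A1 s + ncyc A2 s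
  by rewrite -ncycT (ncycD A1s (subsetT _)) A2D.
have eQ : #|porbits (g * s^-1)| = ncyc A1 (g * s^-1) + ncyc A2 (g * s^-1).
  by rewrite -ncycT (ncycD (stabM A1g (stabV A1s)) (subsetT _)) A2D.
have g1' := ncyc_porbit g x1; have g2' := ncyc_porbit g x2; rewrite -/A1 -/A2 in g1' g2'.
have := card_merge pP P1 P2 c12; move: card12 pl1 pl2;
  rewrite /planar g2 eQ g1' g2' eS => card12 /eqP + /eqP; move: card12.
move: (ncyc A1 s) (ncyc A2 s) (ncyc A1 _) (ncyc A2 _) #|A1| #|A2| #|merge_blocks _ _ _|.
by move=> k1 k2 k3 k4 k5 k6 k7 card12 h1 h2 h3; clear -card12 h1 h2 h3; apply/eqP; lia.
Qed.

End TwoCycles.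

End Contributions.

Local Close Scope group_scope.

Local Open Scope ring_scope.

(** * First variation of planar sums in kappa_p *)

Section PerturbedSums.
Variables (T : finType) (K : comNzRingType) (kap : nat -> K) (p : nat).
Implicit Types (s g : {perm T}) (A : {set T}).

Lemma coef1_prod (I : finType) (D : {set I}) (a b : I -> K) :
  (\prod_(i in D) ((a i)%:P + b i *: 'X))`_1 =
  \sum_(i in D) b i * \prod_(j in D | j != i) a j.
Proof.
have [n] := ubnP #|D|; elim: n D => // n IHn D le_n.
have [->|[i Di]] := set_0Vmem D; first by rewrite !big_set0 coefC.
have le_D : (#|D :\ i| < n)%N by move: le_n; rewrite (cardsD1 i) Di.
have c0 : (\prod_(j in D :\ i) ((a j)%:P + b j *: 'X))`_0 = \prod_(j in D :\ i) a j.
  rewrite -horner_coef0 horner_prod; apply: eq_bigr => j _.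
  by rewrite hornerD hornerZ hornerC hornerX mulr0 addr0.
rewrite (big_setD1 i Di) /= coefM big_ord_recl big_ord1 /= IHn // c0.
rewrite !coefD !coefC !coefZ !coefX /= mulr0 mulr1 addr0 add0r.
rewrite (big_setD1 i Di) /=; rewrite [LHS]addrC; congr (_ + _).
  by congr (_ * _); apply: eq_bigl => j; rewrite !inE andbC.
rewrite mulr_sumr; apply: eq_bigr => k; rewrite !inE => /andP[ki Dk].
rewrite mulrCA; congr (_ * _); rewrite [RHS](bigD1 i) ?Di 1?eq_sym //=; congr (_ * _).
by apply: eq_bigl => j; rewrite !inE; case: (j \in D); case: (j == i); case: (j == k).
Qed.

(** The derivative of the weight with respect to kappa_p: a cycle of size p is singled out and its
    factor dropped. *)
Definition dweight A s : K :=
  \sum_(c in cycs A s | #|c| == p) \prod_(d in cycs A s | d != c) kap #|d|.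

Definition dterm A g s : K := if connected_planar A g s then dweight A s else 0.

Lemma coef1_planar_sum A g :
  (planar_sum (fun k => (kap k)%:P + (k == p)%:R * 'X) A g (fun=> 1%N))`_1 =
  \sum_(s | perm_on A s) dterm A g s.
Proof.
rewrite /planar_sum coef_sum; apply: eq_bigr => s _; rewrite /planar_term /dterm;
  case: ifP => _; last by rewrite coef0.
rewrite /weight (eq_bigr (fun c : {set T} => (kap #|c|)%:P + (#|c| == p)%:R *: 'X));
  last first.
  by move=> c _; rewrite sum1_card -mul_polyC polyC_natr.
rewrite coef1_prod /dweight big_mkcondr; apply: eq_bigr => c _.
by case: eqP; rewrite ?mul1r ?mul0r.
Qed.

Lemma dterm_agree A g s s' : stab A g -> stab A s -> {in A, s =1 s'} ->
  dterm A g s = dterm A g s'.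
Proof.
move=> Ag As ss; rewrite /dterm (connected_planar_agree As Ag ss (fun _ _ => erefl)).
by rewrite /dweight (cycs_agree As ss).
Qed.

End PerturbedSums.

(** * Moments as planar sums *)

Section Reduction.
Variables (K : fieldType) (f : forall n, PS n -> K).
Hypothesis f_mult : Defs.multiplicative f.
(** Going through [genfun] makes [kap 0] equal to 1, as the recursions require; cycles are nonempty,
    so their weights are still values of [f]. *)
Let kap := fcoef (genfun (fun n => f (pp_one (gamma n)))).
Let kap2 m n := f (pp_one (gamma2 m n)).

Let kap_card (T : finType) (c : {set T}) : (exists p, p \in c) ->
  kap #|c| = f (pp_one (gamma #|c|)).
Proof. by move/card_gt0P; rewrite /kap /=; case: #|c|. Qed.

Variable n : nat.
Implicit Types (s g : 'S_n.+1).

Let block_weight A s :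
  \prod_(B in cycs A s) block_val f s B = weight kap A s (fun=> 1%N).
Proof.
apply: eq_bigr => _ /imsetP[p _ ->]; rewrite sum1_card block_val_porbit ?kap_card //.
  by exists p; apply: porbit_id.
exact: f_mult.1.
Qed.

Let cycsT s : cycs setT s = porbits s.
Proof. by apply/setP=> C; apply/imsetP/imsetP=> -[p _ ->]; exists p; rewrite ?inE. Qed.

Let planar_sum_setT g : planar_sum kap setT g (fun=> 1%N) =
  \sum_s (if contributes g s (porbits s) then \prod_(B in porbits s) block_val f s B
    else 0).
Proof.
rewrite /planar_sum (eq_bigl xpredT) => [|s]; last by apply/subsetP=> p _; rewrite inE.
by apply: eq_bigr => s _; rewrite contributes_porbits /planar_term -cycsT block_weight.
Qed.

Lemma convolution_one_cycle g x : porbit g x = setT ->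
  convolution f (@zeta K) (pp_one g) = planar_sum kap setT g (fun=> 1%N).
Proof.
move=> gx; rewrite convolution_zeta // planar_sum_setT; apply: eq_bigr => s _.
case: ifP => [cP|ncP].
  rewrite (big_pred1 (porbits s)) // => V.
  by apply/idP/eqP=> [/(contributes_cycle gx)|->].
by rewrite big1 // => V cV; have e := contributes_cycle gx cV; rewrite e ncP in cV.
Qed.

Section TwoCycles.
Variables (g : 'S_n.+1) (x1 x2 : 'I_n.+1).
Let A1 := porbit g x1.
Let A2 := porbit g x2.
Hypothesis A12 : ~: A1 = A2.

Let dA12 : [disjoint A1 & A2].
Proof. by rewrite -A12 disjoints_subset setCK. Qed.

Let cycs_porbits A s : cycs A s \subset porbits s.
Proof. by apply/subsetP=> _ /imsetP[p _ ->]; apply: imset_f. Qed.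

Let prod_merge s c1 c2 : stab A1 s -> c1 \in cycs A1 s -> c2 \in cycs A2 s ->
  \prod_(B in merge_blocks (porbits s) c1 c2) block_val f s B =
  kap2 #|c1| #|c2| * (\prod_(d in cycs A1 s | d != c1) kap #|d|
                    * \prod_(d in cycs A2 s | d != c2) kap #|d|).
Proof.
move=> A1s C1 C2; have dC := disjoint_cycs A1s dA12.
have nC c : c \in cycs A1 s -> c \in cycs A2 s -> False.
  by move=> c1A c2A; move/pred0P/(_ c): dC; rewrite /= c1A c2A.
have c12 : c1 != c2 by apply/eqP=> e; apply: (nC c1); rewrite // e.
have P1 := subsetP (cycs_porbits _ _) _ C1; have P2 := subsetP (cycs_porbits _ _) _ C2.
have pP := porbits_partition s.
rewrite big_setU1 /=; last first.
  by rewrite !inE (negPf (setU_notin pP P1 P2 c12)) !andbF.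
congr (_ * _).
  have [y1 _ e1] := imsetP C1; have [y2 _ e2] := imsetP C2; rewrite e1 e2.
  rewrite block_val_porbit2 //; first exact: f_mult.1.
  by apply: contra_neqN c12; rewrite e1 e2 -eq_porbit_mem eq_sym => /eqP.
transitivity (\prod_(d in [predU [pred d | (d \in cycs A1 s) && (d != c1)] &
  [pred d | (d \in cycs A2 s) && (d != c2)]])
   kap #|d|).
  apply: eq_big => [d|d].
    rewrite !inE -cycsT -(setUCr A1) A12 /cycs imsetU inE -!/(cycs _ _).
    have [d1|d1] := boolP (d \in cycs A1 s);
      have [d2|d2] := boolP (d \in cycs A2 s) => //=.
    - by case: (nC d).
    - rewrite orbF andbT andbC; case: (d != c1) => //=; apply/negP=> /eqP e;
      apply: (nC d) => //.
      by rewrite e.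
    - rewrite andbT; case: (d != c2) => //=; apply/negP=> /eqP e; apply: (nC d) => //.
      by rewrite e.
    by rewrite !andbF.
  rewrite !inE => /and3P[_ _ /imsetP[q _ ->]].
  rewrite block_val_porbit ?kap_card //; first by exists q; apply: porbit_id.
  exact: f_mult.1.
rewrite bigU //=; apply/pred0P=> d /=; rewrite !inE.
by apply/negP=> /andP[/andP[d1 _] /andP[d2 _]]; apply: (nC d).
Qed.

(** The union of c1 and c2 is the one block that is not a cycle of [s], and its traces on [A1] and
    [A2] recover the two cycles. *)
Let merge_inj s : stab A1 s -> {in setX (cycs A1 s) (cycs A2 s) &,
   injective (fun u => merge_blocks (porbits s) u.1 u.2)}.
Proof.
move=> A1s [c1 c2] [d1 d2]; rewrite !inE /= => /andP[C1 C2] /andP[D1 D2] e.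
have dC := disjoint_cycs A1s dA12.
have nC c : c \in cycs A1 s -> c \in cycs A2 s -> False.
  by move=> c1A c2A; move/pred0P/(_ c): dC; rewrite /= c1A c2A.
have c12 : c1 != c2 by apply/eqP=> ec; apply: (nC c1); rewrite // ec.
have P1 := subsetP (cycs_porbits _ _) _ C1; have P2 := subsetP (cycs_porbits _ _) _ C2.
have pP := porbits_partition s.
have /mem_mergeP[eU|[PU _ _]] : c1 :|: c2 \in merge_blocks (porbits s) d1 d2.
- by rewrite -e; apply/mem_mergeP; left.
- have A2s : stab A2 s by rewrite -A12 -setTD stabD ?stabT.
  have sub A c : stab A s -> c \in cycs A s -> c \subset A.
    by move=> As /imsetP[q Aq ->]; apply: porbit_stab_sub.
  have eI (B1 B2 : {set 'I_n.+1}) : B1 \subset A1 -> B2 \subset A2 ->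
    (B1 :|: B2) :&: A1 = B1 /\ (B1 :|: B2) :&: A2 = B2.
    move=> s1 s2; split; apply/setP=> q; have := subsetP s1 q; have := subsetP s2 q;
    by rewrite -A12 !inE; case: (q \in B1); case: (q \in B2);
      case: (q \in A1) => //= h1 h2;
      try have := h1 isT; try have := h2 isT.
  have [i1 i2] := eI _ _ (sub _ _ A1s C1) (sub _ _ A2s C2).
  have [j1 j2] := eI _ _ (sub _ _ A1s D1) (sub _ _ A2s D2).
  by congr (_, _); [rewrite -i1 eU j1 | rewrite -i2 eU j2].
by rewrite (negPf (setU_notin pP P1 P2 c12)) in PU.
Qed.

Let sizes (A : {set 'I_n.+1}) s (u : nat -> K) (w : {set 'I_n.+1} -> K) : stab A s ->
  \sum_(c in cycs A s) u #|c| * w c =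
  \sum_(p < #|A|) u p.+1 * \sum_(c in cycs A s | #|c| == p.+1) w c.
Proof.
move=> As; under [RHS]eq_bigr => p _ do rewrite big_mkcondr mulr_sumr.
rewrite exchange_big /=; apply: eq_bigr => c /imsetP[q Aq ->].
have lt_c : (#|porbit s q|.-1 < #|A|)%N.
  have c0 : (0 < #|porbit s q|)%N by apply/card_gt0P; exists q; apply: porbit_id.
  by rewrite prednK // subset_leq_card // porbit_stab_sub.
have ec : #|porbit s q|.-1.+1 = #|porbit s q|.
  by rewrite prednK //; apply/card_gt0P; exists q; apply: porbit_id.
rewrite (bigD1 (Ordinal lt_c)) //= ec eqxx big1 ?addr0 // => p np.
case: eqP => [e|]; last by rewrite mulr0.
by case/eqP: np; apply: val_inj; rewrite /= e.
Qed.

(** V = 0_s gives the first term. Any other V merges a cycle in [A1] with one in [A2]; once their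
    sizes are fixed, the choices on the two sides are independent, because [s] preserves [A1]. *)
Lemma convolution_two_cycles :
  convolution f (@zeta K) (pp_one g) = planar_sum kap setT g (fun=> 1%N)
  + \sum_(p < #|A1|) \sum_(q < #|A2|) kap2 p.+1 q.+1 *
      ((\sum_(s | perm_on A1 s) dterm kap p.+1 A1 g s)
       * (\sum_(s | perm_on A2 s) dterm kap q.+1 A2 g s)).
Proof.
rewrite convolution_zeta // planar_sum_setT.
transitivity (\sum_s ((if contributes g s (porbits s) then \prod_(B in porbits s)
  block_val f s B else 0)
  + \sum_(V | contributes g s V && (V != porbits s)) \prod_(B in V) block_val f s B)).
  apply: eq_bigr => s _; case: ifP => cP; first by rewrite (bigD1 (porbits s)).
  rewrite add0r; apply: eq_bigl => V; case: eqP => [->|_]; rewrite ?andbT //.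
  by rewrite cP.
rewrite big_split /=; congr (_ + _).
transitivity (\sum_(s | perm_on setT s && stab A1 s) \sum_(p < #|A1|) \sum_(q < #|A2|)
   kap2 p.+1 q.+1 * (dterm kap p.+1 A1 g s * dterm kap q.+1 A2 g s)).
  rewrite [RHS]big_mkcond; apply: eq_bigr => s _.
  have -> : perm_on setT s by apply/subsetP=> p _; rewrite inE.
  rewrite /=.
  have [js|njs] := boolP (joining g x1 x2 s); last first.
    rewrite big1 => [|V /andP[cV nV]]; last first.
      by have [js _] := contributes_two_cycles A12 cV nV; rewrite js in njs.
    case: ifP => // A1s; move: njs; rewrite /joining A1s /= => /nandP ng.
    symmetry; rewrite big1 // => p _; rewrite big1 // => q _; rewrite /dterm.
    by case: ng => /negPf ->; rewrite ?mul0r ?mulr0.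
  have /and3P[A1s g1 g2] := js; rewrite A1s.
  have A2s : stab A2 s by rewrite -A12 -setTD stabD ?stabT.
  transitivity (\sum_(V in [set merge_blocks (porbits s) u.1 u.2 | u in setX (cycs A1 s)
    (cycs A2 s)])
     \prod_(B in V) block_val f s B).
    apply: eq_bigl => V; apply/andP/imsetP => [[cV nV]|[[c1 c2] /setXP[C1 C2] ->]].
      have [_ [c1 [c2 [C1 C2 ->]]]] := contributes_two_cycles A12 cV nV.
      by exists (c1, c2); rewrite ?inE ?C1.
    have [P1 P2 c12 ct] := contributes_merge A12 js C1 C2; split=> //.
    apply/eqP=> e; have := card_merge (porbits_partition s) P1 P2 c12.
    by rewrite e => /eqP; rewrite eqn_leq ltnn.
  rewrite big_imset /=; last exact: merge_inj.
  transitivity (\sum_(c1 in cycs A1 s) \sum_(c2 in cycs A2 s)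
     kap2 #|c1| #|c2| * (\prod_(d in cycs A1 s | d != c1) kap #|d|
                    * \prod_(d in cycs A2 s | d != c2) kap #|d|)).
    rewrite pair_big /=; apply: eq_big => [u|u]; first by rewrite inE.
    by rewrite inE => /andP[C1 C2]; apply: prod_merge.
  pose u2 (p : nat) := \sum_(q < #|A2|) kap2 p q.+1 * dweight kap q.+1 A2 s.
  transitivity (\sum_(c1 in cycs A1 s) u2 #|c1| * \prod_(d in cycs A1 s | d != c1) kap
    #|d|).
    apply: eq_bigr => c1 C1; rewrite /u2 -(sizes (kap2 #|c1|) _ A2s) mulr_suml.
    by apply: eq_bigr => c2 C2; rewrite mulrA mulrAC.
  rewrite (sizes u2 _ A1s); apply: eq_bigr => p _; rewrite /u2 mulr_suml.
  apply: eq_bigr => q _; rewrite /dterm g1 g2 -mulrA; congr (_ * _).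
  by rewrite mulrC.
rewrite exchange_big; apply: eq_bigr => p _; rewrite exchange_big; apply: eq_bigr => q _.
rewrite -mulr_sumr; congr (_ * _).
have eA2 : setT :\: A1 = A2 by rewrite setTD.
have A1g : stab A1 g := stab_porbit g x1; have A2g : stab A2 g := stab_porbit g x2.
rewrite sum_perm_on_prod ?subsetT // eA2 // => s t Bs At; symmetry.
  apply: dterm_agree => //; first exact: stab_perm_on.
  move=> r Br; rewrite permM [t _](out_perm At) //.
  by rewrite -A12 inE (stabE _ (stab_perm_on Bs)) Br.
apply: dterm_agree => //; first exact: stab_perm_on.
by move=> r; rewrite -A12 inE => Br; rewrite permM [s _](out_perm Bs).
Qed.

End TwoCycles.
End Reduction.

Local Close Scope ring_scope.

Local Open Scope ring_scope.

Lemma marked_ones (T : finType) (A : {set T}) x : marked A x 0 (fun=> 1%N).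
Proof. by []. Qed.

(* [GRing.Theory] shadows [Defs.multiplicative]. *)
Import Defs.

Theorem theorem6p3 (R : realType) (f h : forall n : nat, PS n -> complex R)
    (f_mult : multiplicative f) (h_mult : multiplicative h)
    (h_def : forall (n : nat) (u : PS n),
       h n u = convolution f (@zeta (complex R)) u) :
  let kappa (n : nat) := f n (pp_one (gamma n)) in
  let kappa2 (m n : nat) := f (m + n)%N (pp_one (gamma2 m n)) in
  let alpha (n : nat) := h n (pp_one (gamma n)) in
  let alpha2 (m n : nat) := h (m + n)%N (pp_one (gamma2 m n)) in
  let C := genfun kappa in
  let C2 := genfun2 kappa2 in
  let M := genfun alpha in
  let M2 := genfun2 alpha2 in
  let xM := fvar (complex R) * M in
  let x := in_x (fvar (complex R)) in
  let y := in_y (fvar (complex R)) in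
  let F (p : {fps {fps complex R}}) := tofrac p in
  [/\ fcomp C xM = M,
      M2 = fcomp2 (Hseries C C2) (in_x xM) (in_y xM)
             * in_x (fderiv xM / M) * in_y (fderiv xM / M) &
      F M2 = F (fcomp2 C2 (in_x xM) (in_y xM))
               * (F (in_x (fderiv xM)) / F (in_x M))
               * (F (in_y (fderiv xM)) / F (in_y M))
             + F (x * y)
               * (F (in_x (fderiv xM)) * F (in_y (fderiv xM))
                    / (F (in_x xM) - F (in_y xM)) ^+ 2
                  - 1 / (F x - F y) ^+ 2)].
Proof.
move=> kappa kappa2 alpha alpha2 C C2 M M2 xM x y F.
pose kap := fcoef C; have kap0 : kap 0 = 1 by [].
have [D rD] := disc_rec_exists kap; have [D0 DS] := rD.
have [G rG] := annular_rec_exists D; have [G0 GS] := rG.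
(* For each p the recursion is run over polynomials with kappa_p shifted by ['X]; the coefficient of
   ['X] is then the derivative in kappa_p. *)
have [Dt rDt] : exists Dt, forall p : nat, disc_rec (fun k =>
  (kap k)%:P + (k == p)%:R * 'X) (Dt p).
  by have /choice[Dt rDt] := fun p => disc_rec_exists (fun k =>
    (kap k)%:P + (k == p)%:R * 'X); exists Dt.
pose E (p n : nat) := (Dt p 0 n)`_1.
have alphaE n : alpha n.+1 = D 0 n.+1.
  rewrite /alpha h_def (convolution_one_cycle f_mult (porbit_gamma ord0)).
  rewrite -(porbit_gamma ord0) (planar_sum_one_cycle kap0 D0 DS (n :=
    n.+1) _ (marked_ones _ _)) //.
  by rewrite porbit_gamma cardsT card_ord.
have eE p : \fps_n E p.+1 n * M = fderiv xM * xM ^+ p.+1.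
  have eM : disc (fun a n => (Dt p.+1 a n)`_0) 0 = M.
    apply/fpsP=> -[|n] /=; rewrite -(disc_rec_uniq rD (disc_rec_coef0 (rDt p.+1))) ?D0 //.
  by have := perturbation (rDt p.+1); rewrite eM.
have EZ p (T : finType) (g : {perm T}) (z : T) :
  \sum_(s | perm_on (porbit g z) s) dterm kap p.+1 (porbit g z) g s = E p.+1 #|porbit g
    z|.
  have [Dt0 DtS] := rDt p.+1.
  rewrite -coef1_planar_sum (planar_sum_one_cycle _ Dt0 DtS (n :=
    #|porbit g z|) _ (marked_ones _ _)) //.
  (* The perturbed index [p.+1] is positive, so the value at 0 is still 1. *)
  by rewrite kap0 mul0r addr0.
have alpha2E m n : alpha2 m.+1 n.+1 = G 0 m.+1 n.+1 +
    \sum_(p < m.+1) \sum_(q < n.+1) kappa2 p.+1 q.+1 * (E p.+1 m.+1 * E q.+1 n.+1).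
  pose g := gamma2 m.+1 n.+1; pose z1 := lshift n.+1 (ord0 : 'I_m.+1);
    pose z2 := rshift m.+1 (ord0 : 'I_n.+1).
  have A1 : porbit g z1 = left_part m.+1 n.+1 by apply: porbit_gamma2_l.
  have A2 : porbit g z2 = right_part m.+1 n.+1 by apply: porbit_gamma2_r.
  have A12 : ~: porbit g z1 = porbit g z2 by rewrite A1 A2 left_right_setC.
  have c1 : #|porbit g z1| = m.+1 by rewrite A1 card_left_part.
  have c2 : #|porbit g z2| = n.+1 by rewrite A2 card_right_part.
  rewrite /alpha2 h_def (convolution_two_cycles f_mult A12); congr (_ + _).
    rewrite -(setUCr (porbit g z1)) A12.
    rewrite (planar_sum_two_cycles kap0 D0 DS G0 GS (m := m.+1) _ _ (marked_ones _ _)).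
    - exact: (congr1 (G 0 m.+1) c2).
    - exact: c1.
    by rewrite -A12 inE negbK porbit_id.
  transitivity (\sum_(p < #|porbit g z1|) \sum_(q < #|porbit g z2|)
      kappa2 p.+1 q.+1 * (E p.+1 #|porbit g z1| * E q.+1 #|porbit g z2|)).
    apply: eq_bigr => p _; apply: eq_bigr => q _; congr (_ * (_ * _)); exact: EZ.
  by rewrite c1 c2.
have char0 k : k.+1%:R != 0 :> complex R by rewrite Num.Theory.pnatr_eq0.
split.
- exact: (first_order rD alphaE).
- exact: (second_order_H char0 rD rG alphaE eE alpha2E).
exact: (second_order_frac rD rG alphaE eE alpha2E).
Qed.
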